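(* Let $(G,K)$ be a Gelfand pair and let $\alpha$ be a topological automorphism of $G$. Let $\theta\in L^2(G//K)$ be such that $\|\theta\|_{L^2(G//K)}=1$. If $u\in L^1(G\times\mathcal{S}^+)$, then the localization operator $\mathcal{L}_{\theta,\alpha}^{u}:L^2(G//K)\to L^2(G//K)$ is bounded and $$\|\mathcal{L}_{\theta,\alpha}^{u}\|\leq\|u\|_{L^1(G\times\mathcal{S}^+)}.$$
   Context: $G$ is a locally compact Hausdorff group with left Haar measure $dx$, and $K$ is a compact subgroup. A function $f$ on $G$ is $K$-bi-invariant if $f(kxk')=f(x)$ for all $x\in G$, $k,k'\in K$. $\mathcal{C}_c(G//K)$ is the space of continuous compactly supported $K$-bi-invariant complex functions, and $L^p(G//K)$ is the space of $K$-bi-invariant elements of $L^p(G)$, with the norm of $L^p(G)$; the inner product $\langle f,g\rangle_{L^2(G//K)}$ means $\int_G f\overline{g}\,dx$. $(G,K)$ is a Gelfand pair if $\mathcal{C}_c(G//K)$ is commutative under convolution $(f\ast g)(x)=\int_G f(y)g(y^{-1}x)dy$ (then $G$ is unimodular). A spherical function is a continuous $K$-bi-invariant function $\varphi$ on $G$ such that $f\mapsto\int_G f(x)\varphi(x)dx$ is a nontrivial character of the convolution algebra $\mathcal{C}_c(G//K)$. $\mathcal{S}_b(G,K)$ is the set of bounded spherical functions, and $\mathcal{S}^+\subset\mathcal{S}_b(G,K)$ is the set of positive-definite spherical functions. The spherical Fourier transform of $f\in L^1(G//K)$ is $\widehat f(\varphi)=\int_G f(x)\varphi(x^{-1})dx$.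 $\mathcal{S}_b(G,K)$ has the weak topology generated by the maps $\widehat f$, $f\in L^1(G//K)$. $\mathcal{S}^+$ carries the Plancherel measure, denoted $d\varphi$: the positive Radon measure such that, whenever $f\in L^1(G//K)$ is a linear combination of positive-definite $K$-bi-invariant functions, $\widehat f\in L^1(\mathcal{S}^+)$ and $f(x)=\int_{\mathcal{S}^+}\widehat f(\varphi)\varphi(x)\,d\varphi$; the map $f\mapsto \widehat f$ on $L^1(G//K)\cap L^2(G//K)$ extends to an isometry of $L^2(G//K)$ onto $L^2(\mathcal{S}^+)$. $L^p(G\times\mathcal{S}^+)$ is taken with respect to $dt\,d\varphi$. For a topological automorphism $\alpha$ of $G$, $\delta_\alpha>0$ is the constant with $d(\alpha(x))=\delta_\alpha dx$, i.e. $\int_G f(\alpha(x))dx=\delta_\alpha^{-1}\int_G f(x)dx$. For $\theta\in L^2(G//K)$, $t\in G$, $\varphi\in\mathcal{S}_b(G,K)$, put $\theta_{\alpha,\varphi,t}(x)=\delta_\alpha^{1/2}\varphi(x)\theta(\alpha(t^{-1}x))$. The Stockwell transform is $S_{\theta,\alpha}f(t,\varphi)=\langle f,\theta_{\alpha,\varphi,t}\rangle_{L^2(G//K)}=\delta_\alpha^{1/2}\int_G f(x)\overline{\varphi(x)\theta(\alpha(t^{-1}x))}\,dx$ for $f\in L^2(G//K)$. For a measurable $u:G\times\mathcal{S}^+\to\mathbb{C}$, the localization operator is defined for $f\in L^2(G//K)$ by $$\mathcal{L}_{\theta,\alpha}^{u}f(x)=\int_{\mathcal{S}^+}\int_G u(t,\varphi)\,S_{\theta,\alpha}f(t,\varphi)\,\theta_{\alpha,\varphi,t}(x)\,dt\,d\varphi,\quad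 x\in G.$$ $\|\cdot\|$ without subscript is the operator norm.
   Formalization: Since the localization operator need not have K-bi-invariant values, it is shown to be bounded from L²(G//K) to L²(G) with norm at most ‖u‖₁; its compression to L²(G//K), defined by the same inner products with bi-invariant functions, is bounded there with the same bound. *)

(* Defs.v *)
From HB Require Import structures.
From mathcomp Require Import all_boot all_order all_algebra.
From mathcomp Require Import complex.
From mathcomp Require Import all_classical all_reals all_analysis.
From mathcomp Require Import measurable_realfun.

Set Implicit Arguments.
Unset Strict Implicit.
Unset Printing Implicit Defensive.

Import Order.TTheory GRing.Theory Num.Theory.
Import numFieldNormedType.Exports.

Local Open Scope classical_set_scope.
Local Open Scope ring_scope.
Local Open Scope complex_scope.

HB.mixin Record isTopologicalGroup G & Group G & PointedTopological G := {
  mulg_continuous : continuous (fun xy : G * G => (xy.1 * xy.2)%g) ;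
  invg_continuous : continuous (fun x : G => (x^-1)%g)
}.

#[short(type="topologicalGroupType")]
HB.structure Definition TopologicalGroup :=
  {G of Group G & PointedTopological G & isTopologicalGroup G}.

HB.instance Definition _ (X Y : ptopologicalType) := Pointed.on (X * Y)%type.

Definition borel (T : ptopologicalType) :
    measurableType (sigma_display (@open T)) :=
  g_sigma_algebraType (@open T).

(* C carries the topology of R[i]^o, given by its modulus. *)
Definition ccontinuous {R : realType} {T : topologicalType} (f : T -> R[i]) :=
  continuous (f : T -> R[i]^o).

Definition Cc {R : realType} {T : topologicalType} : set (T -> R[i]) :=
  [set f | ccontinuous f /\ compact (closure [set x | f x != 0])].

Section complex_integration.
Context {d : measure_display} {T : measurableType d} {R : realType}.
Variable m : {measure set T -> \bar R}.
Implicit Types f g : T -> R[i].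

Definition cmeasurable f :=
  measurable_fun setT (fun x => complex.Re (f x)) /\
  measurable_fun setT (fun x => complex.Im (f x)).

Definition cintegrable f :=
  m.-integrable setT (fun x => (complex.Re (f x))%:E) /\
  m.-integrable setT (fun x => (complex.Im (f x))%:E).

(* Total: only meaningful when [cintegrable f] holds. *)
Definition cintegral f : R[i] :=
  Rintegral m setT (fun x => complex.Re (f x)) +i*
  Rintegral m setT (fun x => complex.Im (f x)).

Definition cLnorm (p : R) f : \bar R :=
  Lnorm m p%:E (fun x => (ComplexField.Normc.normc (f x))%:E).

Definition cLp (p : R) : set (T -> R[i]) :=
  [set f | cmeasurable f /\ (cLnorm p f < +oo)%E].

Definition inner f g : R[i] := cintegral (fun x => f x * conjc (g x)).

(* Operators between spaces of (classes of) square-integrable functions are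
   given by maps on representatives; linearity is up to a null set. *)
Definition opnorm (E : set (T -> R[i])) (L : (T -> R[i]) -> (T -> R[i])) :
    \bar R :=
  ereal_sup [set cLnorm 2 (L f) | f in [set f | E f /\ (cLnorm 2 f <= 1)%E]].

Definition bounded_operator (E F : set (T -> R[i]))
    (L : (T -> R[i]) -> (T -> R[i])) :=
  [/\ forall f, E f -> F (L f),
      forall (a b : R[i]) f g, E f -> E g ->
        {ae m, forall x, L (fun y => a * f y + b * g y) x =
                         a * L f x + b * L g x} &
      (opnorm E L < +oo)%E].

End complex_integration.

(* Radon measures on a Hausdorff space. *)
Definition radon {R : realType} (T : ptopologicalType)
    (m : {measure set (borel T) -> \bar R}) :=
  [/\ forall A : set T, compact A -> (m A < +oo)%E,
      forall A : set T, measurable (A : set (borel T)) ->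
        m A = ereal_inf [set m U | U in [set U : set T | open U /\ A `<=` U]] &
      forall U : set T, open U ->
        m U = ereal_sup
                [set m A | A in [set A : set T | compact A /\ A `<=` U]]].

(* The product of Radon measures as a Radon measure on the topological product:
   the library's product measure is a measure only in the sigma-finite case,
   and its sigma-algebra can be smaller than the Borel one. *)
Definition radon_product {R : realType} {X Y : ptopologicalType}
    (m : {measure set (borel X) -> \bar R})
    (n : {measure set (borel Y) -> \bar R})
    (p : {measure set (borel (X * Y)%type) -> \bar R}) :=
  @radon R (X * Y)%type p /\
  forall F : X * Y -> R[i], Cc F ->
    cintegral p F = cintegral n (fun y => cintegral m (fun x => F (x, y))).

Section harmonic_analysis.
Context {R : realType} {G : topologicalGroupType}.
Variable mu : {measure set (borel G) -> \bar R}.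
Variable K : set G.
Implicit Types (f g phi : G -> R[i]).

Definition left_haar :=
  [/\ radon mu,
      mu setT != 0%E &
      forall (y : G) (A : set G), measurable (A : set (borel G)) ->
        mu [set (y * x)%g | x in A] = mu A].

Definition compact_subgroup :=
  [/\ compact K, K 1%g, {in K &, forall x y, K (x * y)%g} &
      {in K, forall x, K (x^-1)%g}].

Definition biinvariant f :=
  forall x k k', K k -> K k' -> f (k * x * k')%g = f x.

Definition CcK : set (G -> R[i]) := [set f | Cc f /\ biinvariant f].

Definition LpK (p : R) : set (G -> R[i]) := [set f | cLp mu p f /\ biinvariant f].

Definition convolution f g : G -> R[i] :=
  fun x => cintegral mu (fun y => f y * g (y^-1 * x)%g).

Definition gelfand_pair :=
  forall f g, CcK f -> CcK g -> convolution f g = convolution g f.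

(* f |-> \int f phi is linear, so only multiplicativity and nontriviality
   need to be required for it to be a nontrivial character. *)
Definition spherical : set (G -> R[i]) :=
  [set phi | [/\ ccontinuous phi, biinvariant phi,
    forall f g, CcK f -> CcK g ->
      cintegral mu (fun x => convolution f g x * phi x) =
      cintegral mu (fun x => f x * phi x) *
      cintegral mu (fun x => g x * phi x) &
    exists2 f, CcK f & cintegral mu (fun x => f x * phi x) != 0]].

Definition bounded_spherical : set (G -> R[i]) :=
  [set phi | spherical phi /\
    exists M : R, forall x, ComplexField.Normc.normc (phi x) <= M].

Definition positive_definite phi :=
  forall (n : nat) (c : 'I_n -> R[i]) (x : 'I_n -> G),
    0 <= \sum_(i < n) \sum_(j < n)
           c i * conjc (c j) * phi ((x j)^-1 * x i)%g.

Definition spherical_fourier f phi : R[i] :=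
  cintegral mu (fun x => f x * phi (x^-1)%g).

(* The weak topology generated by the maps spherical_fourier f, f in L^1(G//K);
   it is put on all functions and only used on sets of spherical functions. *)
Definition weak_space :=
  initial_topology
    (fun phi : G -> R[i] =>
       (fun f : LpK 1 => spherical_fourier (val f) phi)
         : {ptws (LpK 1) -> R[i]^o}).

Definition Splus : set (G -> R[i]) :=
  [set phi | bounded_spherical phi /\ positive_definite phi].

(* S^+ always contains the constant function 1, so that the second disjunct is
   void: it is there because measurable types have to be inhabited. *)
Definition Splus_inhabited : set weak_space :=
  [set phi | Splus phi \/ (Splus = set0 /\ phi = cst 0)].

Definition Splus_type := set_type Splus_inhabited.

Lemma Splus_inhabited_nonempty : exists phi : Splus_type, True.
Proof.
have [S0|/set0P[phi Sphi]] := eqVneq Splus set0.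
  by exists (exist _ (cst 0 : weak_space) (mem_set (or_intror (conj S0 erefl)))).
by exists (exist _ (phi : weak_space) (mem_set (or_introl Sphi))).
Qed.

HB.instance Definition _ :=
  Topological.copy Splus_type (set_type Splus_inhabited).
HB.instance Definition _ :=
  isPointed.Build Splus_type (projT1 (cid Splus_inhabited_nonempty)).

Definition Splus_fun (phi : Splus_type) : G -> R[i] := val phi.

(* Positive-definite functions are required to be continuous here: inversion
   at every point fails for discontinuous ones. *)
Definition pd_span : set (G -> R[i]) :=
  [set f | exists (n : nat) (c : 'I_n -> R[i]) (p : 'I_n -> G -> R[i]),
    (forall i, [/\ ccontinuous (p i), biinvariant (p i) &
                   positive_definite (p i)]) /\
    f = fun x => \sum_(i < n) c i * p i x].

Definition plancherel (nu : {measure set (borel Splus_type) -> \bar R}) :=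
  radon nu /\
  forall f, LpK 1 f -> pd_span f ->
    cLp nu 1 (fun s => spherical_fourier f (Splus_fun s)) /\
    forall x, f x =
      cintegral nu (fun s => spherical_fourier f (Splus_fun s) *
                               Splus_fun s x).

Definition topological_automorphism (alpha : G -> G) :=
  [/\ {morph alpha : x y / (x * y)%g}, continuous alpha &
      exists beta : G -> G,
        [/\ cancel alpha beta, cancel beta alpha & continuous beta]].

(* d(alpha(x)) = delta dx *)
Definition modulus (alpha : G -> G) (delta : R) :=
  0 < delta /\
  forall f : borel G -> \bar R, measurable_fun [set: borel G] f ->
    (forall x, 0 <= f x)%E ->
    (\int[mu]_x f (alpha x) = (delta^-1)%:E * \int[mu]_x f x)%E.

Definition atom (theta : G -> R[i]) (alpha : G -> G) (delta : R)
    phi (t : G) : G -> R[i] :=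
  fun x => (Num.sqrt delta)%:C * phi x * theta (alpha (t^-1 * x)%g).

Definition stockwell (theta : G -> R[i]) (alpha : G -> G) (delta : R)
    f (t : G) phi : R[i] :=
  inner mu f (atom theta alpha delta phi t).

Definition localization_integrand (theta : G -> R[i]) (alpha : G -> G)
    (delta : R) (u : G * Splus_type -> R[i]) f (x : G) :
    G * Splus_type -> R[i] :=
  fun tp => u tp * stockwell theta alpha delta f tp.1 (Splus_fun tp.2) *
            atom theta alpha delta (Splus_fun tp.2) tp.1 x.

(* rho is the measure dt dphi on G x S^+. *)
Definition localization
    (rho : {measure set (borel (G * Splus_type)%type) -> \bar R})
    (theta : G -> R[i]) (alpha : G -> G) (delta : R)
    (u : G * Splus_type -> R[i]) f : G -> R[i] :=
  fun x => cintegral rho (localization_integrand theta alpha delta u f x).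

End harmonic_analysis.

(* Main.v *)
From HB Require Import structures.
Require Import Defs.
From mathcomp Require Import all_boot all_order all_algebra.
From mathcomp Require Import complex.
From mathcomp Require Import all_classical all_reals all_analysis.
From mathcomp Require Import measurable_realfun.
From mathcomp Require Import ring lra.

Set Implicit Arguments.
Unset Strict Implicit.
Unset Printing Implicit Defensive.

Import Order.TTheory GRing.Theory Num.Theory.
Import numFieldNormedType.Exports.

Local Open Scope classical_set_scope.
Local Open Scope ring_scope.

(** Write [ev s] for the spherical function of a point [s] of [S^+], [z = (t, s)]
    for a point of [G * S^+], and [W] for the function
    [sqrt delta * |theta o alpha|], which has norm [1] in [L^2(G)].

    Size of the operator.  As [|ev s| <= 1], the atom at [z] is at most
    [W (t^-1 x)] in absolute value, so it has norm at most [1] and Cauchy-Schwarz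
    gives [|S f (z)| <= |f|].  The integral of [|u| |S f| |atom|] at the point [x]
    is therefore at most [|f|] times the integral of [|u (z)| W (t^-1 x)] against
    [rho], which by Cauchy-Schwarz for the finite measure [|u| rho] is at most
    [|u|_1^(1/2) E(x)^(1/2)] with [E(x)] the integral of [|u (z)| W (t^-1 x)^2].
    By Tonelli and the left invariance of Haar measure, [E] has integral at most
    [|u|_1].  So [E] is finite almost everywhere, the integral that defines the
    operator converges absolutely there, and [L f] has norm at most [|u|_1 |f|].
    Off this conull set, which does not depend on [f], [L f] is put equal to [0],
    so that [L] is linear everywhere.

    Measurability.  [G] and [S^+] need not be second countable, nor [mu]
    sigma-finite, so that the Borel sets of a product need not be generated by
    rectangles and Fubini's theorem does not apply to them.  What replaces it:
    - Sections of an open set have lower semicontinuous measure, by inner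
      regularity and compactness.  Hence [x |-> \int F (x, z) dm(z)] is Borel for
      Borel [F] when [m] is finite, and also when all the sections of [F] vanish
      with one integrable weight ([measurable_section_integral_real]).  This
      applies to [S f], with the weight [|f|^2], and to [L f], with the weight
      [|u|].
    - For an open set, one inequality of Tonelli's theorem holds: countably many
      rectangles inside it fill almost all its sections up to a null set
      ([tonelli_open]).  With the outer regularity of Haar measure this is enough
      to bound the integral of [E] ([translate_tonelli]).

    Continuity on [S^+].  The integrands are Borel because [(x, s) |-> ev s x] is
    jointly continuous ([Splus_near]).  A bounded spherical function is [1] at the
    unit ([bounded_spherical1]), because bi-invariant bumps near the unit are an
    approximate identity.  Krein's inequality then bounds the oscillation of a
    positive-definite spherical function by its behaviour near [1], and that
    behaviour is controlled, for all [s] in a neighbourhood of a given point, by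
    one value of the Fourier transform ([Splus_near1]): a function bounded by [1]
    whose mean on a set is nearly [1] is nearly [1] on most of the set.

    Compression.  [L'] is [L] followed by the orthogonal projection of [L^2(G)]
    onto the bi-invariant functions.  It is the almost-everywhere limit of a
    minimizing sequence ([L2_projection]), chosen so as to be bi-invariant at every
    point. *)

Local Notation normc := ComplexField.Normc.normc.
Local Notation Re := complex.Re.
Local Notation Im := complex.Im.

(** * Borel sets and measures with a density *)

Section borel_space.
Context {R : realType}.
Implicit Types X Y : ptopologicalType.

Lemma open_borel X (A : set X) : open A -> measurable (A : set (borel X)).
Proof. exact: sub_sigma_algebra. Qed.

Lemma closed_borel X (A : set X) : closed A -> measurable (A : set (borel X)).
Proof.
by move=> cA; rewrite -(setCK A); apply: measurableC; apply: open_borel;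
  rewrite openC.
Qed.

Lemma compact_borel X (A : set X) : hausdorff_space X -> compact A ->
  measurable (A : set (borel X)).
Proof. by move=> hX cA; apply: closed_borel; exact: compact_closed. Qed.

Lemma continuous_borel X Y (f : X -> Y) : continuous f ->
  measurable_fun [set: borel X] (f : borel X -> borel Y).
Proof.
move=> /continuousP cf.
apply: (@measurability _ _ (borel X) (borel Y) setT _ (@open Y)) => //.
by move=> _ [A oA <-]; rewrite setTI; apply: open_borel; exact: cf.
Qed.

Lemma continuous_borel_real X (f : X -> R) : continuous f ->
  measurable_fun [set: borel X] (f : borel X -> R).
Proof.
move=> /continuousP cf.
apply: (measurability _ (RGenOInfty.measurableE R)).
move=> _ [_ [a ->] <-]; rewrite setTI; apply: open_borel; apply: cf.
exact: interval_open.
Qed.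

End borel_space.

Section ge0_measurable_ind.
Import HBNNSimple.

(** Functional form of the approximation of nonnegative measurable functions
    by simple functions. *)
Lemma ge0_measurable_ind d (T : measurableType d) (R : realType)
    (P : (T -> \bar R) -> Prop) :
  (forall A, measurable A -> P (fun x => (\1_A x)%:E)) ->
  (forall (c : R) f, 0 <= c -> measurable_fun setT f ->
     (forall x, 0 <= f x)%E -> P f -> P (fun x => c%:E * f x)%E) ->
  (forall f g, measurable_fun setT f -> measurable_fun setT g ->
     (forall x, 0 <= f x)%E -> (forall x, 0 <= g x)%E ->
     P f -> P g -> P (fun x => f x + g x)%E) ->
  (forall f : (T -> \bar R)^nat, (forall n, measurable_fun setT (f n)) ->
     (forall n x, 0 <= f n x)%E ->
     (forall x, nondecreasing_seq (f ^~ x)) -> (forall n, P (f n)) ->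
     P (fun x => limn (f ^~ x))) ->
  forall f, measurable_fun setT f -> (forall x, 0 <= f x)%E -> P f.
Proof.
move=> P1 PZ PD Plim f mf f0.
pose h := nnsfun_approx measurableT mf.
have -> : f = fun x => limn (fun n => (h n x)%:E).
  by apply/funext => x; apply/esym/cvg_lim => //; exact: cvg_nnsfun_approx.
apply: (Plim (fun n x => (h n x)%:E)).
- by move=> n; exact/measurable_EFinP.
- by move=> n x; rewrite lee_fin.
- by move=> x a b ab; rewrite lee_fin; exact/lefP/nd_nnsfun_approx.
move=> n; move: (h n) => g {h}.
pose s := finmap.enum_fset (fset_set (range g)).
have -> : (fun x => (g x)%:E) =
    (fun x => \sum_(y <- s) (y * \1_(g @^-1` [set y]) x)%:E)%E.
  apply/funext => x; rewrite [in LHS](fimfunE g x) -fsumEFin//.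
  by rewrite fsbig_finite.
have s0 : all (fun y => 0 <= y) s.
  apply/allP => y; rewrite in_fset_set// inE => -[x _ <-].
  exact: fun_ge0.
have PZ1 y : 0 <= y -> P (fun x => (y * \1_(g @^-1` [set y]) x)%:E).
  move=> y0; apply: (PZ y (fun x => (\1_(g @^-1` [set y]) x)%:E)) => //.
  - by apply/measurable_EFinP; exact: measurable_indic.
  - exact: P1.
have [] // : [/\ P (fun x => \sum_(y <- s) (y * \1_(g @^-1` [set y]) x)%:E)%E,
   measurable_fun setT
     (fun x => \sum_(y <- s) (y * \1_(g @^-1` [set y]) x)%:E)%E &
   forall x, (0 <= \sum_(y <- s) (y * \1_(g @^-1` [set y]) x)%:E)%E].
elim: s s0 => [_|y s ih /= /andP[y0 s0]].
  rewrite (_ : (fun _ => _) = (fun x => (\1_(@set0 T) x)%:E)); last first.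
    by apply/funext => x; rewrite big_nil indicE in_set0.
  split; first exact: P1.
    by apply/measurable_EFinP; exact: measurable_indic.
  by move=> x; rewrite big_nil.
have [ih1 ih2 ih3] := ih s0.
under eq_fun do rewrite big_cons.
have my : measurable_fun setT (fun x => (y * \1_(g @^-1` [set y]) x)%:E).
  apply/measurable_EFinP; apply: measurable_funM => //.
have y1 x : (0 <= (y * \1_(g @^-1` [set y]) x)%:E)%E.
  by rewrite lee_fin mulr_ge0.
split; first by apply: PD => //; exact: PZ1.
- exact: emeasurable_funD.
- by move=> x; rewrite big_cons adde_ge0.
Qed.

End ge0_measurable_ind.

Section density.
Context d (T : measurableType d) (R : realType).
Variables (m : {measure set T -> \bar R}) (v : T -> R).
Hypotheses (v0 : forall x, 0 <= v x) (mv : measurable_fun setT v).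
Local Open Scope ereal_scope.

(** The proofs are arguments so that the measure structure below is found from
    the term alone. *)
Definition density of (forall x, (0 <= v x)%R) & measurable_fun setT v :=
  fun A : set T => \int[m]_(x in A) (v x)%:E.

Local Notation dm := (density v0 mv).

Let density0 : dm set0 = 0.
Proof. exact: integral_set0. Qed.

Let density_ge0 A : 0 <= dm A.
Proof. by apply: integral_ge0 => x _; rewrite lee_fin. Qed.

Let density_sigma_additive : semi_sigma_additive dm.
Proof.
move=> F mF tF mUF; rewrite /density ge0_integral_bigcup//.
- apply: is_cvg_ereal_nneg_natsum_cond => n _ _.
  by apply: integral_ge0 => x _; rewrite lee_fin.
- by apply/measurable_EFinP; exact: measurable_funTS.
- by move=> x _; rewrite lee_fin.
Qed.

HB.instance Definition _ := isMeasure.Build _ _ _ dm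
  density0 density_ge0 density_sigma_additive.

Lemma ge0_integral_density (f : T -> \bar R) :
  measurable_fun setT f -> (forall x, 0 <= f x) ->
  \int[dm]_x f x = \int[m]_x (f x * (v x)%:E).
Proof.
have mev : measurable_fun setT (fun x => (v x)%:E) by exact/measurable_EFinP.
have ev0 x : 0 <= (v x)%:E by rewrite lee_fin.
move: f; apply: ge0_measurable_ind.
- move=> A mA; rewrite integral_indic// setIT /= /density integral_mkcond.
  apply: eq_integral => x _; rewrite patchE indicE.
  by case: ifP; rewrite ?mul1e ?mul0e.
- move=> c f c0 mf f0 ih.
  rewrite ge0_integralZl_EFin// ih -ge0_integralZl_EFin//.
  + by apply: eq_integral => x _; rewrite muleA.
  + by move=> x _; rewrite mule_ge0.
  + exact: emeasurable_funM.
- move=> f g mf mg f0 g0 ihf ihg.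
  rewrite ge0_integralD// ihf ihg -ge0_integralD//.
  + by apply: eq_integral => x _; rewrite ge0_muleDl.
  + by move=> x _; rewrite mule_ge0.
  + exact: emeasurable_funM.
  + by move=> x _; rewrite mule_ge0.
  + exact: emeasurable_funM.
- move=> f mf f0 ndf ih.
  rewrite monotone_convergence//.
  under eq_fun do rewrite ih.
  rewrite -monotone_convergence//.
  + apply: eq_integral => x _; apply/cvg_lim => //.
    apply: cvgeZr => //.
    by apply: ereal_nondecreasing_is_cvgn; exact: ndf.
  + by move=> n; exact: emeasurable_funM.
  + by move=> n x _; rewrite mule_ge0.
  + by move=> x _ a b ab; rewrite lee_wpmul2r//; exact: ndf.
Qed.

End density.

(** * Inner regularity of Radon measures *)

(** The condition on open sets in [radon], extended to Borel sets of finite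
    measure; this is the form that is stable under passing to a density. *)
Definition inner_regular (R : realType) (T : ptopologicalType)
    (m : {measure set (borel T) -> \bar R}) :=
  forall A : set T, measurable (A : set (borel T)) -> (m A < +oo)%E ->
  forall e : R, 0 < e ->
  exists C : set T, [/\ compact C, C `<=` A & (m A <= m C + e%:E)%E].

Section radon_regularity.
Context {R : realType} {T : ptopologicalType}.
Variable m : {measure set (borel T) -> \bar R}.
Hypotheses (hT : hausdorff_space T) (rm : radon m).
Local Open Scope ereal_scope.
Implicit Types A : set T.

Lemma radon_outer A (e : R) : measurable (A : set (borel T)) ->
  m A < +oo -> (0 < e)%R ->
  exists U : set T, [/\ open U, A `<=` U & m U < m A + e%:E].
Proof.
move=> mA Aoo e0; have [_ outer _] := rm.
have fA : m A \is a fin_num by rewrite ge0_fin_numE.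
have := lb_ereal_inf_adherent e0.
move=> /(_ [set m U | U in [set U : set T | open U /\ A `<=` U]]).
rewrite -(outer _ mA) => /(_ fA) [_ [U [oU AU] <-] UA].
by exists U.
Qed.

Lemma radon_inner_open A (e : R) : open A -> m A < +oo -> (0 < e)%R ->
  exists C : set T, [/\ compact C, C `<=` A & m A < m C + e%:E].
Proof.
move=> oA Aoo e0; have [_ _ inner] := rm.
have fA : m A \is a fin_num by rewrite ge0_fin_numE.
have := ub_ereal_sup_adherent e0.
move=> /(_ [set m U | U in [set U : set T | compact U /\ U `<=` A]]).
rewrite -(inner _ oA) => /(_ fA) [_ [U [oU AU] <-] UA].
by exists U; split => //; rewrite -lteBlDr.
Qed.

(** Take [U] open around [A] and [C] compact in [U], both nearly of the measure of
    [A], and remove from [C] an open set around [U \ A] of small measure. *)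
Lemma radon_inner_regular : inner_regular m.
Proof.
move=> A mA Aoo e e0.
have e30 : (0 < e / 3)%R by rewrite divr_gt0.
have [U [oU AU UA]] := radon_outer mA Aoo e30.
have Uoo : m U < +oo by rewrite (lt_trans UA)// lte_add_pinfty// ltry.
have [C [cC CU UC]] := radon_inner_open oU Uoo e30.
have mU := open_borel oU.
have mUA : measurable (U `\` A : set (borel T)) by exact: measurableD.
have fA : m A \is a fin_num by rewrite ge0_fin_numE.
have UAe : m (U `\` A) < (e / 3)%:E.
  rewrite measureD// setIidr//.
  by rewrite lteBlDl.
have UAoo : m (U `\` A) < +oo by rewrite (lt_trans UAe)// ltry.
have [W [oW UAW WUA]] := radon_outer mUA UAoo e30.
have mW := open_borel oW.
have mC := compact_borel hT cC.
have mCW : measurable (C `\` W : set (borel T)) by exact: measurableD.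
exists (C `\` W); split.
- by apply: compact_closedI => //; rewrite closedC.
- move=> x [Cx nWx]; apply: contrapT => nAx; apply: nWx; apply: UAW.
  by split=> //; exact: CU.
have We : m W <= (e / 3 + e / 3)%:E.
  by rewrite (le_trans (ltW WUA))// EFinD leeD2r// ltW.
apply: (@le_trans _ _ (m U)); first by apply: le_measure => //; rewrite inE.
apply: (le_trans (ltW UC)).
apply: (@le_trans _ _ (m (C `\` W) + m W + (e / 3)%:E)).
  rewrite leeD2r// (measureDI m mC mW) leeD2l//.
  by apply: le_measure => //; rewrite inE//; exact: measurableI.
rewrite -addeA leeD2l// (le_trans (leeD2r _ We))// -EFinD lee_fin.
lra.
Qed.

(** The set where [v] is at least [1/n] has finite measure, so that inner
    regularity applies to its part in [A]; for large [n] the rest of [A] carries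
    little of [v m], and absolute continuity of the integral turns a small
    [m]-measure into a small [v m]-measure. *)
Lemma density_inner_regular (v : borel T -> R) (v0 : forall x, (0 <= v x)%R)
    (mv : measurable_fun setT v) :
  \int[m]_x (v x)%:E < +oo -> inner_regular (density m v0 mv).
Proof.
move=> voo A mA _ e e0.
have mev : measurable_fun setT (EFin \o v) by exact/measurable_EFinP.
have iv : m.-integrable setT (EFin \o v).
  apply/integrableP; split => //.
  by under eq_integral do rewrite /= ger0_norm//.
have e20 : (0 < e / 2)%R by rewrite divr_gt0.
have [r [r0 rP]] := integral_normr_continuous iv e20.
pose B n : set (borel T) := A `&` [set x | (n.+1%:R^-1 <= v x)%R].
have mB n : measurable (B n).
  rewrite /B; apply: measurableI => //.
  have := emeasurable_fun_c_infty measurableT mev (n.+1%:R^-1)%:E.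
  by rewrite setTI; under eq_set do rewrite lee_fin.
pose dm : {measure set (borel T) -> \bar R} := density m v0 mv.
have dfin D : measurable (D : set (borel T)) -> dm D < +oo.
  move=> mD; apply: le_lt_trans voo.
  by apply: ge0_subset_integral => // x _; rewrite lee_fin.
have ndB : nondecreasing_seq B.
  move=> a b ab; apply/subsetPset => x [Ax /= vx]; split => //=.
  by apply: le_trans vx; rewrite lef_pV2 ?posrE// ler_nat.
have dAB : dm A = dm (\bigcup_n B n).
  change (\int[m]_(x in A) (v x)%:E = \int[m]_(x in \bigcup_n B n) (v x)%:E).
  rewrite integral_mkcond [RHS]integral_mkcond.
  apply: eq_integral => x _; rewrite !patchE.
  case: ifPn => xA; case: ifPn => // xB.
    have := v0 x; rewrite le_eqVlt => /predU1P[<-//|vx].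
    exfalso; move/negP : xB; apply; rewrite inE.
    have [n nv] := ltr_add_invr vx; rewrite add0r in nv.
    by exists n => //; split; [rewrite inE in xA|exact: ltW].
  exfalso; move/negP : xA; apply; rewrite inE.
  by move: xB; rewrite inE => -[n _ []].
have cB : (dm \o B) n @[n --> \oo] --> dm A.
  rewrite dAB; apply: nondecreasing_cvg_mu => //.
  exact: bigcup_measurable.
have ndB' : nondecreasing_seq (dm \o B).
  move=> a b ab; apply: le_measure; rewrite ?inE//.
  by apply/subsetPset; exact: ndB.
have Asup : dm A = ereal_sup (range (dm \o B)).
  by apply: (cvg_unique _ cB) => //; exact: ereal_nondecreasing_cvgn.
have [n nP] : exists n, dm A <= dm (B n) + (e / 2)%:E.
  have fA : ereal_sup (range (dm \o B)) \is a fin_num.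
    by rewrite -Asup ge0_fin_numE// dfin.
  have [_ [n _ <-] nA] := ub_ereal_sup_adherent e20 fA.
  by exists n; rewrite Asup -leeBlDr// ltW.
have Boo : m (B n) < +oo.
  have : (n.+1%:R^-1)%:E * m (B n) <= \int[m]_x (v x)%:E.
    rewrite -integral_cst//.
    apply: (@le_trans _ _ (\int[m]_(x in B n) (v x)%:E)).
      apply: ge0_le_integral => //=.
      - exact: measurable_funTS.
      - by move=> x [_ vx]; rewrite lee_fin.
    by apply: ge0_subset_integral => // x _; rewrite lee_fin.
  move=> le_v; rewrite ltNge leye_eq; apply/negP => /eqP Boo.
  move: le_v; rewrite Boo gt0_muley ?lte_fin// leye_eq => /eqP vE.
  by move: voo; rewrite vE.
have [C [cC CB BC]] := radon_inner_regular (mB n) Boo (divr_gt0 r0 (ltr0n _ 2)).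
exists C; split => //; first by move=> x /CB [].
apply: (le_trans nP).
have mC := compact_borel hT cC.
have mBC : measurable (B n `\` C) by exact: measurableD.
change (dm (B n) + (e / 2)%:E <= dm C + e%:E).
rewrite (measureDI dm (mB n) mC) setIidr// addeAC [leRHS]addeC leeD2r//.
rewrite [leRHS](_ : _ = (e / 2)%:E + (e / 2)%:E); last first.
  by rewrite -EFinD -splitr.
rewrite leeD2r//.
have Coo : m C < +oo by case: rm => + _ _; exact.
have BCr : m (B n `\` C) < r%:E.
  rewrite measureD// setIidr// lteBlDl ?ge0_fin_numE//.
  by rewrite (le_lt_trans BC)// lteD2lE// ?ge0_fin_numE// lte_fin; lra.
have := rP _ mBC BCr.
rewrite -lte_fin /Rintegral fineK.
  move=> /ltW; apply: le_trans; apply: ge0_le_integral => //.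
  - by move=> x _; rewrite lee_fin.
  - exact: measurable_funTS.
  - by apply: measurable_funTS; apply/measurable_EFinP/measurableT_comp.
  - by move=> x _; rewrite lee_fin ler_norm.
under eq_integral do rewrite ger0_norm//.
by rewrite ge0_fin_numE; [exact: dfin|apply: integral_ge0 => x _; rewrite lee_fin].
Qed.

End radon_regularity.

(** * Measures and integrals of sections *)

(** Induction over compact sets: a local property that passes to subsets and to
    finite unions holds on every compact set. *)
Lemma compact_ind (T : ptopologicalType) (P : set T -> Prop) (C : set T) :
  compact C -> P set0 ->
  (forall A B, A `<=` B -> P B -> P A) ->
  (forall A B, P A -> P B -> P (A `|` B)) ->
  (forall x, C x -> exists2 N, nbhs x N & P N) -> P C.
Proof.
rewrite compact_cover => cC P0 Pmono PU Ploc.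
have Plo x : exists N : set T, C x -> [/\ open N, N x & P N].
  have [Cx|nCx] := pselect (C x); last by exists setT.
  have [N /nbhs_interior + PN] := Ploc x Cx; exists N^° => _; split => //.
  - exact: open_interior.
  - exact: nbhs_singleton.
  - by apply: Pmono PN; exact: interior_subset.
have [f fP] := choice Plo.
have [|x Cx|D DC CD] := cC T C f.
- by move=> x /fP[].
- by exists x => //; have [] := fP _ Cx.
apply: Pmono CD _; rewrite /cover bigcup_fset big_seq; apply: big_ind => // i iD.
by have [] := fP i (set_mem (DC i iD)).
Qed.

Section sections.
Context {R : realType} {X Z : ptopologicalType}.
Implicit Types (A : set (X * Z)) (m : {measure set (borel Z) -> \bar R}).

Lemma pair_continuous (x : X) : continuous (fun z : Z => (x, z)).
Proof. by move=> z; apply: cvg_pair; [exact: cvg_cst|exact: cvg_id]. Qed.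

Lemma open_section A x : open A -> open [set z | A (x, z)].
Proof. by move=> oA; move/continuousP : (@pair_continuous x); apply. Qed.

Lemma open_section_l A z : open A -> open [set x | A (x, z)].
Proof.
move=> oA; have cz : continuous (fun x : X => (x, z)).
  by move=> x; apply: cvg_pair; [exact: cvg_id|exact: cvg_cst].
by move/continuousP : cz; apply.
Qed.

Lemma borel_section A x : measurable (A : set (borel (X * Z)%type)) ->
  measurable ([set z | A (x, z)] : set (borel Z)).
Proof.
move=> mA; have := continuous_borel (@pair_continuous x) measurableT mA.
by rewrite setTI.
Qed.

(** Tube lemma. *)
Lemma near_compact_section A (D : set Z) x : open A -> compact D ->
  (forall z, D z -> A (x, z)) -> \forall y \near x, D `<=` [set z | A (y, z)].
Proof.
move=> oA /compact_near_coveringP cD DA; apply: cD => z Dz.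
have : nbhs (x, z) A by apply: open_nbhs_nbhs; split => //; exact: DA.
by move=> [[P Q] /= [Px Qz] PQA]; exists (Q, P) => //= -[a b] [/= Qa Pb]; exact: PQA.
Qed.

End sections.

Section section_measurability.
Context {R : realType} {X Z : ptopologicalType}.
Variable m : {measure set (borel Z) -> \bar R}.
Hypotheses (hZ : hausdorff_space Z) (im : inner_regular m).
Hypothesis moo : (m setT < +oo)%E.
Local Open Scope ereal_scope.
Implicit Types A : set (X * Z).

Let mfin (D : set (borel Z)) : measurable D -> m D < +oo.
Proof. by move=> mD; apply: le_lt_trans moo; apply: le_measure; rewrite ?inE. Qed.

Lemma compact_below_open_section A x (c : \bar R) : open A ->
  c < m [set z | A (x, z)] ->
  exists D : set Z, [/\ compact D, c < m D & D `<=` [set z | A (x, z)]].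
Proof.
move=> oA cA.
have mA := open_borel (open_section x oA).
have Afin : m [set z | A (x, z)] \is a fin_num.
  by rewrite ge0_fin_numE//; exact: mfin.
have [e [e0 ce]] : exists e : R, (0 < e)%R /\ c < m [set z | A (x, z)] - e%:E.
  move: c cA => [c| |] cA; last 2 first.
  - by move: cA; rewrite ltNge leey.
  - by exists 1%R; split => //; rewrite -(fineK Afin) -EFinB ltNyr.
  move: cA; rewrite -(fineK Afin) lte_fin => cA.
  exists ((fine (m [set z | A (x, z)]) - c) / 2)%R.
  by split; rewrite -?EFinB ?lte_fin; lra.
have [D [cD DA AD]] := im mA (mfin mA) e0.
by exists D; split => //; rewrite (lt_le_trans ce)// leeBlDr.
Qed.

(** Lower semicontinuity: by inner regularity the measure of the section at [x] is
    nearly attained on a compact set, which the tube lemma keeps inside the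
    sections at nearby points. *)
Lemma open_section_measure_gt A (c : \bar R) : open A ->
  open [set x | c < m [set z | A (x, z)]].
Proof.
move=> oA; rewrite openE => x /= cA.
have [D [cD cmD DA]] := compact_below_open_section oA cA.
apply: filterS (near_compact_section oA cD DA) => y DAy /=.
apply: (lt_le_trans cmD); apply: le_measure => //; rewrite inE.
- exact: compact_borel.
- exact: (open_borel (open_section y oA)).
Qed.

(** Open sets form a pi-system generating the Borel sets of the product, so that
    a Dynkin argument starts from lower semicontinuity.  Rectangles would only
    give the product sigma-algebra. *)
Lemma measurable_section_measure A : measurable (A : set (borel (X * Z)%type)) ->
  measurable_fun [set: borel X] (fun x => m [set z | A (x, z)]).
Proof.
pose P (A : set (borel (X * Z)%type)) :=
  measurable_fun [set: borel X] (fun x => m [set z | A (x, z)]).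
apply: (@dynkin_induction _ (borel (X * Z)%type) (@open (X * Z)%type) P) => //.
- by move=> B C; exact: openI.
- exact: (@measurable_cst _ _ (borel X) _ setT (m setT)).
- move=> B oB; apply: (measurability _ (ErealGenOInfty.measurableE R)).
  move=> _ [_ [a ->]] <-; rewrite setTI; apply: open_borel.
  rewrite preimage_itvoy; exact: open_section_measure_gt.
- move=> B mB PB; rewrite /P.
  rewrite (_ : (fun x => _) = (fun x => m setT - m [set z | B (x, z)])).
    by apply: emeasurable_funB => //; exact: measurable_cst.
  apply/funext => x.
  rewrite -[X in _ - m X]setTI -measureD//; last exact: borel_section.
  by congr (m _); rewrite setTD.
- move=> F mF tF PF; rewrite /P.
  rewrite (_ : (fun x => _) =
      (fun x => \sum_(0 <= n <oo) m [set z | F n (x, z)])).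
    by apply: ge0_emeasurable_sum => // n _; exact: PF.
  apply/funext => x.
  rewrite (_ : [set z | _] = \bigcup_n [set z | F n (x, z)])//.
  rewrite measure_bigcup//.
  + by apply: eq_eseriesl => n; rewrite in_setT.
  + by move=> n _; exact: borel_section.
  + by move=> i j _ _ [z [/= Fi Fj]]; apply: (tF i j) => //; exists (x, z).
Qed.

Lemma measurable_section_integral (F : borel (X * Z)%type -> \bar R) :
  measurable_fun setT F -> (forall p, 0 <= F p) ->
  measurable_fun [set: borel X] (fun x => \int[m]_z F (x, z)).
Proof.
have mpair x : measurable_fun [set: borel Z]
    (fun z => ((x, z) : borel (X * Z)%type)).
  exact: (continuous_borel (@pair_continuous _ _ x)).
have mFx (f : borel (X * Z)%type -> \bar R) x : measurable_fun setT f ->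
    measurable_fun [set: borel Z] (fun z => f (x, z)).
  by move=> mf; exact: (measurableT_comp mf (mpair x)).
move: F; apply: ge0_measurable_ind.
- move=> A mA.
  rewrite (_ : (fun x => _) = (fun x => m [set z | A (x, z)])).
    exact: measurable_section_measure.
  apply/funext => x.
  rewrite -[X in _ = m X]setIT -integral_indic//; exact: borel_section.
- move=> c f c0 mf f0 ih.
  rewrite (_ : (fun x => _) = (fun x => c%:E * \int[m]_z f (x, z))).
    exact: measurable_funeM.
  by apply/funext => x; rewrite ge0_integralZl_EFin//; exact: mFx.
- move=> f g mf mg f0 g0 ihf ihg.
  rewrite (_ : (fun x => _) = (fun x =>
     \int[m]_z f (x, z) + \int[m]_z g (x, z))); first exact: emeasurable_funD.
  by apply/funext => x; rewrite ge0_integralD//; exact: mFx.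
- move=> f mf f0 ndf ih.
  rewrite (_ : (fun x => _) = (fun x => limn (fun n => \int[m]_z f n (x, z)))).
    apply: (emeasurable_fun_cvg
      (fun n (x : borel X) => \int[m]_z f n (x, z)) _ ih) => x _.
    apply: ereal_nondecreasing_is_cvgn => a b ab.
    apply: ge0_le_integral => //; [exact: mFx|exact: mFx|].
    by move=> z _; exact: ndf.
  apply/funext => x; rewrite monotone_convergence//.
  by move=> n; exact: mFx.
Qed.

End section_measurability.

(** The function [F] is [v] times [F / v], so that the parameter integral against
    [m] is one against the finite measure [v m]. *)
Lemma measurable_section_integral_real (R : realType) (X Z : ptopologicalType)
    (m : {measure set (borel Z) -> \bar R}) (v : borel Z -> R)
    (F : borel (X * Z)%type -> R) :
  hausdorff_space Z -> radon m ->
  measurable_fun setT v -> (forall z, 0 <= v z) -> (\int[m]_z (v z)%:E < +oo)%E ->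
  measurable_fun setT F -> (forall x z, v z = 0 -> F (x, z) = 0) ->
  measurable_fun [set: borel X] (fun x => \int[m]_z (F (x, z))%:E)%E.
Proof.
move=> hZ rm mv v0 voo mF Fv.
pose dm : {measure set (borel Z) -> \bar R} := density m v0 mv.
have dmT : (dm setT < +oo)%E by [].
have idm : inner_regular dm by exact: density_inner_regular.
have mpair x : measurable_fun [set: borel Z]
    (fun z => ((x, z) : borel (X * Z)%type)).
  exact: (continuous_borel (@pair_continuous _ _ x)).
have msnd : measurable_fun [set: borel (X * Z)%type] (snd : _ -> borel Z).
  by apply: continuous_borel => -[x z]; exact: cvg_snd.
(* powers provide the measurability of the inverse, also where [v] vanishes *)
have mV : measurable_fun [set: borel (X * Z)%type] (fun p => (v p.2)^-1).
  rewrite (_ : (fun p => _) = (@powR R ^~ (-1)) \o v \o snd).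
    by apply: measurableT_comp => //; apply: measurableT_comp.
  by apply/funext => p /=; rewrite powR_inv1.
have key (H : borel (X * Z)%type -> R) : measurable_fun setT H ->
    (forall x z, v z = 0 -> H (x, z) = 0) -> (forall p, 0 <= H p) ->
    measurable_fun [set: borel X] (fun x => \int[m]_z (H (x, z))%:E)%E.
  move=> mH Hv H0.
  have mHV : measurable_fun setT (fun p => (H p / v p.2)%:E).
    by apply/measurable_EFinP; exact: measurable_funM.
  have HV0 p : (0 <= (H p / v p.2)%:E)%E by rewrite lee_fin divr_ge0.
  apply: eq_measurable_fun (measurable_section_integral hZ idm dmT mHV HV0).
  move=> x _; rewrite ge0_integral_density//.
    apply: eq_integral => z _ /=; rewrite -EFinM.
    have [vz|vz] := eqVneq (v z) 0; first by rewrite vz mulr0 Hv.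
    by rewrite divfK.
  exact: (measurableT_comp mHV (mpair x)).
rewrite (_ : (fun x => _) = (fun x => \int[m]_z (F^\+ (x, z))%:E -
    \int[m]_z (F^\- (x, z))%:E)%E); last first.
  apply/funext => x; rewrite integralE; congr (_ - _)%E.
  - by apply: eq_integral => z _; rewrite funeposE /funrpos EFin_max.
  - by apply: eq_integral => z _; rewrite funenegE /funrneg EFin_max.
apply: emeasurable_funB; apply: key.
- exact: measurable_funrpos.
- by move=> x z vz; rewrite /funrpos /= Fv// maxxx.
- exact: funrpos_ge0.
- exact: measurable_funrneg.
- by move=> x z vz; rewrite /funrneg /= Fv// oppr0 maxxx.
- exact: funrneg_ge0.
Qed.

(** * Tonelli's inequality for open sets *)

Section tonelli_open.
Context {R : realType} {X Z : ptopologicalType}.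
Variables (mu : {measure set (borel X) -> \bar R})
  (m : {measure set (borel Z) -> \bar R}).
Hypotheses (hX : hausdorff_space X) (hZ : hausdorff_space Z).
Hypotheses (rmu : radon mu) (im : inner_regular m) (moo : (m setT < +oo)%E).
Variables (A : set (X * Z)) (b : R).
Hypotheses (oA : open A) (Ab : forall z, (mu [set x | A (x, z)] <= b%:E)%E).
Local Open Scope ereal_scope.

Local Notation rect := (borel X * borel Z)%type.
Local Notation sec B x := (m [set z | (B : set rect) (x, z)]).

Let msec (B : set rect) x : measurable B ->
  measurable ([set z | B (x, z)] : set (borel Z)).
Proof.
move=> mB; rewrite (_ : [set z | _] = xsection B x).
  exact: measurable_xsection.
by apply/seteqP; split => z /=; rewrite /xsection /= inE.
Qed.

Let msec_fun (B : set rect) : measurable B ->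
  measurable_fun [set: borel X] (fun x => sec B x).
Proof.
move=> mB; have := measurable_fun_xsection (mfrestr measurableT moo) mB.
apply: eq_measurable_fun => x _ /=; rewrite /mfrestr /mrestr setIT.
by congr (m _); apply/seteqP; split => z /=; rewrite /xsection /= inE.
Qed.

(** The tube lemma gives one rectangle near each point of [C], and compactness
    reduces to finitely many. *)
Let rect_approx (C : set X) (c : \bar R) : compact C ->
  (forall x, C x -> c < m [set z | A (x, z)]) ->
  exists B : set rect, [/\ measurable B, B `<=` A &
    forall x, C x -> c <= sec B x].
Proof.
move=> cC cA; pose P (S : set X) := exists B : set rect,
  [/\ measurable B, B `<=` A & forall x, S x -> c <= sec B x].
apply: (@compact_ind _ P _ cC).
- by exists set0; split => //; exact: measurable0.
- by move=> S T ST [B [mB BA Bc]]; exists B; split => // x /ST /Bc.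
- move=> S T [B [mB BA Bc]] [B' [mB' BA' Bc']]; exists (B `|` B'); split.
  + exact: measurableU.
  + by move=> p [/BA|/BA'].
  + move=> x [/Bc|/Bc'] /le_trans; apply; apply: le_measure; rewrite ?inE.
    1,2,4,5: by apply: msec => //; exact: measurableU.
    * by move=> z; left.
    * by move=> z; right.
move=> x /cA cx; have [D [cD cmD DA]] := compact_below_open_section im moo oA cx.
have N := near_compact_section oA cD DA.
exists (interior [set y | D `<=` [set z | A (y, z)]]).
  by apply: open_nbhs_nbhs; split; [exact: open_interior|exact: N].
exists ((interior [set y | D `<=` [set z | A (y, z)]]) `*` D); split.
- apply: measurableX; last exact: compact_borel.
  by apply: open_borel; exact: open_interior.
- by move=> [y z] [/interior_subset /= yD /yD].
- move=> y yN; apply: (le_trans (ltW cmD)).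
  apply: le_measure; rewrite ?inE; first exact: compact_borel.
    rewrite (_ : [set z | _] = D); first exact: compact_borel.
    by apply/seteqP; split => z //= [].
  by move=> z Dz; split.
Qed.

(** Sets of the product sigma-algebra obey the usual theorem, after restricting
    [mu] to a compact set, where it is finite. *)
Let rect_bound (K : set X) (B : set rect) : compact K -> measurable B ->
  B `<=` A -> \int[mu]_(x in K) sec B x <= b%:E * m setT.
Proof.
move=> cK mB BA; have mK := compact_borel hX cK.
have muK : mu K < +oo by case: rmu => + _ _; exact.
pose mu' : {finite_measure set (borel X) -> \bar R} := mfrestr mK muK.
pose m' : {finite_measure set (borel Z) -> \bar R} := mfrestr measurableT moo.
have -> : \int[mu]_(x in K) sec B x = \int[mu']_(x in K) sec B x.
  by apply: eq_measure_integral => S mS SK; rewrite /= /mfrestr /mrestr setIidl.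
apply: (@le_trans _ _ (\int[mu']_x (m' \o xsection B) x)).
  rewrite (eq_integral (m' \o xsection B)); last first.
    move=> x _ /=; rewrite /mfrestr /mrestr setIT.
    by congr (m _); apply/seteqP; split => z /=; rewrite /xsection /= inE.
  by apply: ge0_subset_integral => //; exact: measurable_fun_xsection.
have := indic_fubini_tonelli mu' m' mB.
rewrite indic_fubini_tonelli_FE// indic_fubini_tonelli_GE// => ->.
apply: (@le_trans _ _ (\int[m']_z b%:E)).
  apply: ge0_le_integral => //.
  - exact: (measurable_fun_ysection mu' mB).
  - move=> z _ /=; apply: le_trans (Ab z); rewrite /mfrestr /mrestr.
    apply: le_measure; rewrite ?inE.
    + by apply: measurableI => //; exact: measurable_ysection.
    + exact: (open_borel (open_section_l z oA)).
    + by move=> x [] /=; rewrite /ysection /= inE => /BA.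
by rewrite integral_cst//= /mfrestr /mrestr setIT.
Qed.

Let lvl (q : R) : set X := [set x | q%:E < m [set z | A (x, z)]].

Let olvl q : open (lvl q).
Proof. exact: open_section_measure_gt. Qed.

(** Chebyshev's inequality, for compact subsets of the level set first. *)
Let lvl_fin q : (0 < q)%R -> mu (lvl q) < +oo.
Proof.
move=> q0; apply: (@le_lt_trans _ _ (q^-1%:E * (b%:E * m setT))); last first.
  rewrite -(fineK (_ : m setT \is a fin_num)) ?ge0_fin_numE//.
  by rewrite -!EFinM ltry.
have [_ _ inner] := rmu; rewrite (inner _ (olvl q)).
apply: ge_ereal_sup => _ [C [cC CW] <-].
have [B [mB BA Bq]] := rect_approx cC CW.
rewrite lee_pdivlMl//; apply: le_trans (rect_bound cC mB BA).
rewrite -integral_cst; last exact: compact_borel.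
apply: ge0_le_integral => //; first exact: compact_borel.
- by move=> x _; rewrite lee_fin ltW.
- by apply: measurable_funTS; exact: msec_fun.
Qed.

(** Inner regularity of [mu] fills the superlevel sets by compact sets, and
    [rect_approx] works over these.  Rational levels and precisions are countable
    in number, so that almost no point is missed. *)
Let approx_family : exists CB : rat * nat -> set X * set rect, forall t,
  [/\ compact (CB t).1, measurable (CB t).2, (CB t).2 `<=` A,
    forall x, (CB t).1 x -> (ratr t.1)%:E <= sec (CB t).2 x &
    (0 < t.1)%R -> (CB t).1 `<=` lvl (ratr t.1) /\
      mu (lvl (ratr t.1) `\` (CB t).1) <= (t.2.+1%:R^-1)%:E].
Proof.
suff H t : exists CB : set X * set rect,
  [/\ compact CB.1, measurable CB.2, CB.2 `<=` A,
    forall x, CB.1 x -> (ratr t.1)%:E <= sec CB.2 x &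
    (0 < t.1)%R -> CB.1 `<=` lvl (ratr t.1) /\
      mu (lvl (ratr t.1) `\` CB.1) <= (t.2.+1%:R^-1)%:E].
  by have [f fP] := choice H; exists f.
case: t => q n /=; have [q0|q0] := ltP 0%R q; last first.
  exists (set0, set0); split => //=; first exact: compact0.
have q0' : (0 < ratr q :> R)%R by rewrite ltr0q.
have n0 : (0 < n.+1%:R^-1 :> R)%R by rewrite invr_gt0.
have [C [cC CW WC]] := radon_inner_open rmu (olvl (ratr q)) (lvl_fin q0') n0.
have [B [mB BA Bq]] := rect_approx cC CW.
exists (C, B); split => //= _; split => //.
have mC := compact_borel hX cC.
rewrite measureD//; [|exact: (open_borel (olvl _))|exact: lvl_fin].
rewrite setIidr// leeBlDl; first exact: ltW.
by rewrite ge0_fin_numE//; case: rmu => + _ _; exact.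
Qed.

(** Tonelli's theorem holds for the union of the approximating family, whose
    sections have almost everywhere the measure of those of [A]. *)
Lemma tonelli_open : \int[mu]_x m [set z | A (x, z)] <= b%:E * m setT.
Proof.
have [CB CBP] := approx_family.
have [t tE] : exists t : nat -> rat * nat, forall s, exists i, t i = s.
  exists (fun i => odflt (0%R, 0%N) (unpickle i)) => s.
  by exists (pickle s); rewrite pickleK.
(* [rect_bound] integrates over a compact set, whence the restriction to [K N] *)
pose K N := \big[setU/set0]_(i < N) (CB (t i)).1.
pose B N := \big[setU/set0]_(i < N) (CB (t i)).2.
have cK N : compact (K N).
  by apply: bigsetU_compact => i _; have [] := CBP (t i).
have mB N : measurable (B N).
  by apply: bigsetU_measurable => i _; have [] := CBP (t i).
have BA N : B N `<=` A.
  move=> p; rewrite /B -(bigcup_mkord _ (fun i => (CB (t i)).2)) => -[i _].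
  by have [_ _ + _ _] := CBP (t i); exact.
have ndK i j : (i <= j)%N -> K i `<=` K j.
  exact: (@subset_bigsetU _ (fun i => (CB (t i)).1)).
have ndB i j : (i <= j)%N -> B i `<=` B j.
  exact: (@subset_bigsetU _ (fun i => (CB (t i)).2)).
pose F N := (fun x => sec (B N) x) \_ (K N).
have F0 N x : 0 <= F N x by rewrite /F patchE; case: ifP.
have mF N : measurable_fun [set: borel X] (F N).
  apply/(measurable_restrictT _ _).1; first exact: compact_borel.
  by apply: measurable_funTS; exact: msec_fun.
have ndF x : nondecreasing_seq (F ^~ x).
  move=> i j ij; rewrite /F !patchE; case: ifPn => [xi|_]; last first.
    by case: ifP => // _; exact: measure_ge0.
  rewrite ifT; last first.
    by move: xi; rewrite !inE; exact: ndK.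
  apply: le_measure; rewrite ?inE; [exact: msec|exact: msec|].
  by move=> z /=; exact: ndB.
have Fb N : \int[mu]_x F N x <= b%:E * m setT.
  by rewrite /F -integral_mkcond; exact: rect_bound.
have Flim : \int[mu]_x limn (F ^~ x) <= b%:E * m setT.
  rewrite monotone_convergence//; apply: lime_le; last exact: nearW.
  apply: ereal_nondecreasing_is_cvgn => i j ij.
  by apply: ge0_le_integral => // x _; exact: ndF.
apply: le_trans Flim; apply: ae_ge0_le_integral => //.
- apply: (measurability _ (ErealGenOInfty.measurableE R)).
  move=> _ [_ [a ->]] <-; rewrite setTI; apply: open_borel.
  by rewrite preimage_itvoy; exact: open_section_measure_gt.
- move=> x _; apply: lime_ge; last exact: nearW.
  by apply: ereal_nondecreasing_is_cvgn; exact: ndF.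
- apply: (emeasurable_fun_cvg (F : (borel X -> \bar R)^nat) _ mF) => x _.
  by apply: ereal_nondecreasing_is_cvgn; exact: ndF.
(* [Nq q] is the part of the level set that no compact set of level [q] reaches *)
pose Nq (q : rat) := if (0 < q)%R then
  lvl (ratr q) `\` \bigcup_n (CB (q, n)).1 else set0.
have Nq0 q : mu.-negligible (Nq q).
  rewrite /Nq; case: ifPn => [q0|_]; last exact: negligible_set0.
  have mCB n : measurable ((CB (q, n)).1 : set (borel X)).
    by apply: compact_borel => //; have [] := CBP (q, n).
  have mN : measurable
      (lvl (ratr q) `\` \bigcup_n (CB (q, n)).1 : set (borel X)).
    by apply: measurableD; [exact: (open_borel (olvl _))|exact: bigcup_measurable].
  apply/negligibleP => //; apply/eqP; rewrite eq_le measure_ge0 andbT.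
  apply/lee_addgt0Pr => e e0; rewrite add0e.
  have [n ne] := ltr_add_invr e0; rewrite add0r in ne.
  have [_ _ _ _ /(_ q0) [_ /= ql]] := CBP (q, n).
  apply: le_trans (le_trans ql _); last by rewrite lee_fin ltW.
  apply: le_measure; rewrite ?inE//.
    by apply: measurableD => //; exact: (open_borel (olvl _)).
  by apply: setDS => x Cx; exists n.
have : mu.-negligible (\bigcup_i Nq (t i).1).
  by apply: negligible_bigcup => i; exact: Nq0.
apply: negligibleS => x /= nx; apply: contrapT => nN; apply: nx => _.
rewrite leNgt; apply/negP => lt_x.
have L0 : 0 <= limn (F ^~ x).
  apply: lime_ge; last exact: nearW.
  by apply: ereal_nondecreasing_is_cvgn; exact: ndF.
have [q [q1 q2]] : exists q : rat,
    limn (F ^~ x) < (ratr q)%:E /\ (ratr q)%:E < m [set z | A (x, z)].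
  have mA := open_borel (open_section x oA).
  have h_fin : m [set z | A (x, z)] \is a fin_num.
    rewrite ge0_fin_numE//; apply: le_lt_trans moo.
    by apply: le_measure => //; rewrite inE.
  have l_fin : limn (F ^~ x) \is a fin_num.
    by rewrite ge0_fin_numE// (lt_trans lt_x)// ltey_eq h_fin.
  move: lt_x; rewrite -(fineK h_fin) -(fineK l_fin) lte_fin.
  move=> /rat_in_itvoo[q]; rewrite in_itv/= => /andP[q1 q2].
  by exists q; rewrite !lte_fin.
have q0 : (0 < q)%R.
  by rewrite -(ltr0q R) -lte_fin (le_lt_trans L0).
have [i ti] := tE (q, 0%N).
apply: nN; exists i => //; rewrite ti /Nq /= q0; split => //.
move=> [n _ Cx].
have [cC mC CA Cq _] := CBP (q, n).
have : (ratr q)%:E <= limn (F ^~ x).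
  apply: lime_ge; first by apply: ereal_nondecreasing_is_cvgn; exact: ndF.
  have [j tj] := tE (q, n); exists j.+1 => // N /= jN.
  have KN : K N x.
    by rewrite /K -(bigcup_mkord _ (fun i => (CB (t i)).1)); exists j => //;
      rewrite tj.
  rewrite /F patchE ifT ?inE//; apply: (le_trans (Cq _ Cx)).
  apply: le_measure; rewrite ?inE; [exact: msec|exact: msec|].
  move=> z Bz; rewrite /B /= -(bigcup_mkord _ (fun i => (CB (t i)).2)).
  by exists j => //; rewrite tj.
by rewrite leNgt q1.
Qed.

End tonelli_open.

(** * Translation under Haar measure *)

Section topological_group.
Context {G : topologicalGroupType}.

Lemma continuous_mulg {T : topologicalType} (f g : T -> G) :
  continuous f -> continuous g -> continuous (fun x => (f x * g x)%g).
Proof.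
move=> cf cg x; apply: (@continuous2_cvg _ _ _ _ _ _ f g (fun x y => (x * y)%g));
  [exact: (@mulg_continuous G (f x, g x))|exact: cf|exact: cg].
Qed.

Lemma continuous_invg {T : topologicalType} (f : T -> G) :
  continuous f -> continuous (fun x => ((f x)^-1)%g).
Proof. by move=> cf x; apply: continuous_comp; [exact: cf|exact: invg_continuous]. Qed.

Lemma continuous_mulgl (y : G) : continuous (fun x : G => (y * x)%g).
Proof. by apply: continuous_mulg => x; [exact: cvg_cst|exact: cvg_id]. Qed.

End topological_group.

Section haar.
Context {R : realType} {G : topologicalGroupType}.
Variable mu : {measure set (borel G) -> \bar R}.
Hypotheses (hG : hausdorff_space G) (hmu : left_haar mu).
Local Open Scope ereal_scope.

Let rmu : radon mu. Proof. by case: hmu. Qed.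

Lemma measurable_mulgl t : measurable_fun [set: borel G]
  ((fun x : G => (t * x)%g) : borel G -> borel G).
Proof. by apply: continuous_borel; exact: continuous_mulgl. Qed.

Lemma haar_preimage t (A : set G) : measurable (A : set (borel G)) ->
  mu [set x | A (t^-1 * x)%g] = mu A.
Proof.
move=> mA; have [_ _ inv] := hmu; rewrite -[RHS](inv t)//; congr (mu _).
apply/seteqP; split => [x Ax|_ [x Ax <-] /=].
  by exists (t^-1 * x)%g => //; rewrite mulVKg.
by rewrite mulKg.
Qed.

Lemma ge0_integral_translate t (Q : borel G -> \bar R) :
  measurable_fun setT Q -> (forall x, 0 <= Q x) ->
  \int[mu]_x Q (t^-1 * x)%g = \int[mu]_x Q x.
Proof.
move=> mQ Q0; have mt := measurable_mulgl t^-1%g.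
have := ge0_integral_pushforward mt mu measurableT mQ (fun x _ => Q0 x).
rewrite preimage_setT => <-; apply: eq_measure_integral => A mA _.
exact: haar_preimage.
Qed.

Section translate_tonelli.
Context {Z : ptopologicalType}.
Variables (m : {measure set (borel Z) -> \bar R}) (tau : Z -> G).
Hypotheses (hZ : hausdorff_space Z) (im : inner_regular m).
Hypotheses (moo : m setT < +oo) (ctau : continuous tau).

Let act (p : G * Z) : G := ((tau p.2)^-1 * p.1)%g.

Let cact : continuous act.
Proof.
apply: continuous_mulg; last by move=> x; exact: cvg_fst.
apply: continuous_invg => x.
by apply: continuous_comp; [exact: cvg_snd|exact: ctau].
Qed.

Lemma measurable_translate_integral (Q : borel G -> \bar R) :
  measurable_fun setT Q -> (forall x, 0 <= Q x) ->
  measurable_fun [set: borel G] (fun x => \int[m]_z Q ((tau z)^-1 * x)%g).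
Proof.
move=> mQ Q0; apply: (@measurable_section_integral _ _ _ m hZ im moo
  (fun p => Q (act p))) => //.
by apply: (measurableT_comp mQ); exact: continuous_borel.
Qed.

(** The set of all [(x, z)] with [(tau z)^-1 x] in an open [U] is open and its
    sections at [z] are translates of [U]; outer regularity passes from open to
    Borel sets. *)
Let translate_tonelli_set A : measurable (A : set (borel G)) ->
  \int[mu]_x m [set z | A ((tau z)^-1 * x)%g] <= m setT * mu A.
Proof.
move=> mA.
have mact := continuous_borel cact.
have mAact : measurable (act @^-1` A : set (borel (G * Z)%type)).
  by rewrite -[X in measurable X]setTI; exact: mact.
have [m0|m0] := eqVneq (m setT) 0.
  rewrite m0 mul0e integral0_eq// => x _; apply/eqP.
  rewrite eq_le measure_ge0 andbT -m0; apply: le_measure; rewrite ?inE//.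
  exact: borel_section mAact.
have [Aoo|] := ltP (mu A) +oo; last first.
  rewrite leye_eq => /eqP ->; rewrite gt0_muley ?leey//.
  by rewrite lt0e m0 measure_ge0.
have mfin : m setT \is a fin_num by rewrite ge0_fin_numE.
have Afin : mu A \is a fin_num by rewrite ge0_fin_numE.
have H e : (0 < e)%R -> \int[mu]_x m [set z | A ((tau z)^-1 * x)%g] <=
    m setT * (mu A + e%:E).
  move=> e0; have [U [oU AU UA]] := radon_outer rmu mA Aoo e0.
  apply: (@le_trans _ _ (\int[mu]_x m [set z | U ((tau z)^-1 * x)%g])).
    have oUact : open (act @^-1` U) by move/continuousP : cact; exact.
    apply: ge0_le_integral => //.
    - exact: (measurable_section_measure hZ im moo mAact).
    - exact: (measurable_section_measure hZ im moo (open_borel oUact)).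
    - move=> x _; apply: le_measure; rewrite ?inE.
      + exact: borel_section mAact.
      + exact: borel_section (open_borel oUact).
      + by move=> z /= /AU.
  rewrite muleC -(fineK Afin) -EFinD.
  have oUact : open (act @^-1` U) by move/continuousP : cact; exact.
  apply: (tonelli_open hG hZ rmu im moo oUact).
  move=> z; rewrite /act /= haar_preimage; last exact: open_borel.
  by rewrite EFinD fineK// ltW.
apply/lee_addgt0Pr => e e0.
have c0 : (0 < fine (m setT))%R by rewrite fine_gt0// lt0e m0 measure_ge0.
have := H (e / fine (m setT))%R (divr_gt0 e0 c0).
rewrite muleDr//; last by rewrite fin_num_adde_defl.
by rewrite -[X in _ + X * _](fineK mfin) -EFinM mulrC divfK// gt_eqF.
Qed.

(** Convolving [Q] with the image of [m] under [tau] multiplies the integral by the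
    total mass at most. *)
Lemma translate_tonelli (Q : borel G -> \bar R) :
  measurable_fun setT Q -> (forall x, 0 <= Q x) ->
  \int[mu]_x \int[m]_z Q ((tau z)^-1 * x)%g <= m setT * \int[mu]_x Q x.
Proof.
have mtr (f : borel G -> \bar R) x : measurable_fun setT f ->
    measurable_fun [set: borel Z] (fun z => f ((tau z)^-1 * x)%g).
  move=> mf; apply: (measurableT_comp mf).
  apply: continuous_borel; apply: continuous_mulg; last exact: cst_continuous.
  exact: continuous_invg.
move: Q; apply: ge0_measurable_ind.
- move=> A mA; rewrite [X in _ <= _ * X]integral_indic// setIT.
  rewrite (eq_integral (fun x : borel G => m [set z | A ((tau z)^-1 * x)%g])).
    exact: translate_tonelli_set.
  move=> x _; rewrite -[in RHS](setIT [set z | _]) -integral_indic//.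
  have := mtr (fun y => (\1_A y)%:E) x; move/(_ _)/measurable_EFinP => H.
  by apply/measurable_indicP; apply: H; apply/measurable_EFinP/measurable_indic.
- move=> c f c0 mf f0 ih.
  rewrite ge0_integralZl_EFin// muleCA.
  rewrite (eq_integral (fun x : borel G => c%:E * \int[m]_z f ((tau z)^-1 * x)%g)).
    rewrite ge0_integralZl_EFin//; first by rewrite lee_wpmul2l.
    + by move=> x _; exact: integral_ge0.
    + exact: measurable_translate_integral.
  by move=> x _; rewrite ge0_integralZl_EFin//; exact: mtr.
- move=> f g mf mg f0 g0 ihf ihg.
  rewrite ge0_integralD// ge0_muleDr//; try exact: integral_ge0.
  rewrite (eq_integral (fun x : borel G => \int[m]_z f ((tau z)^-1 * x)%g +
     \int[m]_z g ((tau z)^-1 * x)%g)).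
    rewrite ge0_integralD//; first exact: leeD.
    + by move=> x _; exact: integral_ge0.
    + exact: measurable_translate_integral.
    + by move=> x _; exact: integral_ge0.
    + exact: measurable_translate_integral.
  by move=> x _; rewrite ge0_integralD//; exact: mtr.
- move=> f mf f0 ndf ih.
  have ndi x : nondecreasing_seq (fun n => \int[m]_z f n ((tau z)^-1 * x)%g).
    move=> a b ab; apply: ge0_le_integral => //; [exact: mtr|exact: mtr|].
    by move=> z _; exact: ndf.
  rewrite (eq_integral (fun x : borel G =>
      limn (fun n => \int[m]_z f n ((tau z)^-1 * x)%g))).
    rewrite [leLHS]monotone_convergence//.
    + apply: lime_le.
        apply: ereal_nondecreasing_is_cvgn => a b ab.
        apply: ge0_le_integral => //.
        * by move=> x _; exact: integral_ge0.
        * exact: measurable_translate_integral.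
        * exact: measurable_translate_integral.
        * by move=> x _; exact: ndi.
      apply: nearW => n; apply: (le_trans (ih n)); rewrite lee_wpmul2l//.
      apply: ge0_le_integral => //.
      * apply: (emeasurable_fun_cvg f) => // x _.
        by apply: ereal_nondecreasing_is_cvgn; exact: ndf.
      * move=> x _; apply: lime_ge.
          by apply: ereal_nondecreasing_is_cvgn; exact: ndf.
        by exists n => // k /= nk; exact: ndf.
    + by move=> n; exact: measurable_translate_integral.
    + by move=> n x _; exact: integral_ge0.
  by move=> x _; rewrite monotone_convergence// => n; exact: mtr.
Qed.

End translate_tonelli.
End haar.

(** * Complex-valued functions *)

Section complex_modulus.
Context {R : realType}.
Implicit Types z w : R[i].

Lemma sqr_normcE z : normc z ^+ 2 = Re z ^+ 2 + Im z ^+ 2.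
Proof. by case: z => a b /=; rewrite sqr_sqrtr// addr_ge0// sqr_ge0. Qed.

Lemma normc_ge0 z : 0 <= normc z.
Proof. by case: z => a b /=; exact: sqrtr_ge0. Qed.

Lemma ReM z w : Re (z * w) = Re z * Re w - Im z * Im w.
Proof. by case: z w => a b [c d]. Qed.

Lemma ImM z w : Im (z * w) = Re z * Im w + Im z * Re w.
Proof. by case: z w => a b [c d]. Qed.

Lemma ReD z w : Re (z + w) = Re z + Re w. Proof. by case: z w => a b [c d]. Qed.
Lemma ImD z w : Im (z + w) = Im z + Im w. Proof. by case: z w => a b [c d]. Qed.
Lemma ReN z : Re (- z) = - Re z. Proof. by case: z. Qed.
Lemma ImN z : Im (- z) = - Im z. Proof. by case: z. Qed.
Lemma Re_conjc z : Re (conjc z) = Re z. Proof. by case: z. Qed.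
Lemma Im_conjc z : Im (conjc z) = - Im z. Proof. by case: z. Qed.

Definition complex_simp := (ReM, ImM, ReD, ImD, ReN, ImN, Re_conjc, Im_conjc).

Lemma complex_ext z w : Re z = Re w -> Im z = Im w -> z = w.
Proof. by case: z w => a b [c d] /= -> ->. Qed.

Lemma normc_conjc z : normc (conjc z) = normc z.
Proof. by case: z => a b /=; rewrite sqrrN. Qed.

Lemma normr_Re_le z : `|Re z| <= normc z.
Proof.
rewrite -(@ler_pXn2r _ 2)// ?nnegrE ?normc_ge0// sqr_normcE.
by rewrite real_normK ?num_real// lerDl sqr_ge0.
Qed.

Lemma normr_Im_le z : `|Im z| <= normc z.
Proof.
rewrite -(@ler_pXn2r _ 2)// ?nnegrE ?normc_ge0// sqr_normcE.
by rewrite real_normK ?num_real// lerDr sqr_ge0.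
Qed.

Lemma normcB_sym z w : normc (z - w) = normc (w - z).
Proof. by rewrite -normcN opprB. Qed.

Lemma normc_real (a : R) : normc (a%:C)%C = `|a|.
Proof. by rewrite /= expr0n /= addr0 sqrtr_sqr. Qed.

Lemma normc_dist_triangle z w v : normc (z - w) <= normc (z - v) + normc (v - w).
Proof. by rewrite -[z - w](subrKA v); exact: le_normcD. Qed.

(** Taking [w] to be the conjugate of [z] suffices; in this form a bound on real
    integrals gives one on the modulus of a complex integral. *)
Lemma normc_le_test z (c : R) : 0 <= c ->
  (forall w, Re (w * z) <= normc w * c) -> normc z <= c.
Proof.
move=> c0 /(_ (conjc z)); rewrite normc_conjc => H.
have : normc z ^+ 2 <= normc z * c.
  apply: le_trans H; rewrite sqr_normcE !complex_simp; lra.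
have := normc_ge0 z; rewrite le_eqVlt => /predU1P[<-//|z0].
by rewrite expr2 ler_pM2l.
Qed.

End complex_modulus.

Section complex_measurable.
Context d (T : measurableType d) (R : realType).
Implicit Types f g : T -> R[i].

Lemma cmeasurableM f g : cmeasurable f -> cmeasurable g ->
  cmeasurable (fun x => f x * g x).
Proof.
move=> [f1 f2] [g1 g2]; split.
- under eq_fun do rewrite ReM.
  by apply: measurable_funB; apply: measurable_funM.
- under eq_fun do rewrite ImM.
  by apply: measurable_funD; apply: measurable_funM.
Qed.

Lemma cmeasurableD f g : cmeasurable f -> cmeasurable g ->
  cmeasurable (fun x => f x + g x).
Proof.
move=> [f1 f2] [g1 g2]; split.
- by under eq_fun do rewrite ReD; exact: measurable_funD.
- by under eq_fun do rewrite ImD; exact: measurable_funD.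
Qed.

Lemma cmeasurable_conj f : cmeasurable f -> cmeasurable (fun x => conjc (f x)).
Proof.
move=> [f1 f2]; split.
- by under eq_fun do rewrite Re_conjc.
- by under eq_fun do rewrite Im_conjc; exact: measurable_funN.
Qed.

Lemma cmeasurable_cst (a : R[i]) : cmeasurable (fun _ : T => a).
Proof. by split; exact: measurable_cst. Qed.

Lemma cmeasurable_real (f : T -> R) : measurable_fun setT f ->
  cmeasurable (fun x => (f x)%:C)%C.
Proof. by move=> mf; split => //; exact: measurable_cst. Qed.

Lemma cmeasurableZ (a : R[i]) f : cmeasurable f -> cmeasurable (fun x => a * f x).
Proof. by move=> mf; apply: cmeasurableM => //; exact: cmeasurable_cst. Qed.

Lemma measurable_sqr_normc f : cmeasurable f ->
  measurable_fun setT (fun x => normc (f x) ^+ 2).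
Proof.
move=> [f1 f2]; under eq_fun do rewrite sqr_normcE.
by apply: measurable_funD; exact: measurable_funX.
Qed.

Lemma measurable_normc f : cmeasurable f ->
  measurable_fun setT (fun x => normc (f x)).
Proof.
move=> mf; rewrite (_ : (fun x => _) =
  (fun y : R => y `^ 2^-1) \o (fun x => normc (f x) ^+ 2)).
  by apply: measurableT_comp => //; exact: measurable_sqr_normc.
apply/funext => x /=; rewrite -powR_mulrn ?normc_ge0// -powRrM.
by rewrite mulfV// powRr1// normc_ge0.
Qed.

Lemma cmeasurable_comp d' (S : measurableType d') (h : S -> T) f :
  measurable_fun setT h -> cmeasurable f -> cmeasurable (fun x => f (h x)).
Proof.
move=> mh [f1 f2]; split; first exact: (measurableT_comp f1).
exact: (measurableT_comp f2).
Qed.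

End complex_measurable.

Section complex_integral.
Context d (T : measurableType d) (R : realType).
Variable m : {measure set T -> \bar R}.
Implicit Types f g : T -> R[i].

Lemma cintegrable_bound f (h : T -> R) : cmeasurable f ->
  m.-integrable setT (EFin \o h) -> (forall x, normc (f x) <= h x) ->
  cintegrable m f.
Proof.
move=> [f1 f2] ih fh; split; apply: (le_integrable measurableT _ _ ih).
- exact/measurable_EFinP.
- move=> x _ /=; rewrite lee_fin (le_trans (normr_Re_le _))//.
  by rewrite (le_trans (fh x))// ler_norm.
- exact/measurable_EFinP.
- move=> x _ /=; rewrite lee_fin (le_trans (normr_Im_le _))//.
  by rewrite (le_trans (fh x))// ler_norm.
Qed.

Lemma integrable_ge0 (h : T -> R) : measurable_fun setT h ->
  (forall x, 0 <= h x) -> (\int[m]_x (h x)%:E < +oo)%E ->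
  m.-integrable setT (EFin \o h).
Proof.
move=> mh h0 hoo; apply/integrableP; split; first exact/measurable_EFinP.
by under eq_integral do rewrite /= ger0_norm//.
Qed.

Lemma cintegrableZ (a : R[i]) f : cintegrable m f ->
  cintegrable m (fun x => a * f x).
Proof.
move=> [f1 f2]; split.
- under eq_fun do rewrite ReM EFinB !EFinM.
  by apply: integrableB => //; exact: integrableZl.
- under eq_fun do rewrite ImM EFinD !EFinM.
  by apply: integrableD => //; exact: integrableZl.
Qed.

Lemma cintegralD f g : cintegrable m f -> cintegrable m g ->
  cintegral m (fun x => f x + g x) = cintegral m f + cintegral m g.
Proof.
move=> [f1 f2] [g1 g2]; apply: complex_ext.
- rewrite ReD /= -RintegralD//; apply: eq_Rintegral => x _; exact: ReD.
- rewrite ImD /= -RintegralD//; apply: eq_Rintegral => x _; exact: ImD.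
Qed.

Lemma cintegralZ (a : R[i]) f : cintegrable m f ->
  cintegral m (fun x => a * f x) = a * cintegral m f.
Proof.
move=> [f1 f2]; apply: complex_ext.
- rewrite ReM /= -!RintegralZl// -RintegralB//; last 2 first.
    by have := integrableZl measurableT (Re a) f1.
    by have := integrableZl measurableT (Im a) f2.
  by apply: eq_Rintegral => x _; exact: ReM.
- rewrite ImM /= -!RintegralZl// -RintegralD//; last 2 first.
    by have := integrableZl measurableT (Re a) f2.
    by have := integrableZl measurableT (Im a) f1.
  by apply: eq_Rintegral => x _; exact: ImM.
Qed.

Lemma cintegralB f g : cintegrable m f -> cintegrable m g ->
  cintegral m (fun x => f x - g x) = cintegral m f - cintegral m g.
Proof.
move=> fi gi; rewrite -mulN1r -cintegralZ// -cintegralD//.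
  by congr (cintegral m _); apply/funext => x; rewrite mulN1r.
exact: cintegrableZ.
Qed.

Lemma normc_cintegral f (h : T -> R) (c : R) : cintegrable m f ->
  m.-integrable setT (EFin \o h) -> (forall x, normc (f x) <= h x) ->
  (\int[m]_x (h x)%:E <= c%:E)%E -> normc (cintegral m f) <= c.
Proof.
move=> fi hi fh hc.
have h0 x : 0 <= h x by rewrite (le_trans _ (fh x))// normc_ge0.
have c0 : 0 <= c.
  by rewrite -lee_fin (le_trans _ hc)//; apply: integral_ge0 => x _; rewrite lee_fin.
apply: normc_le_test => // w; rewrite -cintegralZ//=.
have [wfi _] := cintegrableZ w fi.
have whi : m.-integrable setT (EFin \o (fun x => normc w * h x)).
  by have := integrableZl measurableT (normc w) hi.
apply: (@le_trans _ _ (\int[m]_x (normc w * h x))%R).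
  apply: le_Rintegral => // x _; apply: (le_trans (ler_norm _)).
  apply: (le_trans (normr_Re_le _)); rewrite ComplexField.Normc.normcM.
  by rewrite ler_wpM2l ?normc_ge0.
rewrite RintegralZl// ler_wpM2l ?normc_ge0//.
rewrite -lee_fin /Rintegral fineK//.
exact: integrable_fin_num.
Qed.

Section weighted.
Variable F : T -> R.
Hypotheses (F0 : forall x, 0 <= F x) (iF : m.-integrable setT (EFin \o F)).
Let I := Rintegral m setT F.

Lemma weight_RintegralE : (\int[m]_x (F x)%:E = I%:E)%E.
Proof. by rewrite /I /Rintegral fineK//; exact: integrable_fin_num. Qed.

(** The values of [k] matter only where the weight [F] does not vanish: this is how
    estimates known near a point pass to averages supported there. *)
Lemma cintegral_weight (k : T -> R[i]) (c : R) : cmeasurable k ->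
  (forall x, F x != 0 -> normc (k x) <= c) ->
  cintegrable m (fun x => (F x)%:C%C * k x) /\
  normc (cintegral m (fun x => (F x)%:C%C * k x)) <= c * I.
Proof.
move=> mk kc.
have mF : measurable_fun setT F by apply/measurable_EFinP; exact: measurable_int iF.
have ifk x : normc ((F x)%:C%C * k x) <= c * F x.
  rewrite ComplexField.Normc.normcM normc_real ger0_norm// mulrC.
  have [->|Fx] := eqVneq (F x) 0; first by rewrite !mulr0.
  by rewrite ler_wpM2r// kc.
have icF : m.-integrable setT (EFin \o (fun x => c * F x)).
  by have := integrableZl measurableT c iF.
have ci : cintegrable m (fun x => (F x)%:C%C * k x).
  apply: (cintegrable_bound _ icF ifk).
  exact: (cmeasurableM (cmeasurable_real mF) mk).
split => //; apply: (normc_cintegral ci icF ifk).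
under eq_integral do rewrite EFinM.
by rewrite integralZl// weight_RintegralE EFinM.
Qed.

Lemma cintegral_weight_cst (c : R[i]) :
  cintegrable m (fun x => (F x)%:C%C * c) /\
  cintegral m (fun x => (F x)%:C%C * c) = I%:C%C * c.
Proof.
have cst (a : R[i]) := cintegral_weight (@cmeasurable_cst _ T R a)
  (fun _ _ => lexx (normc a)).
split; first exact: (cst c).1.
have fi : cintegrable m (fun x => (F x)%:C%C).
  by move: (cst 1).1; under [X in cintegrable _ X]eq_fun do rewrite mulr1.
under [X in cintegral _ X]eq_fun do rewrite mulrC.
rewrite cintegralZ// mulrC; congr (_ * _).
by apply: complex_ext => //=; rewrite /Rintegral integral0_eq.
Qed.

Lemma cintegral_weight_dist (k : T -> R[i]) (a : R[i]) (c : R) : cmeasurable k ->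
  (forall x, F x != 0 -> normc (k x - a) <= c) ->
  normc (cintegral m (fun x => (F x)%:C%C * k x) - I%:C%C * a) <= c * I.
Proof.
move=> mk kc.
have mka : cmeasurable (fun x => k x - a).
  exact: (cmeasurableD mk (@cmeasurable_cst _ T R (- a))).
have ki : cintegrable m (fun x => (F x)%:C%C * k x).
  apply: (cintegral_weight (c := c + normc a) mk _).1 => x Fx.
  rewrite -[k x](subrK a) (le_trans (le_normcD _ _))// lerD2r.
  exact: kc.
rewrite -(cintegral_weight_cst a).2 -cintegralB//; last exact: (cintegral_weight_cst a).1.
under [X in cintegral _ X]eq_fun do rewrite -mulrBr.
exact: (cintegral_weight mka kc).2.
Qed.

End weighted.

End complex_integral.

Section L2.
Context d (T : measurableType d) (R : realType).
Variable m : {measure set T -> \bar R}.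
Implicit Types f g : T -> R[i].
Local Open Scope ereal_scope.

Lemma cLnorm1E f : cLnorm m 1 f = \int[m]_x (normc (f x))%:E.
Proof.
rewrite /cLnorm Lnorm1; apply: eq_integral => x _ /=.
by rewrite ger0_norm// normc_ge0.
Qed.

Lemma cLnorm2E f :
  cLnorm m 2 f = (\int[m]_x (normc (f x) ^+ 2)%:E) `^ 2^-1.
Proof.
rewrite /cLnorm unlock; congr (_ `^ _); apply: eq_integral => x _ /=.
by rewrite ger0_norm ?normc_ge0// -powR_mulrn ?normc_ge0.
Qed.

Lemma cLnorm2_le f (c : R) : (0 <= c)%R ->
  (cLnorm m 2 f <= c%:E) <-> (\int[m]_x (normc (f x) ^+ 2)%:E <= (c ^+ 2)%:E).
Proof.
move=> c0; rewrite cLnorm2E.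
set I := \int[m]_x _.
have I0 : 0 <= I by apply: integral_ge0 => x _; rewrite lee_fin sqr_ge0.
have cE : (c = (c ^+ 2) `^ 2^-1)%R.
  by rewrite -powR_mulrn// -powRrM mulfV// powRr1.
move: I0; case: I => [r| |] //; rewrite ?leeNy_eq// => r0.
- rewrite lee_fin in r0; rewrite /= !lee_fin [in (_ <= c)%R]cE.
  split => [|rc]; last first.
    by apply: ge0_ler_powR => //; rewrite ?nnegrE ?sqr_ge0.
  move=> H; have := ge0_ler_powR (ler0n R 2) _ _ H.
  rewrite !nnegrE !powR_ge0 -!powRrM mulVf// !powRr1 ?sqr_ge0//.
  by apply.
- by rewrite /poweR invr_eq0 pnatr_eq0 /= !leye_eq.
Qed.

Lemma cLnorm2_lty f :
  (cLnorm m 2 f < +oo) <-> (\int[m]_x (normc (f x) ^+ 2)%:E < +oo).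
Proof.
rewrite cLnorm2E; set I := \int[m]_x _.
by case: I => [r| |]; rewrite /poweR ?invr_eq0 ?pnatr_eq0//= ?ltry.
Qed.

(** Cauchy-Schwarz, from Hoelder's inequality. *)
Lemma integral_mul_le (f g : T -> R) (a b : R) :
  measurable_fun setT f -> measurable_fun setT g ->
  (forall x, 0 <= f x)%R -> (forall x, 0 <= g x)%R -> (0 <= a)%R -> (0 <= b)%R ->
  \int[m]_x (f x ^+ 2)%:E <= (a ^+ 2)%:E ->
  \int[m]_x (g x ^+ 2)%:E <= (b ^+ 2)%:E ->
  \int[m]_x (f x * g x)%:E <= (a * b)%:E.
Proof.
move=> mf mg f0 g0 a0 b0 fa gb.
have half : (2^-1 + 2^-1 = 1 :> R)%R by rewrite [RHS]splitr !mul1r.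
have := hoelder m mf mg (ltr0n _ 2) (ltr0n _ 2) half.
rewrite Lnorm1.
rewrite (eq_integral (fun x => (f x * g x)%:E)); last first.
  by move=> x _ /=; rewrite ger0_norm// mulr_ge0.
move=> /le_trans; apply; rewrite EFinM; apply: lee_pmul; try exact: Lnorm_ge0.
- have /(cLnorm2_le (fun x => (f x)%:C)%C a0) :
    \int[m]_x (normc ((f x)%:C)%C ^+ 2)%:E <= (a ^+ 2)%:E.
    by under eq_integral do rewrite normc_real real_normK ?num_real//.
  rewrite /cLnorm; under eq_Lnorm do rewrite normc_real ger0_norm//.
  by [].
- have /(cLnorm2_le (fun x => (g x)%:C)%C b0) :
    \int[m]_x (normc ((g x)%:C)%C ^+ 2)%:E <= (b ^+ 2)%:E.
    by under eq_integral do rewrite normc_real real_normK ?num_real//.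
  rewrite /cLnorm; under eq_Lnorm do rewrite normc_real ger0_norm//.
  by [].
Qed.

End L2.

Lemma cmeasurable_section_cintegral (R : realType) (X Z : ptopologicalType)
    (m : {measure set (borel Z) -> \bar R}) (v : borel Z -> R)
    (F : borel (X * Z)%type -> R[i]) :
  hausdorff_space Z -> radon m ->
  measurable_fun setT v -> (forall z, 0 <= v z) -> (\int[m]_z (v z)%:E < +oo)%E ->
  cmeasurable F -> (forall x z, v z = 0 -> F (x, z) = 0) ->
  cmeasurable (fun x : borel X => cintegral m (fun z => F (x, z))).
Proof.
move=> hZ rm mv v0 voo [F1 F2] Fv; split => /=.
- apply: measurableT_comp; first exact: fine_measurable.
  apply: (measurable_section_integral_real hZ rm mv v0 voo F1) => x z vz.
  by rewrite Fv.
- apply: measurableT_comp; first exact: fine_measurable.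
  apply: (measurable_section_integral_real hZ rm mv v0 voo F2) => x z vz.
  by rewrite Fv.
Qed.

(** * Orthogonal projection in [L^2] *)

Section real_L2.
Context d (T : measurableType d) (R : realType).
Variable m : {measure set T -> \bar R}.
Implicit Types f g h : T -> R.

Definition square_integrable f :=
  measurable_fun setT f /\ (\int[m]_x (f x ^+ 2)%:E < +oo)%E.

Definition ip f g : R := Rintegral m setT (fun x => f x * g x).

Lemma square_integrableD f g : square_integrable f -> square_integrable g ->
  square_integrable (fun x => f x + g x).
Proof.
move=> [mf f2] [mg g2]; split; first exact: measurable_funD.
have mf2 : measurable_fun setT (fun x => (f x ^+ 2)%:E).
  by apply/measurable_EFinP; exact: measurable_funX.
have mg2 : measurable_fun setT (fun x => (g x ^+ 2)%:E).
  by apply/measurable_EFinP; exact: measurable_funX.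
apply: (@le_lt_trans _ _
    (\int[m]_x (2%:E * (f x ^+ 2)%:E + 2%:E * (g x ^+ 2)%:E))%E).
  apply: ge0_le_integral => //.
  - by move=> x _; rewrite lee_fin sqr_ge0.
  - by apply/measurable_EFinP; apply: measurable_funX; exact: measurable_funD.
  - by apply: emeasurable_funD; exact: measurable_funeM.
  - move=> x _; rewrite -!EFinM -EFinD lee_fin.
    by have := sqr_ge0 (f x - g x); rewrite sqrrB sqrrD; lra.
rewrite ge0_integralD//; last 4 first.
- by move=> x _; rewrite mule_ge0// lee_fin sqr_ge0.
- exact: measurable_funeM.
- by move=> x _; rewrite mule_ge0// lee_fin sqr_ge0.
- exact: measurable_funeM.
rewrite !ge0_integralZl_EFin//; last 2 first.
- by move=> x _; rewrite lee_fin sqr_ge0.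
- by move=> x _; rewrite lee_fin sqr_ge0.
by rewrite lte_add_pinfty// lte_mul_pinfty.
Qed.

Lemma square_integrableZ (a : R) f : square_integrable f ->
  square_integrable (fun x => a * f x).
Proof.
move=> [mf f2]; split; first exact: measurable_funM.
under eq_integral do rewrite exprMn EFinM.
rewrite ge0_integralZl_EFin ?sqr_ge0//.
- by rewrite lte_mul_pinfty// lee_fin sqr_ge0.
- by move=> x _; rewrite lee_fin sqr_ge0.
- by apply/measurable_EFinP; exact: measurable_funX.
Qed.

Lemma square_integrableB f g : square_integrable f -> square_integrable g ->
  square_integrable (fun x => f x - g x).
Proof.
move=> hf /(square_integrableZ (-1)) hg; have := square_integrableD hf hg.
by under eq_fun do rewrite mulN1r.
Qed.

Lemma square_integrable0 : square_integrable (fun _ => 0).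
Proof.
split; first exact: measurable_cst.
by rewrite integral0_eq// => x _; rewrite expr0n.
Qed.

Lemma square_integrable_mul f g : square_integrable f -> square_integrable g ->
  m.-integrable setT (EFin \o (fun x => f x * g x)).
Proof.
move=> hf hg; have [mf _] := hf; have [mg _] := hg.
have [_ hfg2] := square_integrableD hf hg.
have hab : square_integrable (fun x => `|f x| + `|g x|).
  apply: square_integrableD; split; try exact: measurableT_comp.
  - by under eq_integral do rewrite real_normK ?num_real//; case: hf.
  - by under eq_integral do rewrite real_normK ?num_real//; case: hg.
apply: (@le_integrable _ _ _ _ _ _ _ (EFin \o (fun x => (`|f x| + `|g x|) ^+ 2))) => //.
- by apply/measurable_EFinP; exact: measurable_funM.
- move=> x _ /=; rewrite lee_fin normrM [leRHS]ger0_norm ?sqr_ge0//.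
  by have := normr_ge0 (f x); have := normr_ge0 (g x); nra.
- apply: integrable_ge0.
  + by apply: measurable_funX; exact: (hab.1).
  + by move=> x; exact: sqr_ge0.
  + exact: hab.2.
Qed.

Lemma ipC f g : ip f g = ip g f.
Proof. by apply: eq_Rintegral => x _; rewrite mulrC. Qed.

Lemma ipDl f g h : square_integrable f -> square_integrable g ->
  square_integrable h -> ip (fun x => f x + g x) h = ip f h + ip g h.
Proof.
move=> hf hg hh; rewrite /ip -RintegralD//; try exact: square_integrable_mul.
by apply: eq_Rintegral => x _; rewrite mulrDl.
Qed.

Lemma ipZl (a : R) f g : square_integrable f -> square_integrable g ->
  ip (fun x => a * f x) g = a * ip f g.
Proof.
move=> hf hg; rewrite /ip -RintegralZl//; last exact: square_integrable_mul.
by apply: eq_Rintegral => x _; rewrite mulrA.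
Qed.

Lemma ipBl f g h : square_integrable f -> square_integrable g ->
  square_integrable h -> ip (fun x => f x - g x) h = ip f h - ip g h.
Proof.
move=> hf hg hh; rewrite -mulN1r -ipZl// -ipDl//; last exact: square_integrableZ.
by congr (ip _ h); apply/funext => x; rewrite mulN1r.
Qed.

Lemma ip_sqrE f : square_integrable f ->
  (\int[m]_x (f x ^+ 2)%:E = (ip f f)%:E)%E.
Proof.
move=> hf; rewrite /ip /Rintegral fineK; last first.
  by apply: integrable_fin_num => //; exact: square_integrable_mul.
by apply: eq_integral => x _; rewrite expr2.
Qed.

Lemma ip_ge0 f : 0 <= ip f f.
Proof. by apply: Rintegral_ge0 => x _; rewrite -expr2 sqr_ge0. Qed.

Lemma ip_subZ f g (t : R) : square_integrable f -> square_integrable g ->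
  ip (fun x => f x - t * g x) (fun x => f x - t * g x) =
  ip f f - 2 * t * ip f g + t ^+ 2 * ip g g.
Proof.
move=> hf hg; have tg := square_integrableZ t hg.
have fg := square_integrableB hf tg.
rewrite ipBl// ipC ipBl// [X in _ - X]ipC ipBl// !(ipC _ (fun x => t * g x)).
by rewrite !ipZl// (ipC _ (fun x => t * g x)) !ipZl// (ipC g f); ring.
Qed.

End real_L2.

Section L2_projection.
Context d (T : measurableType d) (R : realType).
Variable m : {measure set T -> \bar R}.
Variable r : T -> T -> Prop.
Implicit Types f g h : T -> R.

(** Constancy along [r] is required at every point, not almost everywhere, because
    bi-invariant functions are invariant at every point. *)
Definition L2inv g := square_integrable m g /\ forall x y, r x y -> g x = g y.

Lemma L2invD f g : L2inv f -> L2inv g -> L2inv (fun x => f x + g x).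
Proof.
move=> [f1 f2] [g1 g2]; split; first exact: square_integrableD.
by move=> x y xy; rewrite (f2 x y)// (g2 x y).
Qed.

Lemma L2invZ (a : R) f : L2inv f -> L2inv (fun x => a * f x).
Proof.
move=> [f1 f2]; split; first exact: square_integrableZ.
by move=> x y xy; rewrite (f2 x y).
Qed.

(** The weights [4^n] keep the series of squared increments integrable, hence
    finite almost everywhere, and there the increments are [O(2^-n)]. *)
Lemma ae_cvg_of_increments (g : (T -> R)^nat) :
  (forall n, square_integrable m (g n)) ->
  (forall n, ip m (fun x => g n.+1 x - g n x) (fun x => g n.+1 x - g n x) <=
     4 * 8^-1 ^+ n) ->
  {ae m, forall x, cvgn (fun n => g n x)}.
Proof.
move=> hg gD; pose D n x := g n.+1 x - g n x.
have hD n : square_integrable m (D n) by exact: square_integrableB.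
pose F n x := (4 ^+ n * (D n x) ^+ 2)%:E.
have F0 n x : (0 <= F n x)%E by rewrite lee_fin mulr_ge0 ?sqr_ge0 ?exprn_ge0//.
have mF n : measurable_fun setT (F n).
  apply/measurable_EFinP; apply: measurable_funM => //; apply: measurable_funX.
  by case: (hD n).
have intF : (\int[m]_x (\sum_(n <oo) F n x) <= 8%:E)%E.
  rewrite integral_nneseries//; apply: lime_le.
    by apply: is_cvg_nneseries => n _ _; exact: integral_ge0.
  apply: nearW => n; apply: (@le_trans _ _ (\sum_(0 <= k < n) (4 * 2^-1 ^+ k)%:E)%E).
    apply: lee_sum => k _; rewrite /F.
    under eq_integral do rewrite EFinM.
    rewrite ge0_integralZl_EFin ?exprn_ge0//; last 2 first.
    - by move=> x _; rewrite lee_fin sqr_ge0.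
    - by apply/measurable_EFinP; apply: measurable_funX; case: (hD k).
    rewrite ip_sqrE// -EFinM lee_fin.
    apply: (@le_trans _ _ (4 ^+ k * (4 * 8^-1 ^+ k))).
      by rewrite ler_wpM2l ?exprn_ge0// gD.
    rewrite mulrCA -exprMn (_ : 4 * 8^-1 = 2^-1 :> R)//.
    by rewrite (_ : 8 = 4 * 2 :> R) ?invfM ?mulVKf// ?mulrA ?divff ?mul1r// -natrM.
  rewrite sumEFin lee_fin.
  suff -> : \sum_(0 <= k < n) (4 * 2^-1 ^+ k) = 8 - 8 * 2^-1 ^+ n :> R.
    by rewrite gerBl mulr_ge0// exprn_ge0// invr_ge0.
  elim: n => [|n ih]; first by rewrite big_nil expr0 mulr1 subrr.
  rewrite big_nat_recr//= ih exprS; lra.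
have iF : m.-integrable setT (fun x => \sum_(n <oo) F n x)%E.
  apply/integrableP; split.
    by apply: ge0_emeasurable_sum => // k x _ _.
  under eq_integral do rewrite gee0_abs ?nneseries_ge0//.
  by rewrite (le_lt_trans intF)// ltry.
have := integrable_ae measurableT iF.
apply: filterS => x /(_ I) Fx.
pose S := fine (\sum_(n <oo) F n x)%E.
have S0 : 0 <= S by rewrite fine_ge0// nneseries_ge0.
have FS n : 4 ^+ n * D n x ^+ 2 <= S.
  rewrite -lee_fin fineK//.
  have := @nneseries_lim_ge R (F ^~ x) xpredT 0 n.+1 (fun n _ _ => F0 n x).
  apply: le_trans; rewrite big_nat_recr//= leeDr//.
  by apply: sume_ge0 => k _; exact: F0.
pose a := Num.sqrt S.
have Da n : `|D n x| <= a * 2^-1 ^+ n.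
  rewrite -(@ler_pXn2r _ 2)// ?nnegrE ?mulr_ge0 ?sqrtr_ge0 ?exprn_ge0 ?invr_ge0//.
  rewrite real_normK ?num_real// exprMn sqr_sqrtr// -exprM mulnC exprM.
  rewrite -(ler_pM2l (_ : 0 < 4 ^+ n)) ?exprn_gt0// (le_trans (FS n))//.
  rewrite mulrCA -exprMn (_ : 4 * 2^-1 ^+ 2 = 1 :> R) ?expr1n ?mulr1//.
  by rewrite expr2 -invfM -natrM divff.
have cD : cvgn (series (D ^~ x)).
  apply: normed_cvg; apply: (@series_le_cvg _ _ (geometric a 2^-1)).
  - by move=> n; exact: normr_ge0.
  - by move=> n; rewrite /geometric /= mulr_ge0 ?sqrtr_ge0 ?exprn_ge0 ?invr_ge0//.
  - exact: Da.
  - by apply: is_cvg_geometric_series; rewrite ger0_norm ?invr_ge0// invf_lt1 ?ltr1n.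
rewrite (_ : (fun n => g n x) = (fun n => g 0%N x + series (D ^~ x) n)).
  by apply: is_cvgD => //; exact: is_cvg_cst.
by apply/funext => n; rewrite [LHS](eq_sum_telescope (fun n => g n x)).
Qed.

(** A minimizing sequence for the distance to [h] has summable increments by the
    parallelogram identity, so that it converges almost everywhere.  The upper
    limit [G] is defined at every point and inherits invariance along [r] from the
    sequence; Fatou's lemma shows that it attains the minimum. *)
Lemma L2_projection h : square_integrable m h ->
  exists p, L2inv p /\ forall g, L2inv g -> ip m p g = ip m h g.
Proof.
move=> hh.
pose D g := ip m (fun x => h x - g x) (fun x => h x - g x).
pose E := [set D g | g in L2inv].
have hE : has_inf E.
  split; last by exists 0 => _ [g _ <-]; exact: ip_ge0.
  by exists (D (fun=> 0)); exists (fun=> 0) => //; split => //; exact: square_integrable0.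
pose dd := inf E.
have ddle g : L2inv g -> dd <= D g by move=> Lg; apply: ge_inf; [exact: hE.2|exists g].
have [g gP] : exists g : (T -> R)^nat, forall n, L2inv (g n) /\ D (g n) < dd + 8^-1 ^+ n.
  suff H n : exists g : T -> R, L2inv g /\ D g < dd + 8^-1 ^+ n by have [f fP] := choice H; exists f.
  have e0 : 0 < 8^-1 ^+ n :> R by rewrite exprn_gt0// invr_gt0.
  by have [_ [g Lg <-] Dg] := inf_adherent e0 hE; exists g.
have Lg n : square_integrable m (g n) by case: (gP n) => -[].
(* the parallelogram identity, applied to the midpoint *)
have par g1 g2 : L2inv g1 -> L2inv g2 ->
    ip m (fun x => g1 x - g2 x) (fun x => g1 x - g2 x) <= 2 * D g1 + 2 * D g2 - 4 * dd.
  move=> L1 L2; pose a x := h x - g1 x; pose b x := h x - g2 x.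
  have ha : square_integrable m a by apply: square_integrableB => //; case: L1.
  have hb : square_integrable m b by apply: square_integrableB => //; case: L2.
  have Lmid := L2invZ 2^-1 (L2invD L1 L2).
  have e1 := ip_subZ 1 hb ha; have e2 := ip_subZ (- 1) hb ha.
  have -> : ip m (fun x => g1 x - g2 x) (fun x => g1 x - g2 x) =
      ip m (fun x => b x - 1 * a x) (fun x => b x - 1 * a x).
    by apply: eq_Rintegral => x _; rewrite /a /b; ring.
  have e3 : ip m (fun x => b x - - 1 * a x) (fun x => b x - - 1 * a x) =
      4 * D (fun x => 2^-1 * (g1 x + g2 x)).
    rewrite /D /ip -RintegralZl//; last first.
      by apply: square_integrable_mul; apply: square_integrableB => //; case: Lmid.
    by apply: eq_Rintegral => x _; rewrite /a /b; field.
  have := ddle _ Lmid; rewrite e3 in e2; rewrite e1.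
  rewrite (_ : D g1 = ip m a a)// (_ : D g2 = ip m b b)//.
  lra.
have incr n : ip m (fun x => g n.+1 x - g n x) (fun x => g n.+1 x - g n x) <=
     4 * 8^-1 ^+ n.
  have [L1 D1] := gP n.+1; have [L0 D0] := gP n.
  apply: (le_trans (par _ _ L1 L0)).
  have : 8^-1 ^+ n.+1 <= 8^-1 ^+ n :> R.
    by rewrite exprS ler_piMl ?exprn_ge0 ?invr_ge0// invf_le1 ?ler1n.
  by move: D0 D1; move: (8^-1 ^+ n.+1) (8^-1 ^+ n) (D _) (D _) => *; lra.
have aecv := ae_cvg_of_increments Lg incr.
pose G x := fine (limn_esup (fun n => (g n x)%:E)).
have mG : measurable_fun setT G.
  apply: measurableT_comp; first exact: fine_measurable.
  apply: measurable_fun_limn_esup => n; apply/measurable_EFinP.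
  by case: (Lg n).
have Gr x y : r x y -> G x = G y.
  move=> xy; rewrite /G; congr (fine (limn_esup _)).
  by apply/funext => n; have [[_ gr] _] := gP n; rewrite (gr x y).
have Gcv x : cvgn (fun n => g n x) -> g n x @[n --> \oo] --> G x.
  move=> cgx; rewrite /G.
  have c : (g n x)%:E @[n --> \oo] --> (limn (fun n => g n x))%:E.
    by apply: cvg_EFin => //; exact: nearW.
  by rewrite (cvg_limn_einf_sup c).2.
have DGn : (D (g n))%:E @[n --> \oo] --> dd%:E.
  apply: cvg_EFin; first exact: nearW.
  apply: (squeeze_cvgr (f := cst dd) (h := fun n => dd + 8^-1 ^+ n)).
  - apply: nearW => n; have [L0 D0] := gP n.
    by rewrite ddle//= ltW.
  - exact: cvg_cst.
  - rewrite -[X in _ --> X]addr0; apply: cvgD; first exact: cvg_cst.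
    have z1 : `|8^-1 : R| < 1 by rewrite ger0_norm ?invr_ge0// invf_lt1 ?ltr1n.
    have := cvg_geometric (1 : R) z1; apply: cvg_trans.
    by rewrite (_ : geometric _ _ = (fun n => 8^-1 ^+ n)) //;
      apply/funext => n; rewrite /geometric /= mul1r.
have hgn n : square_integrable m (fun x => h x - g n x) by exact: square_integrableB.
have intG : (\int[m]_x ((h x - G x) ^+ 2)%:E <= dd%:E)%E.
  have mhg n : measurable_fun setT (fun x => ((h x - g n x) ^+ 2)%:E).
    by apply/measurable_EFinP; apply: measurable_funX; case: (hgn n).
  have := fatou m measurableT mhg (fun n x _ => sqr_ge0 _).
  under [X in (_ <= limn_einf X)%E -> _]eq_fun do rewrite ip_sqrE//.
  rewrite (cvg_limn_einf_sup DGn).1; apply: le_trans.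
  rewrite le_eqVlt; apply/orP; left; apply/eqP; apply: ge0_ae_eq_integral => //.
  - by apply/measurable_EFinP; apply: measurable_funX; apply: measurable_funB => //; case: hh.
  - under eq_fun do rewrite -[limn_einf _]oppeK -limn_esupN.
    apply: measurableT_comp => //; apply: measurable_fun_limn_esup => n.
    exact: measurableT_comp.
  - by move=> x _; rewrite lee_fin sqr_ge0.
  - move=> x _; rewrite limn_einf_lim; apply: lime_ge; first exact: is_cvg_einfs.
    apply: nearW => n; apply: le_ereal_inf_tmp => _ [k _ <-].
    by rewrite lee_fin sqr_ge0.
  apply: filterS aecv => x cx _.
  apply/esym; apply: (cvg_limn_einf_sup _).1.
  apply: cvg_EFin; first exact: nearW.
  have c : h x - g n x @[n --> \oo] --> h x - G x.
    by apply: cvgB; [exact: cvg_cst|exact: Gcv].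
  by rewrite expr2; under eq_fun do rewrite expr2; exact: cvgM.
have hGs : square_integrable m (fun x => h x - G x).
  split; last by rewrite (le_lt_trans intG)// ltry.
  by apply: measurable_funB => //; case: hh.
have LG : L2inv G.
  split; last exact: Gr.
  have H := square_integrableB hh hGs.
  have E' : (fun x => h x - (h x - G x)) = G by apply/funext => x; rewrite subKr.
  by move: H; rewrite /= E'.
have DG : D G <= dd by rewrite -lee_fin /D -ip_sqrE.
exists G; split => // e Le; have he := Le.1.
have key t : 0 <= t ^+ 2 * ip m e e - 2 * t * ip m (fun x => h x - G x) e.
  have := ddle _ (L2invD LG (L2invZ t Le)); rewrite /D.
  under [X in ip m X _]eq_fun do rewrite opprD addrA.
  under [X in ip m _ X]eq_fun do rewrite opprD addrA.
  rewrite ip_subZ//; move: DG; rewrite /D; lra.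
suff : ip m (fun x => h x - G x) e = 0.
  rewrite ipBl//; last exact: LG.1.
  by move/eqP; rewrite subr_eq0 => /eqP.
(* a quadratic polynomial in [t] without constant term and of constant sign has no
   linear term; [b + 1] in place of [b] avoids the case [b = 0] *)
have b0 := ip_ge0 m e.
move: key b0; move: (ip m e e) (ip m (fun x => h x - G x) e) => b c key b0.
have := key (c / (b + 1)).
have b1 : 0 < b + 1 by lra.
have cE : c = c / (b + 1) * (b + 1) by rewrite divfK// gt_eqF.
set q := c / (b + 1) in cE *; rewrite {}cE => h1.
have : q ^+ 2 * (b + 2) <= 0.
  have -> : q ^+ 2 * (b + 2) = - (q ^+ 2 * b - 2 * q * (q * (b + 1))) by ring.
  by rewrite oppr_le0.
have b2 : 0 < b + 2 by lra.
rewrite pmulr_lle0// => q2.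
have : q ^+ 2 = 0 by apply/eqP; rewrite eq_le q2 sqr_ge0.
by move/eqP; rewrite sqrf_eq0 => /eqP ->; rewrite mul0r.
Qed.

End L2_projection.

(** * Inner products of complex-valued functions *)

Section complex_L2.
Context d (T : measurableType d) (R : realType).
Variable m : {measure set T -> \bar R}.
Implicit Types f g h : T -> R[i].
Local Notation re f := (fun x => Re (f x)).
Local Notation im f := (fun x => Im (f x)).

Lemma integral_sqr_normc f : cmeasurable f ->
  (\int[m]_x (normc (f x) ^+ 2)%:E =
   \int[m]_x (Re (f x) ^+ 2)%:E + \int[m]_x (Im (f x) ^+ 2)%:E)%E.
Proof.
move=> [mr mi]; rewrite -ge0_integralD//.
- by apply: eq_integral => x _; rewrite sqr_normcE EFinD.
- by move=> x _; rewrite lee_fin sqr_ge0.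
- exact/measurable_EFinP/measurable_funX.
- by move=> x _; rewrite lee_fin sqr_ge0.
- exact/measurable_EFinP/measurable_funX.
Qed.

Lemma cLp2P f : cLp m 2 f <->
  square_integrable m (re f) /\ square_integrable m (im f).
Proof.
split=> [[[mr mi] /cLnorm2_lty]|[[mr r2] [mi i2]]].
  have r0 : (0 <= \int[m]_x (Re (f x) ^+ 2)%:E)%E.
    by apply: integral_ge0 => x _; rewrite lee_fin sqr_ge0.
  have i0 : (0 <= \int[m]_x (Im (f x) ^+ 2)%:E)%E.
    by apply: integral_ge0 => x _; rewrite lee_fin sqr_ge0.
  rewrite integral_sqr_normc// => foo; split; split => //.
    by apply: le_lt_trans foo; rewrite leeDl.
  by apply: le_lt_trans foo; rewrite leeDr.
by split=> //; apply/cLnorm2_lty; rewrite integral_sqr_normc// lte_add_pinfty.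
Qed.

Lemma cLp2_bound f : cLp m 2 f -> exists c : R, 0 <= c /\
  (\int[m]_x (normc (f x) ^+ 2)%:E <= (c ^+ 2)%:E)%E.
Proof.
move=> [_ /cLnorm2_lty foo].
have f0 : (0 <= \int[m]_x (normc (f x) ^+ 2)%:E)%E.
  by apply: integral_ge0 => x _; rewrite lee_fin sqr_ge0.
exists (Num.sqrt (fine (\int[m]_x (normc (f x) ^+ 2)%:E)%E)).
split; first exact: sqrtr_ge0.
by rewrite sqr_sqrtr ?fine_ge0// fineK// ge0_fin_numE.
Qed.

Lemma cLp2_lin (a b : R[i]) f g : cLp m 2 f -> cLp m 2 g ->
  cLp m 2 (fun x => a * f x + b * g x).
Proof.
move=> /cLp2P[fr fi] /cLp2P[gr gi]; apply/cLp2P; split.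
  under eq_fun do rewrite !complex_simp.
  apply: square_integrableD; apply: square_integrableB; exact: square_integrableZ.
under eq_fun do rewrite !complex_simp.
by apply: square_integrableD; apply: square_integrableD; exact: square_integrableZ.
Qed.

Lemma inner_integrable f g : cLp m 2 f -> cLp m 2 g ->
  cintegrable m (fun x => f x * conjc (g x)).
Proof.
move=> /cLp2P[fr fi] /cLp2P[gr gi]; split.
  apply: (eq_integrable measurableT (fun x => (Re (f x) * Re (g x))%:E +
    (Im (f x) * Im (g x))%:E)%E).
    by move=> x _; rewrite !complex_simp mulrN opprK EFinD.
  by apply: integrableD => //; exact: square_integrable_mul.
apply: (eq_integrable measurableT (fun x => (Im (f x) * Re (g x))%:E -
    (Re (f x) * Im (g x))%:E)%E).
  by move=> x _; rewrite !complex_simp -EFinB; congr EFin; rewrite mulrN addrC.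
by apply: integrableB => //; exact: square_integrable_mul.
Qed.

Lemma Re_inner f g : cLp m 2 f -> cLp m 2 g ->
  Re (inner m f g) = ip m (re f) (re g) + ip m (im f) (im g).
Proof.
move=> /cLp2P[fr fi] /cLp2P[gr gi]; rewrite /inner /ip.
change (Rintegral m setT (fun x => Re (f x * conjc (g x))) =
  Rintegral m setT (fun x => Re (f x) * Re (g x)) +
  Rintegral m setT (fun x => Im (f x) * Im (g x))).
rewrite -RintegralD//; [|exact: square_integrable_mul|exact: square_integrable_mul].
by apply: eq_Rintegral => x _; rewrite !complex_simp mulrN opprK.
Qed.

Lemma Im_inner f g : cLp m 2 f -> cLp m 2 g ->
  Im (inner m f g) = ip m (im f) (re g) - ip m (re f) (im g).
Proof.
move=> /cLp2P[fr fi] /cLp2P[gr gi]; rewrite /inner /ip.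
change (Rintegral m setT (fun x => Im (f x * conjc (g x))) =
  Rintegral m setT (fun x => Im (f x) * Re (g x)) -
  Rintegral m setT (fun x => Re (f x) * Im (g x))).
rewrite -RintegralB//; [|exact: square_integrable_mul|exact: square_integrable_mul].
by apply: eq_Rintegral => x _; rewrite !complex_simp mulrN addrC.
Qed.

Lemma inner_lin (a b : R[i]) f g h : cLp m 2 f -> cLp m 2 g -> cLp m 2 h ->
  inner m (fun x => a * f x + b * g x) h = a * inner m f h + b * inner m g h.
Proof.
move=> f2 g2 h2; have If := inner_integrable f2 h2; have Ig := inner_integrable g2 h2.
rewrite /inner -!cintegralZ// -cintegralD; last 2 first.
- exact: cintegrableZ.
- exact: cintegrableZ.
by congr cintegral; apply/funext => x; rewrite mulrDl !mulrA.
Qed.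

Lemma inner_eq0_ae f : cLp m 2 f -> inner m f f = 0 -> {ae m, forall x, f x = 0}.
Proof.
move=> f2 ff; have /cLp2P[fr fi] := f2; have mf : cmeasurable f by case: f2.
have i0 : (\int[m]_x (normc (f x) ^+ 2)%:E = 0)%E.
  by rewrite integral_sqr_normc// !ip_sqrE// -EFinD -Re_inner// ff.
have msq : measurable_fun setT (fun x => (normc (f x) ^+ 2)%:E).
  by apply/measurable_EFinP; exact: measurable_sqr_normc.
have : (\int[m]_x `|(normc (f x) ^+ 2)%:E| = 0)%E.
  by rewrite -[RHS]i0; apply: eq_integral => x _; rewrite gee0_abs// lee_fin sqr_ge0.
move/(ae_eq_integral_abs m measurableT msq).
apply: filterS => x /(_ Logic.I) /= [/eqP]; rewrite sqrf_eq0 => /eqP.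
exact: ComplexField.Normc.eq0_normc.
Qed.

(** The test function [e] is the difference, in the shape used by [inner_lin]. *)
Lemma inner_eq_ae f g : cLp m 2 f -> cLp m 2 g ->
  let e := fun x => 1 * f x + -1 * g x in
  inner m f e = inner m g e -> {ae m, forall x, f x = g x}.
Proof.
move=> f2 g2 e fg; have e2 : cLp m 2 e by exact: cLp2_lin.
have : inner m e e = 0 by rewrite inner_lin// fg mul1r mulN1r subrr.
move/(inner_eq0_ae e2); apply: filterS => x; rewrite /e mul1r mulN1r.
by move/eqP; rewrite subr_eq0 => /eqP.
Qed.

End complex_L2.

(** * Continuous functions to the complex numbers *)

Section complex_topology.
Context {R : realType}.

Lemma ccontinuousP {T : topologicalType} (f : T -> R[i]) x :
  {for x, continuous (f : T -> R[i]^o)} <->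
  forall e : R, 0 < e -> \forall y \near x, normc (f y - f x) < e.
Proof.
have E e y : (`|(f x : R[i]^o) - f y| < e%:C%C) = (normc (f y - f x) < e).
  by rewrite normcB_sym -ltcR.
split => [cf e e0|H].
  have := @cvgr_dist_lt _ _ _ (nbhs x) _ (f : T -> R[i]^o) (f x) cf e%:C%C.
  by rewrite ltcR => /(_ _ e0); apply: filterS => y; rewrite E.
apply/cvgrPdist_lt => e e0.
have eE : e = (Re e)%:C%C.
  apply: complex_ext => //=; exact: (ger0_Im (ltW e0)).
rewrite eE in e0 *; rewrite ltcR in e0.
by apply: filterS (H _ e0) => y; rewrite E.
Qed.

Lemma near_Re_continuous {T : topologicalType} (f : T -> R[i]) :
  (forall x (e : R), 0 < e -> \forall y \near x, normc (f y - f x) < e) ->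
  continuous (fun x => Re (f x)) /\ continuous (fun x => Im (f x)).
Proof.
move=> H; split => x; apply/cvgrPdist_lt => e e0; apply: filterS (H x e e0) => y;
  apply: le_lt_trans.
- by rewrite -ReN -ReD -normcN opprB; exact: normr_Re_le.
- by rewrite -ImN -ImD -normcN opprB; exact: normr_Im_le.
Qed.

Lemma ccontinuous_cmeasurable {T : ptopologicalType} (f : borel T -> R[i]) :
  @ccontinuous R T f -> cmeasurable f.
Proof.
move=> cf; have [c1 c2] : continuous (fun x : T => Re (f x)) /\
    continuous (fun x : T => Im (f x)).
  by apply: near_Re_continuous => x; apply/ccontinuousP; exact: cf.
by split; exact: continuous_borel_real.
Qed.

End complex_topology.

(** * Bi-invariant open sets and bump functions *)

Section haar_topology.
Context {R : realType} {G : topologicalGroupType}.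
Variable mu : {measure set (borel G) -> \bar R}.
Hypotheses (hG : hausdorff_space G) (lcG : locally_compact [set: G]).
Hypothesis hmu : left_haar mu.
Variable K : set G.
Hypothesis cptK : compact_subgroup K.

Let rmu : radon mu. Proof. by case: hmu. Qed.
Let cK : compact K. Proof. by case: cptK. Qed.
Let K1 : K 1%g. Proof. by case: cptK. Qed.
Let KM x y : K x -> K y -> K (x * y)%g.
Proof. by move=> Kx Ky; case: cptK => _ _ + _; apply; rewrite inE. Qed.
Let KV x : K x -> K (x^-1)%g.
Proof. by move=> Kx; case: cptK => _ _ _; apply; rewrite inE. Qed.

(** If [U] were null, so would be its translates and every compact set; inner
    regularity then makes [mu] vanish. *)
Lemma haar_open_gt0 (U : set G) x : open U -> U x -> (0 < mu U)%E.
Proof.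
move=> oU Ux; rewrite lt0e measure_ge0 andbT; apply/eqP => U0.
have [_ mu0 _] := hmu; have [_ _ inner] := rmu.
move/eqP : mu0; apply; rewrite (inner _ openT).
apply/eqP; rewrite eq_le; apply/andP; split; last first.
  by apply: ereal_sup_ubound; exists set0; [split=> //; exact: compact0|
     rewrite measure0].
apply: ge_ereal_sup => _ [C [cC _] <-].
suff [_] : measurable (C : set (borel G)) /\ (mu C <= 0)%E by [].
suff : exists2 B : set G, C `<=` B & measurable (B : set (borel G)) /\ mu B = 0%E.
  move=> [B CB [mB B0]]; have mC := compact_borel hG cC; split => //.
  by rewrite -B0; apply: le_measure; rewrite ?inE.
apply: (@compact_ind G (fun S => exists2 B : set G, S `<=` B &
  measurable (B : set (borel G)) /\ mu B = 0%E) _ cC).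
- by exists set0.
- by move=> A B AB [D BD DP]; exists D => // y /AB /BD.
- move=> A B [A' AA' [mA A0]] [B' BB' [mB B0]]; exists (A' `|` B').
    by move=> y [/AA'|/BB']; [left|right].
  split; first exact: measurableU.
  apply/eqP; rewrite eq_le measure_ge0 andbT.
  apply: (@le_trans _ _ (mu A' + mu B')%E); first exact: measureU2.
  by rewrite A0 B0 adde0.
move=> y _; pose t := (y * x^-1)%g.
have ot : open [set z | U (t^-1 * z)%g].
  by move/continuousP : (@continuous_mulgl G t^-1%g); exact.
exists [set z | U (t^-1 * z)%g].
  apply: open_nbhs_nbhs; split => //=.
  by rewrite /t invgM invgK -mulgA mulVg mulg1.
exists [set z | U (t^-1 * z)%g] => //; split; first exact: open_borel.
by rewrite (haar_preimage hmu)//; exact: open_borel.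
Qed.

(** The open set [K U K], written so that it is bi-[K]-invariant at sight. *)
Definition bisat (U : set G) : set G :=
  \bigcup_(p in K `*` K) [set x | U (p.1 * x * p.2)%g].

Lemma sub_bisat U : U `<=` bisat U.
Proof. by move=> x Ux; exists (1%g, 1%g) => //=; rewrite mul1g mulg1. Qed.

Lemma open_bisat U : open U -> open (bisat U).
Proof.
move=> oU; apply: bigcup_open => -[k k'] _ /=.
have c : continuous (fun x : G => (k * x * k')%g).
  apply: continuous_mulg; last exact: cst_continuous.
  exact: continuous_mulgl.
by move/continuousP : c; exact.
Qed.

Lemma bisat_mulK U x k k' : K k -> K k' -> bisat U (k * x * k')%g <-> bisat U x.
Proof.
move=> Kk Kk'; split => -[[l l'] /= [Kl Kl'] Ul].
  exists ((l * k)%g, (k' * l')%g); first by split; exact: KM.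
  by rewrite /= !mulgA in Ul *.
exists ((l * k^-1)%g, (k'^-1 * l')%g) => /=; first by split; apply: KM => //; exact: KV.
by rewrite !mulgA (mulgVK k) (mulgK k').
Qed.

Lemma bisat_sub_compact (U C : set G) : U `<=` C -> compact C ->
  exists2 D, compact D & bisat U `<=` D.
Proof.
move=> UC cC; pose h (p : G * G * G) := (p.1.1^-1 * p.2 * p.1.2^-1)%g.
exists (h @` ((K `*` K) `*` C)).
  apply: continuous_compact; last by apply: compact_setX => //; exact: compact_setX.
  apply: continuous_subspaceT => x; apply: continuous_mulg => {}x.
    apply: continuous_mulg => {}x; last exact: cvg_snd.
    apply: continuous_invg => {}x; apply: continuous_comp; exact: cvg_fst.
  apply: continuous_invg => {}x.
  by apply: continuous_comp; [exact: cvg_fst|exact: cvg_snd].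
move=> x [[k k'] /= [Kk Kk'] Uk]; exists ((k, k'), (k * x * k')%g) => //=.
  by split => //; exact: UC.
by rewrite /h /= !mulgA mulVg mul1g mulgK.
Qed.

Lemma bisat_fin (U C : set G) : open U -> U `<=` C -> compact C ->
  (mu (bisat U) < +oo)%E.
Proof.
move=> oU UC /(bisat_sub_compact UC)[D cD UD].
have [+ _ _] := rmu => /(_ _ cD); apply: le_lt_trans; apply: le_measure => //.
  by rewrite inE; apply: open_borel; exact: open_bisat.
by rewrite inE; exact: compact_borel.
Qed.

Lemma precompact_nbhs1 : exists C : set G, compact C /\ nbhs 1%g C.
Proof.
have := @lcG 1%g I; rewrite withinET => -[C C1 [cC _]].
by exists C; split.
Qed.

(** A bump near [1] becomes bi-[K]-invariant by taking suprema over [K x K],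
    so that no invariant measure on [K] is needed. *)
Lemma biinvariant_bump (U : set G) : nbhs 1%g U ->
  exists F : G -> R, [/\ continuous F, forall x, 0 <= F x <= 1,
    forall x k k', K k -> K k' -> F (k * x * k')%g = F x,
    F 1%g = 1 & forall x, F x != 0 -> bisat U x].
Proof.
move=> U1.
have [b [cb b01 b1 bU]] : exists b : G -> R, [/\ continuous b,
    forall x, 0 <= b x <= 1, b 1%g = 1 & forall x, b x != 0 -> U x].
  have cU : closed (~` (interior U)) by rewrite closedC; exact: open_interior.
  have nU : ~ (~` (interior U)) (1%g : G) by move=> /(_ U1).
  have := @locally_compact_completely_regular G R lcG hG 1%g _ cU nU.
  move=> /uniform_separatorP => /(_ R)[f [cf f01 f0 f1]].
  exists (fun x => 1 - f x); split.
  - by move=> x; apply: cvgB; [exact: cvg_cst|exact: cf].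
  - move=> x; have : `[0, 1]%classic (f x) by apply: f01; exists x.
    by rewrite /= in_itv /= => /andP[? ?]; rewrite subr_ge0 gerBl; apply/andP.
  - by rewrite (f0 (f 1%g))// ?subr0//; exists 1%g.
  - move=> x; apply: contraNP => nUx; rewrite subr_eq0 eq_sym.
    by apply/eqP; apply: f1; exists x => // /interior_subset.
pose S x : set R := [set b (p.1 * x * p.2)%g | p in K `*` K].
have S0 x : S x !=set0 by exists (b (1 * x * 1)%g); exists (1%g, 1%g).
have Sub x : ubound (S x) 1 by move=> _ [p _ <-]; have /andP[] := b01 (p.1 * x * p.2)%g.
have Shs x : has_sup (S x) by split => //; exists 1.
have Sle x k k' : K k -> K k' -> b (k * x * k')%g <= sup (S x).
  by move=> Kk Kk'; apply: ub_le_sup; [exact: (Shs x).2|exists (k, k')].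
exists (fun x => sup (S x)); split.
- move=> x; apply/cvgrPdist_le => e e0.
  have : \forall y \near x, K `*` K `<=`
      [set p | `|b (p.1 * y * p.2)%g - b (p.1 * x * p.2)%g| < e].
    have /compact_near_coveringP cKK : compact (K `*` K) by exact: compact_setX.
    apply: (cKK _ _ (fun y p => `|b (p.1 * y * p.2)%g - b (p.1 * x * p.2)%g| < e)).
    move=> p _.
    have c : continuous (fun q : (G * G) * G =>
        b (q.1.1 * q.2 * q.1.2)%g - b (q.1.1 * x * q.1.2)%g).
      have cc (h : G * G * G -> G) : continuous h -> continuous (b \o h).
        by move=> ch q; apply: continuous_comp; [exact: ch|exact: cb].
      have c1 : continuous (fun q : G * G * G => q.1.1).
        by move=> q; apply: continuous_comp; exact: cvg_fst.
      have c2 : continuous (fun q : G * G * G => q.1.2).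
        by move=> q; apply: continuous_comp; [exact: cvg_fst|exact: cvg_snd].
      have c3 : continuous (fun q : G * G * G => q.2) by move=> q; exact: cvg_snd.
      move=> q; apply: cvgB.
        by apply: (cc (fun q => q.1.1 * q.2 * q.1.2)%g);
          do 2 apply: continuous_mulg => //.
      by apply: (cc (fun q => q.1.1 * x * q.1.2)%g);
        do 2 apply: continuous_mulg => //; exact: cst_continuous.
    have := c (p, x); rewrite /continuous_at /= subrr => /cvgr0Pnorm_lt.
    exact.
  apply: filterS => y yK.
  have le1 : sup (S y) <= sup (S x) + e.
    apply: ge_sup => // _ [p pK <-]; have [Kp1 Kp2] := pK.
    have := yK _ pK; rewrite /= ltr_norml => /andP[_ h].
    have := Sle x _ _ Kp1 Kp2; lra.
  have le2 : sup (S x) <= sup (S y) + e.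
    apply: ge_sup => // _ [p pK <-]; have [Kp1 Kp2] := pK.
    have := yK _ pK; rewrite /= ltr_norml => /andP[h _].
    have := Sle y _ _ Kp1 Kp2; lra.
  rewrite ler_norml; apply/andP; split; lra.
- move=> x; apply/andP; split; last exact: ge_sup.
  apply: le_trans (Sle x _ _ K1 K1); by have /andP[] := b01 (1 * x * 1)%g.
- move=> x k k' Kk Kk'; congr sup; apply/seteqP; split => _ [[l l'] /= [Kl Kl'] <-].
    exists ((l * k)%g, (k' * l')%g); first by split; exact: KM.
    by rewrite /= !mulgA.
  exists ((l * k^-1)%g, (k'^-1 * l')%g) => /=; first by split; apply: KM => //; exact: KV.
  by rewrite !mulgA (mulgVK k) (mulgK k').
- apply/eqP; rewrite eq_le; apply/andP; split; first exact: ge_sup.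
  by have := Sle 1%g _ _ K1 K1; rewrite !mulg1 b1.
- move=> x; apply: contraNP => nUx; apply/eqP; rewrite (_ : S x = [set 0]).
    exact: sup1.
  apply/seteqP; split => [_ [p pK <-]|_ ->] /=.
    by apply: contrapT => /eqP /bU Up; apply: nUx; exists p.
  exists (1%g, 1%g) => //=; apply: contrapT => /eqP /bU Up; apply: nUx.
  by exists (1%g, 1%g).
Qed.

End haar_topology.

(** * Positive-definite functions *)

Section positive_definite.
Context {R : realType} {G : topologicalGroupType}.
Variable phi : G -> R[i].
Hypothesis pd : positive_definite phi.

(** The positivity condition at the three points [1], [x] and [y]. *)
Let pd3 (a b c : R[i]) x y : 0 <=
  (a * conjc a + b * conjc b + c * conjc c) * phi 1%g
  + (b * conjc a * phi x + a * conjc b * phi (x^-1)%g)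
  + (c * conjc a * phi y + a * conjc c * phi (y^-1)%g)
  + (c * conjc b * phi (x^-1 * y)%g + b * conjc c * phi (y^-1 * x)%g).
Proof.
have := @pd 3 (fun i => [:: a; b; c]`_i) (fun i => nth 1%g [:: 1%g; x; y] i).
rewrite !big_ord_recl !big_ord0 /= !invg1 !mul1g !mulg1 !mulVg !addr0.
by congr (0 <= _); ring.
Qed.

Let phi1 : Im (phi 1%g) = 0.
Proof.
have := @pd3 1 0 0 1%g 1%g; rewrite lecE => /andP[/eqP/= + _].
by rewrite !complex_simp /= !(mul0r, mulr0, mul1r, mulr1, addr0, oppr0, subr0, add0r) => ->.
Qed.

Lemma positive_definiteV x : phi (x^-1)%g = conjc (phi x).
Proof.
have := @pd3 1 1 0 x 1%g; have := @pd3 1 'i%C 0 x 1%g.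
rewrite !lecE => /andP[/eqP/= + _] /andP[/eqP/= + _].
rewrite !complex_simp /= phi1.
move: (phi x) (phi (x^-1)%g) => [p q] [r s] /= h1 h2.
by congr (_ +i* _)%C; lra.
Qed.

(** Coefficients [- phi x], [1], [0] at the points [1], [x], [1]. *)
Lemma positive_definite_normc_le : phi 1%g = 1 -> forall x, normc (phi x) <= 1.
Proof.
move=> p1 x; have := @pd3 (- phi x) 1 0 x 1%g.
rewrite positive_definiteV p1 lecE => /andP[_].
have := sqr_normcE (phi x); have := normc_ge0 (phi x).
rewrite !complex_simp /=; move: (normc (phi x)) => n; case: (phi x) => p q /=.
by nra.
Qed.

(** Krein's inequality, from the coefficients [phi y - phi x], [1], [-1] at the
    points [1], [x], [y]. *)
Lemma positive_definite_dist : phi 1%g = 1 ->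
  forall x y, normc (phi x - phi y) ^+ 2 <= 2 * (1 - Re (phi (x^-1 * y)%g)).
Proof.
move=> p1 x y; have := @pd3 (phi y - phi x) 1 (- 1) x y.
rewrite !positive_definiteV p1 -[(y^-1 * x)%g]invgK invgM invgK positive_definiteV.
rewrite lecE => /andP[_]; rewrite sqr_normcE !complex_simp /=.
case: (phi x) => a b; case: (phi y) => c d; case: (phi _) => e f /=.
by nra.
Qed.

End positive_definite.

(** * Bounded spherical functions at the unit *)

Section Cc_functions.
Context {R : realType} {G : topologicalGroupType}.
Implicit Types g : G -> R[i].

Lemma Cc_bounded g : Cc g ->
  exists M : R, forall x, normc (g x) <= M * \1_(closure [set x | g x != 0]) x.
Proof.
move=> [cg ccg]; set C := closure _.
have [M MC] : exists M : R, forall x, C x -> normc (g x) <= M.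
  apply: (@compact_ind G (fun S => exists M : R, forall x, S x -> normc (g x) <= M)
    _ ccg).
  - by exists 0.
  - by move=> A B AB [M MB]; exists M => x /AB /MB.
  - move=> A B [M MA] [N NB]; exists (Num.max M N) => x [/MA|/NB] h.
      by rewrite le_max h.
    by rewrite le_max h orbT.
  - move=> x _; exists [set y | normc (g y - g x) < 1].
      by move/ccontinuousP : (cg x); exact.
    exists (normc (g x) + 1) => y /= gy.
    have := le_normcD (g y - g x) (g x); rewrite subrK => /le_trans; apply.
    by rewrite addrC lerD2l ltW.
exists M => x; rewrite indicE; have [xC|xC] := boolP (x \in C).
  by rewrite mulr1 MC// -inE.
rewrite mulr0; have [->|gx] := eqVneq (g x) 0; first by rewrite ComplexField.Normc.normc0.
by exfalso; move/negP : xC; apply; rewrite inE; apply: subset_closure.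
Qed.

(** Uniform continuity.  For [y] in the support this is compactness; a point [y] off
    the support with [u^-1 y] in it is the case of [u^-1 y] and [u^-1]. *)
Lemma Cc_near_translate g (e : R) : hausdorff_space G -> Cc g -> 0 < e ->
  \forall u \near (1%g : G), forall y, normc (g (u^-1 * y)%g - g y) < e.
Proof.
move=> hG [cg ccg] e0; set C := closure _ in ccg.
pose h (q : G * G) : R[i]^o := g (q.1^-1 * q.2)%g - g q.2.
have cgc (k : G * G -> G) : continuous k ->
    continuous (fun q => g (k q) : R[i]^o).
  move=> ck q.
  by apply: (@continuous_comp _ _ _ k (g : G -> R[i]^o)); [exact: ck|exact: cg].
have ch : continuous h.
  move=> q; apply: cvgB.
    apply: (cgc (fun q => (q.1^-1 * q.2)%g)); apply: continuous_mulg => {}q.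
      by apply: continuous_invg => {}q; exact: cvg_fst.
    exact: cvg_snd.
  by apply: (cgc snd) => {}q; exact: cvg_snd.
have nC : \forall u \near (1%g : G), C `<=` [set y | normc (h (u, y)) < e].
  move/compact_near_coveringP : ccg => cC.
  apply: (cC _ _ (fun u y => normc (h (u, y)) < e)) => y _.
  have /ccontinuousP/(_ e e0) := ch (1%g, y).
  have -> : h (1%g, y) = 0 by rewrite /h /= invg1 mul1g subrr.
  move=> [[P Q] /= [P1 Qy] PQ].
  exists (Q, P) => //= -[a b] /= [Qa Pb].
  by rewrite -[h _]subr0; exact: (PQ (b, a)).
have nV : \forall u \near (1%g : G), C `<=` [set y | normc (h ((u^-1)%g, y)) < e].
  have : (u^-1)%g @[u --> (1%g : G)] --> (1%g : G).
    by rewrite -[X in _ --> X]invg1; exact: invg_continuous.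
  by move=> /(_ _ nC).
have g0 y : ~ C y -> g y = 0.
  by move=> nCy; apply: contrapT => /eqP gy; apply: nCy; exact: subset_closure.
near=> u => y.
have [Cy|nCy] := pselect (C y); first by apply: (near nC u).
have [Cuy|nCuy] := pselect (C (u^-1 * y)%g); last first.
  by rewrite !g0// subrr ComplexField.Normc.normc0.
have := near nV u _ _ Cuy; rewrite /h /= invgK mulVKg normcB_sym; exact.
Unshelve. all: by end_near. Qed.

End Cc_functions.

Section spherical_functions.
Context {R : realType} {G : topologicalGroupType}.
Variable mu : {measure set (borel G) -> \bar R}.
Hypotheses (hG : hausdorff_space G) (lcG : locally_compact [set: G]).
Hypothesis hmu : left_haar mu.
Variable K : set G.
Hypothesis cptK : compact_subgroup K.

Let rmu : radon mu. Proof. by case: hmu. Qed.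
Let K1 : K 1%g. Proof. by case: cptK. Qed.

Lemma integrable_scaled_indic (A : set G) (c : R) : measurable (A : set (borel G)) ->
  (mu A < +oo)%E -> mu.-integrable setT (EFin \o (fun x => c * \1_A x)).
Proof.
move=> mA Aoo; have : mu.-integrable setT (EFin \o (\1_A : borel G -> R)).
  apply: integrable_ge0 => //.
  by rewrite integral_indic// setIT.
by move=> /(integrableZl measurableT c).
Qed.

Lemma integral_scaled_indic (A : set G) (c : R) : measurable (A : set (borel G)) ->
  (mu A < +oo)%E -> (\int[mu]_x (c * \1_A x)%:E = (c * fine (mu A))%:E)%E.
Proof.
move=> mA Aoo; under eq_integral do rewrite EFinM.
rewrite integralZl//; last first.
  have := integrable_scaled_indic 1 mA Aoo.
  by under eq_fun do rewrite mul1r.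
by rewrite integral_indic// setIT EFinM fineK// ge0_fin_numE.
Qed.

Lemma Cc_cintegrable (g phi : G -> R[i]) (M : R) : Cc g -> ccontinuous phi ->
  (forall x, normc (phi x) <= M) -> cintegrable mu (fun x : borel G => g x * phi x).
Proof.
move=> ccg cphi phiM; have [N Ng] := Cc_bounded ccg.
set C := closure _ in Ng.
have cC : compact C by case: ccg.
have mC := compact_borel hG cC.
have Coo : (mu C < +oo)%E by case: rmu => + _ _; exact.
apply: (@cintegrable_bound _ (borel G) R mu (fun x => g x * phi x)
  (fun x => (N * M) * \1_C x)).
- apply: cmeasurableM; apply: ccontinuous_cmeasurable => //; by case: ccg.
- exact: integrable_scaled_indic.
- move=> x; rewrite ComplexField.Normc.normcM mulrAC.
  by rewrite ler_pM// normc_ge0.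
Qed.

(** Let [F] be a bi-invariant bump near [1] with integral [I], and [g] a function
    with [chi g <> 0], where [chi] is the character of [phi].  Then [F * g] is
    uniformly close to [I g], and [chi F] to [I phi 1], as [phi] is continuous at
    [1].  Multiplicativity gives [I phi(1) chi(g) ~ chi(F * g) ~ I chi(g)], and
    [phi 1 = 1] in the limit. *)
Lemma bounded_spherical1 (phi : G -> R[i]) : bounded_spherical mu K phi ->
  phi 1%g = 1.
Proof.
move=> [[cphi bphi mphi [g [ccg bg] chig]] [M phiM]].
pose chi f := cintegral mu (fun x => f x * phi x).
have M0 : 0 <= M by rewrite (le_trans _ (phiM 1%g))// normc_ge0.
have mgphi := ccontinuous_cmeasurable cphi.
have mg : @cmeasurable _ (borel G) _ g by apply: ccontinuous_cmeasurable; case: ccg.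
have [C0 [cC0 C01]] := precompact_nbhs1 lcG.
have [D0 cD0 CD0] := bisat_sub_compact cptK (@subset_refl _ C0) cC0.
set Cg := closure [set x | g x != 0].
have cCg : compact Cg by case: ccg.
(* a compact set outside which both [F * g] and [g] vanish, for all bumps [F]
   supported in [D0] *)
pose E := (fun p : G * G => (p.1 * p.2)%g) @` (D0 `*` Cg) `|` Cg.
have cE : compact E.
  apply: compactU => //; apply: continuous_compact; last exact: compact_setX.
  by apply: continuous_subspaceT; exact: mulg_continuous.
have mE := compact_borel hG cE.
have Eoo : (mu E < +oo)%E by case: rmu => + _ _; exact.
pose B := fine (mu E).
have B0 : 0 <= B by rewrite fine_ge0.
have g0 y : ~ Cg y -> g y = 0.
  by move=> nCy; apply: contrapT => /eqP gy; apply: nCy; exact: subset_closure.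
suff key e : 0 < e ->
    normc (chi g) * normc (1 - phi 1%g) <= e * (M * B + normc (chi g)).
  apply/esym/eqP; rewrite -subr_eq0; apply/eqP/ComplexField.Normc.eq0_normc.
  have chi0 : 0 < normc (chi g).
    rewrite lt0r normc_ge0 andbT; apply: contra chig => /eqP.
    by move=> /ComplexField.Normc.eq0_normc; rewrite /chi => ->.
  apply/eqP; rewrite eq_le normc_ge0 andbT -(pmulr_rle0 _ chi0).
  apply/ler_addgt0Pr => e e0; rewrite add0r.
  have P0 : 0 < M * B + normc (chi g) by rewrite ltr_wpDl// mulr_ge0.
  by have := key _ (divr_gt0 e0 P0); rewrite divfK// gt_eqF.
move=> e0.
pose U := C0 `&` [set u | normc (phi u - phi 1%g) < e] `&`
  [set u | forall y, normc (g (u^-1 * y)%g - g y) < e].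
have U1 : nbhs 1%g U.
  apply: filterI; last exact: Cc_near_translate.
  apply: filterI => //.
  by move/ccontinuousP : (cphi (1%g : G)); exact.
have [F [cF F01 bF F1 FU]] := @biinvariant_bump R G hG lcG K cptK U U1.
have F0 x : 0 <= F x by have /andP[] := F01 x.
have UD0 : bisat K U `<=` D0.
  by apply: subset_trans CD0 => x [p pK [[Cp _] _]]; exists p.
have FD0 x : F x != 0 -> D0 x by move=> /FU /UD0.
have Fphi x : F x != 0 -> normc (phi x - phi 1%g) <= e.
  move=> /FU[[k k'] /= [Kk Kk'] [[_ /= h] _]].
  by rewrite -(bphi x k k')// ltW.
have Fg x y : F x != 0 -> normc (g (x^-1 * y)%g - g y) <= e.
  move=> /FU[[k k'] /= [Kk Kk'] [_ /= h]].
  have := h (k * y)%g; rewrite !invgM -!mulgA mulKg => /ltW.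
  have -> : g (k * y)%g = g y by rewrite -[in LHS](mulg1 (k * y)%g) bg.
  have -> : g (k'^-1 * (x^-1 * y))%g = g (x^-1 * y)%g => //.
  have [_ _ _ KV] := cptK.
  by rewrite -[in LHS](mulg1 (_ * (x^-1 * y))%g) bg//; apply: KV; rewrite inE.
pose f x : R[i] := (F x)%:C%C.
have mF : measurable_fun [set: borel G] (F : borel G -> R) by exact: continuous_borel_real.
have mf : @cmeasurable _ (borel G) _ f by exact: cmeasurable_real.
have cD : closed D0 by exact: compact_closed.
have CcKf : CcK K f.
  split; last by move=> x k k' Kk Kk'; rewrite /f bF.
  split.
    move=> x; apply/ccontinuousP => r r0.
    have /cvgrPdist_lt/(_ r r0) := cF x; apply: filterS => y.
    by rewrite /f -rmorphB normc_real distrC.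
  apply: (subclosed_compact _ cD0); first exact: closed_closure.
  rewrite closureE => x; apply; split => // y /= fy; apply: FD0.
  by apply: contra fy => /eqP Fy; rewrite /f Fy.
have D0oo : (mu D0 < +oo)%E by case: rmu => + _ _; exact.
have mD0 := compact_borel hG cD0.
have iF : mu.-integrable setT (EFin \o (F : borel G -> R)).
  apply: le_integrable (integrable_scaled_indic 1 mD0 D0oo) => //.
    exact/measurable_EFinP.
  move=> x _ /=; rewrite lee_fin mul1r !ger0_norm//.
  rewrite indicE; have [xD|xD] := boolP (x \in D0); first by have /andP[] := F01 x.
  have [->//|/FD0 Dx] := eqVneq (F x) 0.
  by move: xD; rewrite notin_setE.
pose I := Rintegral mu setT F.
have IE : (\int[mu]_x (F x)%:E = I%:E)%E by exact: weight_RintegralE.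
have I0 : 0 < I.
  rewrite -lte_fin -IE.
  pose O := [set x | 2^-1 < F x].
  have oO : open O.
    by rewrite (_ : O = F @^-1` `]2^-1, +oo[%classic);
     [move/continuousP : cF; apply; exact: interval_open|
      apply/seteqP; split => x /=; rewrite in_itv/= andbT].
  have O0 : (0 < mu O)%E.
    apply: (haar_open_gt0 hG hmu oO (x := 1%g)); rewrite /O /= F1.
    by rewrite invf_lt1// ltr1n.
  apply: (@lt_le_trans _ _ (\int[mu]_(x in O) (2^-1)%:E)%E).
    rewrite integral_cst; last exact: open_borel.
    by rewrite mule_gt0// lte_fin.
  apply: (@le_trans _ _ (\int[mu]_(x in O) (F x)%:E)%E).
    apply: ge0_le_integral; rewrite //=.
    - exact: open_borel.
    - by apply: measurable_funTS; exact/measurable_EFinP.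
    - by move=> x /= Fx; rewrite lee_fin ltW.
  apply: ge0_subset_integral => //.
  - exact: open_borel.
  - exact/measurable_EFinP.
  - by move=> x _; rewrite lee_fin.
have mconv : @cmeasurable _ (borel G) _ (convolution mu f g).
  apply: (@cmeasurable_section_cintegral _ G G mu F
    (fun p : G * G => f p.2 * g (p.2^-1 * p.1)%g)) => //.
  - by rewrite IE ltry.
  - apply: cmeasurableM.
      apply: (@cmeasurable_comp _ (borel G) R _ (borel (G * G)%type) snd f) => //.
      by apply: continuous_borel => x; exact: cvg_snd.
    apply: (@cmeasurable_comp _ (borel G) R _ (borel (G * G)%type)
      (fun p => (p.2^-1 * p.1)%g) g) => //.
    apply: continuous_borel; apply: continuous_mulg => x; last exact: cvg_fst.
    by apply: continuous_invg => {}x; exact: cvg_snd.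
  - by move=> x z Fz; rewrite /f /= Fz mul0r.
(* [f] is [F] with complex values, and [r] the error in [f * g ~ I g] *)
pose r x := convolution mu f g x - I%:C%C * g x.
have mgx (x : G) : @cmeasurable _ (borel G) _ (fun y => g (y^-1 * x)%g).
  apply: (@cmeasurable_comp _ (borel G) R _ (borel G) (fun y => (y^-1 * x)%g)) => //.
  apply: continuous_borel; apply: continuous_mulg; last exact: cst_continuous.
  exact: invg_continuous.
have rE x : normc (r x) <= e * I * \1_E x.
  rewrite /r /convolution mulrAC; apply: cintegral_weight_dist => //.
  move=> y Fy; rewrite indicE; have [xE|xE] := boolP (x \in E).
    by rewrite mulr1; exact: Fg.
  rewrite mulr0 (g0 x); last by move=> Cx; move/negP : xE; apply; rewrite inE; right.
  rewrite subr0 g0 ?ComplexField.Normc.normc0// => Cyx.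
  move/negP : xE; apply; rewrite inE; left; exists (y, (y^-1 * x)%g) => /=.
    by split => //; exact: FD0.
  by rewrite mulVKg.
have chif : normc (chi f - I%:C%C * phi 1%g) <= e * I.
  by apply: cintegral_weight_dist.
have mr : @cmeasurable _ (borel G) _ r.
  have mIg := cmeasurableZ (- I%:C%C) mg.
  rewrite (_ : r = fun x => convolution mu f g x + - I%:C%C * g x).
    exact: cmeasurableD.
  by apply/funext => x; rewrite mulNr.
have rphi x : normc (r x * phi x) <= e * I * M * \1_E x.
  rewrite ComplexField.Normc.normcM mulrAC.
  by rewrite ler_pM// normc_ge0.
have iE := integrable_scaled_indic (e * I * M) mE Eoo.
have ri : cintegrable mu (fun x : borel G => r x * phi x).
  by apply: (cintegrable_bound _ iE rphi); exact: cmeasurableM.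
have chir : normc (chi r) <= e * I * M * B.
  by apply: (normc_cintegral ri iE rphi); rewrite integral_scaled_indic.
have chifg : chi (convolution mu f g) = I%:C%C * chi g + chi r.
  have gi := Cc_cintegrable ccg cphi phiM.
  rewrite /chi -cintegralZ// -cintegralD//; last exact: cintegrableZ.
  by congr (cintegral mu _); apply/funext => x; rewrite /r; ring.
have : chi f * chi g = I%:C%C * chi g + chi r by rewrite -chifg /chi mphi.
move=> chiE.
have : I * (normc (chi g) * normc (1 - phi 1%g)) <= I * (e * (M * B + normc (chi g))).
  rewrite -[X in X * _](gtr0_norm I0) -normc_real -!ComplexField.Normc.normcM.
  rewrite (_ : _ * _ = (chi f - I%:C%C * phi 1%g) * chi g - chi r); last first.
    rewrite mulrBl chiE; ring.
  apply: (le_trans (le_normcD _ _)); rewrite normcN ComplexField.Normc.normcM.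
  apply: (@le_trans _ _ (e * I * normc (chi g) + e * I * M * B)).
    by apply: lerD => //; apply: ler_wpM2r => //; exact: normc_ge0.
  by rewrite le_eqVlt; apply/orP; left; apply/eqP; ring.
by rewrite ler_pM2l.
Qed.

End spherical_functions.

(** * The topology of the space of positive-definite spherical functions *)

Lemma separating_hausdorff (T U : topologicalType) (I : Type)
    (f : I -> T -> U) : hausdorff_space U -> (forall i, continuous (f i)) ->
  (forall x y, (forall i, f i x = f i y) -> x = y) -> hausdorff_space T.
Proof.
move=> hU cf finj x y xy; apply: finj => i; apply: hU => A B Ax By.
have [z [Az Bz]] := xy _ _ (cf i x _ Ax) (cf i y _ By).
by exists (f i z).
Qed.

Lemma prod_hausdorff (T U : topologicalType) : hausdorff_space T ->
  hausdorff_space U -> hausdorff_space (T * U)%type.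
Proof.
move=> hT hU p q pq.
have h1 : p.1 = q.1.
  apply: hT => A B Ap Bq.
  have := pq (fst @^-1` A) (fst @^-1` B).
  case; [by apply: cvg_fst|by apply: cvg_fst|].
  by move=> z [Az Bz]; exists z.1.
have h2 : p.2 = q.2.
  apply: hU => A B Ap Bq.
  have := pq (snd @^-1` A) (snd @^-1` B).
  case; [by apply: cvg_snd|by apply: cvg_snd|].
  by move=> z [Az Bz]; exists z.2.
by move: p q h1 h2 {pq} => [? ?] [? ?] /= -> ->.
Qed.

Section Splus_topology.
Context {R : realType} {G : topologicalGroupType}.
Variable mu : {measure set (borel G) -> \bar R}.
Hypotheses (hG : hausdorff_space G) (lcG : locally_compact [set: G]).
Hypothesis hmu : left_haar mu.
Variable K : set G.
Hypothesis cptK : compact_subgroup K.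

Local Notation S := (Splus_type mu K).
Local Notation ev := (@Splus_fun R G mu K).

Let rmu : radon mu. Proof. by case: hmu. Qed.

(** The zero function is a point of the type only when it is the only one, so that
    continuity is then trivial. *)
Lemma Splus_dichotomy :
  (forall s : S, Splus mu K (ev s)) \/ (forall s : S, ev s = cst 0).
Proof.
have [S0|S0] := pselect (Splus mu K = set0); [right|left] => s.
  by have [|[]] := set_valP s; rewrite ?S0.
by have [|[]] := set_valP s.
Qed.

Lemma spherical_fourier_near (f : G -> R[i]) (s0 : S) (e : R) :
  LpK mu K 1 f -> 0 < e -> \forall s \near s0,
  normc (spherical_fourier mu f (ev s) - spherical_fourier mu f (ev s0)) < e.
Proof.
move=> Lf e0.
pose F : weak_space mu K -> {ptws (LpK mu K 1) -> R[i]^o} :=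
  fun phi => fun f => spherical_fourier mu (val f) phi.
have cF : continuous F by exact: initial_continuous.
have cv : continuous (val : S -> weak_space mu K) by exact: initial_continuous.
pose f' : LpK mu K 1 := exist _ f (mem_set Lf).
have cp := @proj_continuous (LpK mu K 1) (fun _ => R[i]^o) f'.
pose V : S -> weak_space mu K := val.
have c1 : {for s0, continuous (F \o V)}.
  by apply: continuous_comp; [exact: cv|exact: cF].
pose P (h : {ptws (LpK mu K 1) -> R[i]^o}) : R[i]^o := h f'.
have c : {for s0, continuous (P \o (F \o V))}.
  by apply: continuous_comp; [exact: c1|exact: cp].
by move/ccontinuousP : c => /(_ e e0).
Qed.

Lemma Splus1 phi : Splus mu K phi -> phi 1%g = 1.
Proof. by move=> [bphi _]; exact: (bounded_spherical1 hG lcG hmu cptK bphi). Qed.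

Lemma Splus_ccontinuous phi : Splus mu K phi -> ccontinuous phi.
Proof. by move=> [[[]]]. Qed.

Lemma Splus_biinvariant phi : Splus mu K phi -> biinvariant K phi.
Proof. by move=> [[[]]]. Qed.

Lemma Splus_normc_le1 phi : Splus mu K phi -> forall x, normc (phi x) <= 1.
Proof.
move=> Sphi; apply: positive_definite_normc_le; first by case: Sphi.
exact: Splus1.
Qed.

Lemma Splus_Re phi : Splus mu K phi -> continuous (fun x => Re (phi x)).
Proof.
move=> /Splus_ccontinuous cphi.
by apply: (near_Re_continuous _).1 => x; apply/ccontinuousP; exact: cphi.
Qed.

(** The indicators of the sets [K U K], for [U] open and relatively compact, are
    the only test functions used for the topology of [S]. *)
Let ind (A : set G) (x : G) : R[i] := (\1_A x)%:C%C.

Let ind_LpK (U C : set G) : open U -> U `<=` C -> compact C ->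
  LpK mu K 1 (ind (bisat K U)).
Proof.
move=> oU UC cC.
have mW := open_borel (open_bisat K oU).
have mi : @cmeasurable _ (borel G) _ (ind (bisat K U)).
  by apply: cmeasurable_real; exact: measurable_indic.
split; last first.
  move=> x k k' Kk Kk'; rewrite /ind !indicE; congr ((_%:R)%:C%C).
  by congr nat_of_bool; apply/idP/idP; rewrite !inE;
    [exact: (bisat_mulK cptK U x Kk Kk').1|exact: (bisat_mulK cptK U x Kk Kk').2].
split => //; rewrite cLnorm1E.
under eq_integral do rewrite normc_real ger0_norm//.
by rewrite integral_indic// setIT; exact: (bisat_fin hG hmu cptK oU UC cC).
Qed.

(** The Fourier transform of the indicator of [K U K] evaluates the average of the
    conjugate of [phi] on that set, since [phi (x^-1)] is the conjugate of
    [phi x]. *)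
Let fourier_ind (U C : set G) phi (c : R[i]) (e : R) : open U -> U `<=` C ->
  compact C -> Splus mu K phi ->
  (forall x, bisat K U x -> normc (phi x - c) <= e) ->
  normc (spherical_fourier mu (ind (bisat K U)) phi -
         (fine (mu (bisat K U)))%:C%C * conjc c) <= e * fine (mu (bisat K U)).
Proof.
move=> oU UC cC Sphi phic.
have mW := open_borel (open_bisat K oU).
have Woo := bisat_fin hG hmu cptK oU UC cC.
have iW : mu.-integrable setT (EFin \o (\1_(bisat K U) : borel G -> R)).
  by have := integrable_scaled_indic 1 mW Woo; under eq_fun do rewrite mul1r.
have WE : Rintegral mu setT (\1_(bisat K U) : borel G -> R) =
    fine (mu (bisat K U)).
  by rewrite /Rintegral integral_indic// setIT.
rewrite -WE; apply: cintegral_weight_dist => //.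
  apply: (@cmeasurable_comp _ (borel G) R _ (borel G) (fun x => (x^-1)%g)).
    by apply: continuous_borel; exact: invg_continuous.
  by apply: ccontinuous_cmeasurable; exact: Splus_ccontinuous.
move=> x; rewrite indicE; case: (boolP (x \in _)) => [|_]; last by rewrite eqxx.
rewrite inE => Wx _; rewrite positive_definiteV; last by case: Sphi.
by rewrite -rmorphB normc_conjc; exact: phic.
Qed.

(** Equicontinuity at [1].  Let [W] be an open neighbourhood [K U K] of [1] on which
    [ev s0] is [h]-close to [1], of measure [w], and let [q = 1 - Re (ev s)].
    For [s] close to [s0] the integral of [q >= 0] over [W] is at most [2 h w].  If
    [v] is so small that [v C] stays in [W] for a compact [C] filling [W] up to
    [h w], then the integral of [q] over [v^-1 W] is at most [4 h w].  Krein's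
    inequality gives [|ev s v - 1|^2 <= 4 q(v^-1 y) + 4 q(y)] for all [y], and the
    mean over [y] in [W] is at most [24 h]. *)
Lemma Splus_near1 (s0 : S) (e : R) : (forall s : S, Splus mu K (ev s)) ->
  0 < e -> exists2 V : set G, nbhs 1%g V &
    \forall s \near s0, forall v, V v -> normc (ev s v - 1) <= e.
Proof.
move=> HS e0; pose h := e ^+ 2 / 24.
have h0 : 0 < h by rewrite divr_gt0// exprn_gt0.
have [C0 [cC0 C01]] := precompact_nbhs1 lcG.
pose U := (C0 `&` [set u | normc (ev s0 u - 1) < h])°.
have oU : open U by exact: open_interior.
have UC : U `<=` C0 by move=> y /interior_subset[].
have U1 : U 1%g.
  apply: nbhs_singleton; apply: nbhs_interior; apply: filterI => //.
  have c1 := @Splus_ccontinuous _ (HS s0) 1%g.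
  by move/ccontinuousP : c1 => /(_ h h0); rewrite (Splus1 (HS s0)).
set W := bisat K U; set w := fine (mu W).
have mW := open_borel (open_bisat K oU).
have Woo : (mu W < +oo)%E := bisat_fin hG hmu cptK oU UC cC0.
have WE : mu W = w%:E by rewrite fineK// ge0_fin_numE.
have w0 : 0 < w.
  rewrite -lte_fin -WE; apply: (haar_open_gt0 hG hmu (open_bisat K oU) (x := 1%g)).
  exact: (sub_bisat cptK).
have hw0 : 0 < h * w by rewrite mulr_gt0.
have Lf := ind_LpK oU UC cC0.
have W1 x : W x -> normc (ev s0 x - 1) <= h.
  move=> [[k k'] [/= Kk Kk'] /interior_subset[_ /= Ux]].
  by rewrite -(Splus_biinvariant (HS s0) x Kk Kk') ltW.
have F0 := fourier_ind oU UC cC0 (HS s0) W1.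
have [C [cC CW WC]] := radon_inner_open rmu (open_bisat K oU) Woo hw0.
exists [set v | C `<=` [set y | W (v * y)%g]].
  apply: (@near_compact_section _ _ ((fun p : G * G => (p.1 * p.2)%g) @^-1` W)) => //.
    by have /continuousP := @mulg_continuous G; apply; exact: open_bisat.
  by move=> z Cz; rewrite /= mul1g; exact: CW.
apply: filterS (spherical_fourier_near s0 Lf hw0) => s sF v /= Cv.
have Sphi := HS s; set phi := ev s in Sphi sF *.
have [_ pd] := Sphi; have phi1 := Splus1 Sphi.
have phile := Splus_normc_le1 Sphi.
pose q y := 1 - Re (phi y).
have q0 y : 0 <= q y.
  rewrite subr_ge0 (le_trans _ (phile y))// (le_trans (ler_norm _))//.
  exact: normr_Re_le.
have q2 y : q y <= 2.
  have := phile y; have := normr_Re_le (phi y); rewrite ler_norml /q => /andP[? _] ?; lra.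
have mq : measurable_fun [set: borel G] (q : borel G -> R).
  apply: measurable_funB => //; apply: continuous_borel_real; exact: Splus_Re.
have m1 (A : set (borel G)) : measurable A -> measurable_fun [set: borel G] (\1_A : borel G -> R).
  exact: measurable_indic.
have Is : (\int[mu]_y (q y * \1_W y)%:E <= (2 * (h * w))%:E)%E.
  have iW : mu.-integrable setT (EFin \o (\1_W : borel G -> R)).
    by have := integrable_scaled_indic 1 mW Woo; under eq_fun do rewrite mul1r.
  have iq : mu.-integrable setT (EFin \o (fun y : borel G => q y * \1_W y)).
    apply: le_integrable (integrable_scaled_indic 2 mW Woo) => //.
      by apply/measurable_EFinP; apply: measurable_funM => //; exact: m1.
    move=> y _ /=; rewrite lee_fin !ger0_norm ?mulr_ge0//.
    by rewrite ler_wpM2r.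
  have hatE : w - Re (spherical_fourier mu (ind W) phi) =
      Rintegral mu setT (fun y : borel G => q y * \1_W y).
    rewrite (_ : w = Rintegral mu setT (\1_W : borel G -> R)); last first.
      by rewrite /Rintegral integral_indic// setIT.
    have [ih _] : cintegrable mu (fun x : borel G => ind W x * phi (x^-1)%g).
      apply: (cintegral_weight _ iW (c := 1) _ _).1 => //.
      apply: (@cmeasurable_comp _ (borel G) R _ (borel G) (fun x => (x^-1)%g)).
        by apply: continuous_borel; exact: invg_continuous.
      by apply: ccontinuous_cmeasurable; exact: Splus_ccontinuous.
    rewrite /spherical_fourier /= -RintegralB//.
    apply: eq_Rintegral => y _; rewrite /ind positive_definiteV//.
    rewrite !complex_simp /= /q; ring.
  have -> : (\int[mu]_y (q y * \1_W y)%:E =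
      (Rintegral mu setT (fun y : borel G => (q y * \1_W y)%R))%:E)%E.
    by rewrite /Rintegral fineK//; exact: integrable_fin_num.
  rewrite -hatE lee_fin.
  set f1 := spherical_fourier _ _ _ in sF *.
  set f0 := spherical_fourier _ _ _ in F0 sF.
  have {}sF : normc (f1 - f0) < h * w by exact: sF.
  rewrite rmorph1 mulr1 -/W -/w in F0.
  have a2 := normc_dist_triangle f1 (w%:C)%C f0.
  have := normr_Re_le (f1 - (w%:C)%C); rewrite ReD ReN ler_norml => /andP[a1 _].
  have {}a1 : - normc (f1 - (w%:C)%C) <= Re f1 - w by exact: a1.
  move: a1 a2 sF F0; move: (normc (f1 - (w%:C)%C)) (normc (f1 - f0)).
  by move: (normc (f0 - (w%:C)%C)) (h * w) (Re f1) => *; lra.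
pose A := [set y | W (v * y)%g] `\` C.
have mC := compact_borel hG cC.
have mWv : measurable ([set y | W (v * y)%g] : set (borel G)).
  apply: open_borel.
  by move/continuousP : (@continuous_mulgl G v); apply; exact: open_bisat.
have mA : measurable (A : set (borel G)) by exact: measurableD.
have Av : (mu A <= (h * w)%:E)%E.
  have muWv : mu [set y | W (v * y)%g] = mu W.
    by have := haar_preimage hmu (v^-1)%g mW; rewrite invgK.
  have Wvoo : (mu [set y | W (v * y)%g] < +oo)%E by rewrite muWv.
  rewrite measureD// setIidr// leeBlDl.
    by apply: le_trans (ltW WC); rewrite le_eqVlt; apply/orP; left; apply/eqP.
  by rewrite ge0_fin_numE//; case: rmu => + _ _; exact.
pose Q (y : borel G) := (q y * \1_W (v * y)%g)%:E.
have mQ : measurable_fun setT Q.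
  apply/measurable_EFinP; apply: measurable_funM => //.
  apply: (@measurableT_comp _ _ _ (borel G) (borel G) R) (m1 _ mW) _.
  exact: measurable_mulgl.
have Q0 y : (0 <= Q y)%E by rewrite lee_fin mulr_ge0.
have mqW : measurable_fun [set: borel G] (fun y => (q y * \1_W y)%:E).
  by apply/measurable_EFinP; apply: measurable_funM => //; exact: m1.
have mQv : measurable_fun [set: borel G] (fun y => Q (v^-1 * y)%g).
  by apply: (measurableT_comp mQ); exact: measurable_mulgl.
have Is0 y : (0 <= (q y * \1_W y)%:E)%E by rewrite lee_fin mulr_ge0.
have Qle : (\int[mu]_y Q y <= (4 * (h * w))%:E)%E.
  apply: (@le_trans _ _ (\int[mu]_y ((q y * \1_W y)%:E + (2 * \1_A y)%:E))%E).
    apply: ge0_le_integral => //.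
    - apply/measurable_EFinP; apply: measurable_funD; apply: measurable_funM => //;
        exact: m1.
    - move=> y _; rewrite -EFinD lee_fin !indicE.
      have [Wvy|nWvy] := boolP ((v * y)%g \in W); last first.
        by rewrite mulr0 addr_ge0// mulr_ge0.
      have [Cy|nCy] := pselect (C y).
        by rewrite [y \in W]mem_set ?lerDl ?mulr_ge0//; exact: CW.
      rewrite [y \in A]mem_set.
        by rewrite !mulr1 (le_trans (q2 y))// lerDr mulr_ge0.
      by split => //; rewrite inE in Wvy.
  rewrite ge0_integralD//; last first.
    by apply/measurable_EFinP; apply: measurable_funM => //; exact: m1.
  have Aoo : (mu A < +oo)%E by rewrite (le_lt_trans Av)// ltry.
  rewrite (integral_scaled_indic 2 mA Aoo).
  apply: (le_trans (leeD Is (lexx _))); rewrite -EFinD lee_fin.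
  have : fine (mu A) <= h * w by rewrite -lee_fin fineK// ge0_fin_numE.
  lra.
have key y : normc (phi v - 1) ^+ 2 <= 4 * q (v^-1 * y)%g + 4 * q y.
  have d1 := positive_definite_dist pd phi1 v y.
  have d2 := positive_definite_dist pd phi1 1%g y.
  rewrite invg1 mul1g phi1 in d2; rewrite /q.
  have d3 := normc_dist_triangle (phi v) 1 (phi y).
  rewrite normcB_sym in d2.
  move: (normc_ge0 (phi v - phi y)) (normc_ge0 (phi y - 1)).
  move: d1 d2 d3 (normc_ge0 (phi v - 1)).
  move: (normc (phi v - 1)) (normc (phi v - phi y)) (normc (phi y - 1)) => a b c; move: (Re _) (Re _) => p r.
  move=> b2 c2 abc a0 b0 c0.
  have : a ^+ 2 <= (b + c) ^+ 2 by rewrite ler_pXn2r// nnegrE addr_ge0.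
  by have := sqr_ge0 (b - c); rewrite sqrrB sqrrD; lra.
have : ((normc (phi v - 1) ^+ 2 * w)%:E <= (24 * (h * w))%:E)%E.
  apply: (@le_trans _ _ (\int[mu]_y (4%:E * Q (v^-1 * y)%g +
      4%:E * (q y * \1_W y)%:E))%E).
    have -> : w = fine (mu W) by [].
    rewrite -(integral_scaled_indic _ mW Woo); apply: ge0_le_integral => //.
    - by move=> y _; rewrite lee_fin mulr_ge0// sqr_ge0.
    - by apply/measurable_EFinP; apply: measurable_funM => //; exact: m1.
    - by apply: emeasurable_funD; exact: measurable_funeM.
    - move=> y _; rewrite /Q mulVKg -!EFinM -EFinD lee_fin !mulrA -mulrDl.
      by rewrite ler_wpM2r.
  rewrite ge0_integralD//; last 4 first.
  - by move=> y _; rewrite mule_ge0.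
  - exact: measurable_funeM.
  - by move=> y _; rewrite mule_ge0.
  - exact: measurable_funeM.
  rewrite !ge0_integralZl_EFin//.
  rewrite (ge0_integral_translate hmu v mQ Q0).
  apply: (@le_trans _ _ (4%:E * (4 * (h * w))%:E + 4%:E * (2 * (h * w))%:E)%E).
    by apply: leeD; rewrite lee_wpmul2l.
  by rewrite -!EFinM -EFinD lee_fin; lra.
rewrite lee_fin /h mulrA ler_pM2r// (mulrC 24) divfK// => H.
by rewrite -(@ler_pXn2r _ 2)// ?nnegrE ?normc_ge0// ltW.
Qed.

(** By Krein's inequality and [Splus_near1], the functions [ev s] with [s] near
    [s0] vary little on [K U K] for a small neighbourhood [U] of [x0].  Hence
    [ev s x0] is close to the average of [ev s] over [K U K], which depends
    continuously on [s]. *)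
Lemma Splus_near (p0 : G * S) (e : R) : 0 < e -> \forall p \near p0,
  normc (ev p.2 p.1 - ev p0.2 p0.1) < e.
Proof.
move: p0 => [x0 s0] e0 /=; have [HS|H0] := Splus_dichotomy; last first.
  near=> p; have -> : ev p.2 p.1 - ev s0 x0 = 0 by rewrite !H0 subrr.
  by rewrite ComplexField.Normc.normc0.
have d0 : 0 < (e / 6) ^+ 2 / 2 by rewrite divr_gt0// exprn_gt0// divr_gt0.
have [V V1 sV] := Splus_near1 s0 HS d0.
have [C0 [cC0 C01]] := precompact_nbhs1 lcG.
pose U := [set y | (V `&` C0)° (x0^-1 * y)%g].
have oU : open U.
  move/continuousP : (@continuous_mulgl G (x0^-1)%g); apply.
  exact: open_interior.
have Ux0 : U x0 by rewrite /U /= mulVg; apply: nbhs_singleton; apply: nbhs_interior; exact: filterI.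
pose C := (fun y => (x0 * y)%g) @` C0.
have cC : compact C.
  by apply: continuous_compact => //; apply: continuous_subspaceT; exact: continuous_mulgl.
have UC : U `<=` C.
  move=> y /interior_subset[_ C0y]; exists (x0^-1 * y)%g => //.
  by rewrite mulVKg.
have equi (s : S) y : (forall v, V v -> normc (ev s v - 1) <= (e / 6) ^+ 2 / 2) ->
    U y -> normc (ev s y - ev s x0) <= e / 6.
  move=> sv /interior_subset[Vy _].
  have e60 : 0 <= e / 6 by rewrite divr_ge0// ltW.
  rewrite -(@ler_pXn2r _ 2)// ?nnegrE ?normc_ge0// normcB_sym.
  have [[_ pd] s1] := (HS s, Splus1 (HS s)).
  apply: (le_trans (positive_definite_dist pd s1 x0 y)).
  have := sv _ Vy; have := normr_Re_le (ev s (x0^-1 * y)%g - 1).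
  rewrite !complex_simp /= ler_norml => /andP[h _] h'; lra.
have equiW (s : S) y : (forall v, V v -> normc (ev s v - 1) <= (e / 6) ^+ 2 / 2) ->
    bisat K U y -> normc (ev s y - ev s x0) <= e / 6.
  move=> sv [[k k'] [/= Kk Kk'] Uy].
  by rewrite -(Splus_biinvariant (HS s) y Kk Kk'); exact: equi.
set w := fine (mu (bisat K U)).
have mW := open_borel (open_bisat K oU).
have w0 : 0 < w.
  rewrite fine_gt0// (bisat_fin hG hmu cptK oU UC cC) andbT.
  by apply: (haar_open_gt0 hG hmu (open_bisat K oU) (x := x0)); exact: (sub_bisat cptK).
have Lf := ind_LpK oU UC cC.
have we0 : 0 < w * (e / 6) by rewrite mulr_gt0// divr_gt0.
have nF := spherical_fourier_near s0 Lf we0.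
have H0 := nbhs_singleton sV.
exists (U, [set s | (forall v, V v -> normc (ev s v - 1) <= (e / 6) ^+ 2 / 2) /\
  normc (spherical_fourier mu (ind (bisat K U)) (ev s) -
    spherical_fourier mu (ind (bisat K U)) (ev s0)) < w * (e / 6)]) => /=.
  by split; [exact: open_nbhs_nbhs|exact: filterI].
move=> [x s] [Ux [sv sF]]; change (U x) in Ux.
change (normc (ev s x - ev s0 x0) < e).
have h1 := equi s x sv Ux.
have h2 := fourier_ind oU UC cC (HS s) (fun y => equiW s y sv).
have h3 := fourier_ind oU UC cC (HS s0) (fun y => equiW s0 y H0).
rewrite -/w in h2 h3.
have h4 : normc (ev s x0 - ev s0 x0) <= 3 * (e / 6).
  rewrite -(ler_pM2l w0).
  set a := _%:C%C * _ in h2; set b := _%:C%C * _ in h3.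
  have -> : w * normc (ev s x0 - ev s0 x0) = normc (a - b).
    rewrite /a /b -mulrBr -rmorphB ComplexField.Normc.normcM normc_real.
    by rewrite normc_conjc gtr0_norm.
  set f1 := spherical_fourier _ _ (ev s) in h2 sF *.
  set f2 := spherical_fourier _ _ (ev s0) in h3 sF *.
  have t1 := normc_dist_triangle a b f1; have t2 := normc_dist_triangle f1 b f2.
  rewrite (mulrC (e / 6)) in h2 h3; rewrite normcB_sym in h2.
  have {}sF : normc (f1 - f2) < w * (e / 6) by exact: sF.
  rewrite (mulrCA w).
  move: h2 h3 sF t1 t2; set q := w * _.
  move: (normc (a - b)) (normc (a - f1)) (normc (f1 - b)) (normc (f1 - f2)) (normc (f2 - b)).
  move=> *; lra.
have := normc_dist_triangle (ev s x) (ev s0 x0) (ev s x0); lra.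
Unshelve. all: by end_near. Qed.

Lemma Splus_hausdorff : hausdorff_space S.
Proof.
apply: (@separating_hausdorff S R (bool * G)
  (fun i s => if i.1 then Re (ev s i.2) else Im (ev s i.2))).
- exact: Rhausdorff.
- move=> [b x].
  have H (s : S) (e : R) : 0 < e -> \forall s' \near s, normc (ev s' x - ev s x) < e.
    move=> e0; have := Splus_near (x, s) e0 => -[[P Q] /= [Px Qs] PQ].
    apply: filterS Qs => s' Qs'; apply: (PQ (x, s')); split => //=.
    exact: nbhs_singleton.
  by have [c1 c2] := near_Re_continuous H; case: b.
- move=> s s' ss'; apply: val_inj; apply/funext => x; apply: complex_ext.
    exact: (ss' (true, x)).
  exact: (ss' (false, x)).
Qed.

Lemma Splus_normc_le (s : S) x : normc (ev s x) <= 1.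
Proof.
have [HS|H0] := Splus_dichotomy; first exact: Splus_normc_le1.
by rewrite H0 ComplexField.Normc.normc0.
Qed.

End Splus_topology.

(** * The Stockwell transform *)

Section stockwell_transform.
Context {R : realType} {G : topologicalGroupType}.
Variable mu : {measure set (borel G) -> \bar R}.
Hypotheses (hG : hausdorff_space G) (lcG : locally_compact [set: G]).
Hypothesis hmu : left_haar mu.
Variable K : set G.
Hypothesis cptK : compact_subgroup K.
Local Notation S := (Splus_type mu K).
Local Notation ev := (@Splus_fun R G mu K).
Local Notation Z := (G * S)%type.
Variables (alpha : G -> G) (delta : R) (theta : G -> R[i]).
Hypotheses (calpha : continuous alpha) (mod_delta : modulus mu alpha delta).
Hypotheses (mtheta : @cmeasurable _ (borel G) _ theta).
Hypothesis theta1 : cLnorm mu 2 theta = 1%E.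

Let rmu : radon mu. Proof. by case: hmu. Qed.

Let hZ : hausdorff_space Z.
Proof. by apply: prod_hausdorff => //; exact: Splus_hausdorff. Qed.

(** The modulus of the atom at [(1, phi)], without its factor [phi]. *)
Definition window (y : G) : R := Num.sqrt delta * normc (theta (alpha y)).

Lemma window_ge0 y : 0 <= window y.
Proof. by rewrite mulr_ge0 ?sqrtr_ge0 ?normc_ge0. Qed.

Lemma measurable_window : measurable_fun setT (window : borel G -> R).
Proof.
apply: measurable_funM => //; apply: measurable_normc.
apply: (@cmeasurable_comp _ (borel G) _ _ (borel G) alpha theta) => //.
exact: continuous_borel.
Qed.

Lemma integral_window :
  (\int[mu]_x (window x ^+ 2)%:E = 1)%E.
Proof.
have [d0 md] := mod_delta.
have mq : measurable_fun [set: borel G] (fun x => (normc (theta x) ^+ 2)%:E).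
  by apply/measurable_EFinP; exact: measurable_sqr_normc.
have q0 (x : borel G) : (0 <= (normc (theta x) ^+ 2)%:E)%E.
  by rewrite lee_fin sqr_ge0.
have i1 : (\int[mu]_x (normc (theta x) ^+ 2)%:E = 1)%E.
  move: theta1; rewrite cLnorm2E.
  have : (0 <= \int[mu]_x (normc (theta x) ^+ 2)%:E)%E by exact: integral_ge0.
  move=> i0 e1; have := congr1 (fun y => y `^ 2)%E e1.
  by rewrite -poweRrM mulVf ?pnatr_eq0// poweRe1// poweR1r.
have E : (fun x : borel G => (window x ^+ 2)%:E) =
         (fun x => delta%:E * (normc (theta (alpha x)) ^+ 2)%:E)%E.
  by apply/funext => x; rewrite /window exprMn sqr_sqrtr 1?ltW// EFinM.
rewrite E ge0_integralZl_EFin//; last exact: ltW.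
- have := md _ mq q0; rewrite /= => ->; rewrite i1 mule1 -EFinM mulfV//.
  by rewrite gt_eqF.
- have ma : measurable_fun [set: borel G] (alpha : borel G -> borel G).
    exact: continuous_borel.
  exact: (measurableT_comp mq ma).
Qed.

Lemma normc_atom_le t (s : S) x :
  normc (atom theta alpha delta (ev s) t x) <= window (t^-1 * x)%g.
Proof.
rewrite /atom /window !ComplexField.Normc.normcM normc_real ger0_norm ?sqrtr_ge0//.
rewrite ler_wpM2r ?normc_ge0// ler_piMr ?sqrtr_ge0//.
exact: Splus_normc_le.
Qed.

Lemma atom_cmeasurable (Y : ptopologicalType) (z : Y -> Z) (x : Y -> G) :
  continuous z -> continuous x ->
  @cmeasurable _ (borel Y) _
    (fun y => atom theta alpha delta (ev (z y).2) (z y).1 (x y)).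
Proof.
move=> cz cx.
have c1 : continuous (fun y => (z y).1) by move=> y; exact: continuous_comp (cz y) cvg_fst.
have c2 : continuous (fun y => (z y).2) by move=> y; exact: continuous_comp (cz y) cvg_snd.
rewrite /atom; apply: cmeasurableM.
  apply: cmeasurableM; first exact: cmeasurable_cst.
  apply: ccontinuous_cmeasurable => y; apply/ccontinuousP => e e0.
  have := Splus_near hG lcG hmu cptK (x y, (z y).2) e0.
  apply: (@cvg_pair _ _ _ _ (nbhs (x y)) (nbhs (z y).2)); [exact: cx|exact: c2].
apply: (@cmeasurable_comp _ (borel G) _ _ (borel Y)
  (fun y => alpha ((z y).1^-1 * x y)%g) theta) => //.
apply: continuous_borel => y.
apply: (@continuous_comp _ _ _ (fun y => ((z y).1^-1 * x y)%g) alpha); last exact: calpha.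
by apply: continuous_mulg => //; exact: continuous_invg.
Qed.

Section one_function.
Variable f : G -> R[i].
Hypothesis f2 : cLp mu 2 f.

Let mf : @cmeasurable _ (borel G) _ f. Proof. by case: f2. Qed.

Let translated_window_le (t : G) (c : R) : 0 <= c ->
  (\int[mu]_x (normc (f x) ^+ 2)%:E <= (c ^+ 2)%:E)%E ->
  (\int[mu]_x (normc (f x) * window (t^-1 * x)%g)%:E <= c%:E)%E.
Proof.
move=> c0 fc; rewrite -[c in leRHS]mulr1; apply: integral_mul_le => //.
- exact: measurable_normc.
- exact: (measurableT_comp measurable_window (measurable_mulgl _)).
- by move=> x; exact: normc_ge0.
- by move=> x; exact: window_ge0.
- rewrite expr1n -integral_window.
  rewrite -(ge0_integral_translate hmu t (Q := fun x => (window x ^+ 2)%:E))//.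
    by apply/measurable_EFinP/measurable_funX; exact: measurable_window.
  by move=> x; rewrite lee_fin sqr_ge0.
Qed.

Let mprod (z : Z) : @cmeasurable _ (borel G) _
  (fun x => f x * conjc (atom theta alpha delta (ev z.2) z.1 x)).
Proof.
apply: cmeasurableM => //; apply: cmeasurable_conj.
by apply: (@atom_cmeasurable G (fun=> z) id) => x; [exact: cvg_cst|exact: cvg_id].
Qed.

Let bprod (z : Z) x :
  normc (f x * conjc (atom theta alpha delta (ev z.2) z.1 x)) <=
  normc (f x) * window (z.1^-1 * x)%g.
Proof.
rewrite ComplexField.Normc.normcM normc_conjc ler_wpM2l ?normc_ge0//.
exact: normc_atom_le.
Qed.

Let iprod (z : Z) : mu.-integrable setT
  (EFin \o (fun x : borel G => normc (f x) * window (z.1^-1 * x)%g)).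
Proof.
apply: integrable_ge0.
- apply: measurable_funM; first exact: measurable_normc.
  exact: (measurableT_comp measurable_window (measurable_mulgl _)).
- by move=> x; rewrite mulr_ge0 ?normc_ge0 ?window_ge0.
- have [c [c0 fc]] := cLp2_bound f2.
  exact: le_lt_trans (translated_window_le z.1 c0 fc) (ltry _).
Qed.

Lemma stockwell_integrable (z : Z) : cintegrable mu
  (fun x => f x * conjc (atom theta alpha delta (ev z.2) z.1 x)).
Proof. exact: cintegrable_bound (mprod z) (iprod z) (bprod z). Qed.

Lemma normc_stockwell_le (z : Z) (c : R) : 0 <= c ->
  (\int[mu]_x (normc (f x) ^+ 2)%:E <= (c ^+ 2)%:E)%E ->
  normc (stockwell mu theta alpha delta f z.1 (ev z.2)) <= c.
Proof.
move=> c0 fc; apply: normc_cintegral (iprod z) (bprod z) _.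
  exact: stockwell_integrable.
exact: translated_window_le.
Qed.

Lemma stockwell_cmeasurable : @cmeasurable _ (borel Z) _
  (fun z => stockwell mu theta alpha delta f z.1 (ev z.2)).
Proof.
apply: (@cmeasurable_section_cintegral R Z G mu (fun x => normc (f x) ^+ 2)
  (fun p => f p.2 * conjc (atom theta alpha delta (ev p.1.2) p.1.1 p.2))) => //.
- exact: measurable_sqr_normc.
- by move=> x; exact: sqr_ge0.
- by case: f2 => _ /cLnorm2_lty.
- apply: cmeasurableM.
    apply: (@cmeasurable_comp _ (borel G) _ _ (borel (Z * G)%type)) => //.
    by apply: continuous_borel => p; exact: cvg_snd.
  apply: cmeasurable_conj.
  by apply: (@atom_cmeasurable (Z * G)%type fst snd) => p; [exact: cvg_fst|exact: cvg_snd].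
- move=> z x /eqP; rewrite sqrf_eq0 => /eqP /ComplexField.Normc.eq0_normc -> /=.
  by rewrite mul0r.
Qed.

End one_function.

Lemma stockwell_linear (a b : R[i]) f g (z : Z) : cLp mu 2 f -> cLp mu 2 g ->
  stockwell mu theta alpha delta (fun y => a * f y + b * g y) z.1 (ev z.2) =
  a * stockwell mu theta alpha delta f z.1 (ev z.2) +
  b * stockwell mu theta alpha delta g z.1 (ev z.2).
Proof.
move=> f2 g2; have If := stockwell_integrable f2 z.
have Ig := stockwell_integrable g2 z.
rewrite /stockwell /inner -!cintegralZ// -cintegralD; last 2 first.
- exact: cintegrableZ.
- exact: cintegrableZ.
by congr cintegral; apply/funext => x; rewrite mulrDl !mulrA.
Qed.

End stockwell_transform.

(** * The localization operator *)

Section localization_operator.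
Context {R : realType} {G : topologicalGroupType}.
Variable mu : {measure set (borel G) -> \bar R}.
Hypotheses (hG : hausdorff_space G) (lcG : locally_compact [set: G]).
Hypothesis hmu : left_haar mu.
Variable K : set G.
Hypothesis cptK : compact_subgroup K.
Local Notation S := (Splus_type mu K).
Local Notation ev := (@Splus_fun R G mu K).
Local Notation Z := (G * S)%type.
Variable rho : {measure set (borel Z) -> \bar R}.
Hypothesis rrho : @radon R Z rho.
Variables (alpha : G -> G) (delta : R) (theta : G -> R[i]).
Hypotheses (calpha : continuous alpha) (mod_delta : modulus mu alpha delta).
Hypotheses (mtheta : @cmeasurable _ (borel G) _ theta).
Hypothesis theta1 : cLnorm mu 2 theta = 1%E.
Variable u : Z -> R[i].
Hypothesis L1u : cLp rho 1 u.

Local Notation W := (window alpha delta theta).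

Let hZ : hausdorff_space Z.
Proof. by apply: prod_hausdorff => //; exact: Splus_hausdorff. Qed.

Let mu_ : @cmeasurable _ (borel Z) _ u. Proof. by case: L1u. Qed.

Let v (z : borel Z) : R := normc (u z).

Let v0 z : 0 <= v z. Proof. exact: normc_ge0. Qed.

Let mv : measurable_fun setT v. Proof. exact: measurable_normc. Qed.

Let voo : (\int[rho]_z (v z)%:E < +oo)%E.
Proof. by case: L1u => _; rewrite cLnorm1E. Qed.

Let I : R := fine (cLnorm rho 1 u).

Let vI : (\int[rho]_z (v z)%:E = I%:E)%E.
Proof.
rewrite /I cLnorm1E fineK// ge0_fin_numE//.
by apply: integral_ge0 => z _; exact: v0.
Qed.

Let I0 : 0 <= I.
Proof. by rewrite -lee_fin -vI; apply: integral_ge0 => z _; exact: v0. Qed.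

Let mW2 : measurable_fun [set: borel G] (fun x => (W x ^+ 2)%:E).
Proof. by apply/measurable_EFinP/measurable_funX; exact: measurable_window. Qed.

Let W20 (x : borel G) : (0 <= (W x ^+ 2)%:E)%E.
Proof. by rewrite lee_fin sqr_ge0. Qed.

Let ctau : continuous (fst : Z -> G). Proof. by move=> p; exact: cvg_fst. Qed.

Let dm : {measure set (borel Z) -> \bar R} := density rho v0 mv.

Let dmT : dm setT = I%:E. Proof. exact: vI. Qed.

Let idm : inner_regular dm. Proof. exact: density_inner_regular. Qed.

Let dmoo : (dm setT < +oo)%E. Proof. by rewrite dmT ltry. Qed.

(** The quantity that controls the integrand of [loc f x] for all [f] at once. *)
Definition window_energy (x : G) : \bar R :=
  (\int[rho]_z (normc (u z) * W (z.1^-1 * x)%g ^+ 2)%:E)%E.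

Let mtW (x : G) :
  measurable_fun [set: borel Z] (fun z => W ((z : Z).1^-1 * x)%g).
Proof.
have c : continuous (fun z : Z => (z.1^-1 * x)%g).
  by apply: continuous_mulg; [exact: continuous_invg|move=> z; exact: cvg_cst].
exact: (measurableT_comp (measurable_window _ calpha mtheta) (continuous_borel c)).
Qed.

Let energyE x : window_energy x =
  (\int[dm]_z (fun y => (W y ^+ 2)%:E) ((z : Z).1^-1 * x)%g)%E.
Proof.
rewrite /dm ge0_integral_density.
- by apply: eq_integral => z _; rewrite -EFinM mulrC.
- by apply/measurable_EFinP/measurable_funX; exact: mtW.
- by move=> z; rewrite lee_fin sqr_ge0.
Qed.

Lemma window_energy_ge0 x : (0 <= window_energy x)%E.
Proof.
by apply: integral_ge0 => z _; rewrite lee_fin mulr_ge0 ?sqr_ge0 ?normc_ge0.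
Qed.

Lemma measurable_window_energy :
  measurable_fun [set: borel G] (window_energy : borel G -> \bar R).
Proof.
rewrite (_ : window_energy = fun x : borel G =>
   (\int[dm]_z (fun y => (W y ^+ 2)%:E) ((z : Z).1^-1 * x)%g)%E); last first.
  by apply/funext => x; exact: energyE.
exact: (measurable_translate_integral hZ idm dmoo ctau mW2 W20).
Qed.

(** Translates of the window have the same norm, so that [translate_tonelli] applies
    to the finite measure [|u| rho] and the projection to [G]. *)
Lemma integral_window_energy : (\int[mu]_x window_energy x <= I%:E)%E.
Proof.
under eq_integral do rewrite energyE.
apply: le_trans (translate_tonelli hG hmu hZ idm dmoo ctau mW2 W20) _.
by rewrite dmT (integral_window calpha mod_delta mtheta theta1) mule1.
Qed.

Definition finite_energy : set G := [set x | (window_energy x < +oo)%E].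

Lemma measurable_finite_energy : measurable (finite_energy : set (borel G)).
Proof.
rewrite -[finite_energy]setTI.
by apply: emeasurable_fun_infty_o => //; exact: measurable_window_energy.
Qed.

Lemma ae_finite_energy : {ae mu, forall x : borel G, finite_energy x}.
Proof.
have ie : mu.-integrable setT (window_energy : borel G -> \bar R).
  apply/integrableP; split; first exact: measurable_window_energy.
  under eq_integral do rewrite gee0_abs ?window_energy_ge0//.
  exact: le_lt_trans integral_window_energy (ltry _).
have := integrable_ae measurableT ie.
apply: filterS => x /(_ Logic.I); rewrite /finite_energy /=.
by rewrite ge0_fin_numE// window_energy_ge0.
Qed.

(** The cutoff makes [loc] linear at every point: off [finite_energy] the integral
    may diverge and its conventional value is not additive in [f]. *)
Definition loc (f : G -> R[i]) : G -> R[i] := fun x =>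
  (\1_finite_energy x)%:C%C * localization rho theta alpha delta u f x.

Section one_function.
Variable f : G -> R[i].
Hypothesis f2 : cLp mu 2 f.
Local Notation ig := (localization_integrand theta alpha delta u f).

Lemma integrand_cmeasurable :
  @cmeasurable _ (borel (G * Z)%type) _ (fun p => ig p.1 p.2).
Proof.
have c2 : measurable_fun [set: borel (G * Z)%type]
    ((fun p : G * Z => p.2) : borel (G * Z)%type -> borel Z).
  by apply: continuous_borel => p; exact: cvg_snd.
apply: cmeasurableM; first apply: cmeasurableM.
- exact: (cmeasurable_comp c2 mu_).
- have := stockwell_cmeasurable hG lcG hmu cptK delta calpha mtheta f2.
  exact: (cmeasurable_comp c2).
- apply: (@atom_cmeasurable _ _ mu hG lcG hmu K cptK alpha delta theta calpha
    mtheta (G * Z)%type snd fst) => p; [exact: cvg_snd|exact: cvg_fst].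
Qed.

Lemma integrand_section_cmeasurable x : @cmeasurable _ (borel Z) _ (ig x).
Proof.
apply: (@cmeasurable_comp _ (borel (G * Z)%type) _ _ (borel Z)
  (fun z => (x, z)) (fun p => ig p.1 p.2)); last exact: integrand_cmeasurable.
by apply: continuous_borel => z; exact: cvg_pair (cvg_cst _) cvg_id.
Qed.

Let cbound (c : R) : 0 <= c -> (\int[mu]_x (normc (f x) ^+ 2)%:E <= (c ^+ 2)%:E)%E ->
  forall x z, normc (ig x z) <= c * (v z * W (z.1^-1 * x)%g).
Proof.
move=> c0 fc x z; rewrite /localization_integrand.
move: (atom _ _ _ _ _ _) (normc_atom_le hG lcG hmu cptK alpha delta theta z.1 z.2 x).
move=> A leA; rewrite !ComplexField.Normc.normcM.
rewrite /v mulrCA -mulrA ler_wpM2l ?normc_ge0//; apply: ler_pM; rewrite ?normc_ge0//.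
exact: normc_stockwell_le.
Qed.

Let mvW x : measurable_fun [set: borel Z] (fun z => v z * W ((z : Z).1^-1 * x)%g).
Proof. exact: measurable_funM. Qed.

(** Cauchy-Schwarz with the two factors [sqrt v] and [sqrt v * W]. *)
Let vW_le x : finite_energy x ->
  (\int[rho]_z (v z * W (z.1^-1 * x)%g)%:E <=
     (Num.sqrt I * Num.sqrt (fine (window_energy x)))%:E)%E.
Proof.
move=> ex.
have e0 : 0 <= fine (window_energy x) by rewrite fine_ge0 ?window_energy_ge0.
have sv z : Num.sqrt (v z) ^+ 2 = v z by rewrite sqr_sqrtr.
have msv : measurable_fun setT (fun z => Num.sqrt (v z)).
  apply: (measurableT_comp (f := @Num.sqrt R)) => //.
  by apply: continuous_measurable_fun; exact: sqrt_continuous.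
rewrite (eq_integral (fun z => (Num.sqrt (v z) *
  (Num.sqrt (v z) * W (z.1^-1 * x)%g))%:E)); last first.
  by move=> z _; rewrite mulrA -expr2 sv.
apply: integral_mul_le; rewrite ?sqrtr_ge0//.
- exact: measurable_funM.
- by move=> z; rewrite mulr_ge0 ?sqrtr_ge0 ?window_ge0.
- by under eq_integral do rewrite sv; rewrite vI sqr_sqrtr.
- under eq_integral do rewrite exprMn sv.
  rewrite sqr_sqrtr// fineK// ge0_fin_numE//; exact: window_energy_ge0.
Qed.

Let dominating_le (c : R) x : 0 <= c -> finite_energy x ->
  (\int[rho]_z (c * (v z * W (z.1^-1 * x)%g))%:E <=
     (c * (Num.sqrt I * Num.sqrt (fine (window_energy x))))%:E)%E.
Proof.
move=> c0 ex; under eq_integral do rewrite EFinM.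
rewrite ge0_integralZl_EFin//.
- by rewrite EFinM lee_wpmul2l//; exact: vW_le.
- by move=> z _; rewrite lee_fin mulr_ge0// window_ge0.
- exact/measurable_EFinP.
Qed.

Let dominating_integrable (c : R) x : 0 <= c -> finite_energy x ->
  rho.-integrable setT (EFin \o (fun z => c * (v z * W (z.1^-1 * x)%g))).
Proof.
move=> c0 ex; apply: integrable_ge0; first exact: measurable_funM.
- by move=> z; rewrite mulr_ge0// mulr_ge0// window_ge0.
- exact: le_lt_trans (dominating_le c0 ex) (ltry _).
Qed.

Lemma integrand_integrable x : finite_energy x -> cintegrable rho (ig x).
Proof.
move=> ex; have [c [c0 fc]] := cLp2_bound f2.
exact: (cintegrable_bound (integrand_section_cmeasurable x)
  (dominating_integrable c0 ex) (cbound c0 fc x)).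
Qed.

Lemma loc_cmeasurable : @cmeasurable _ (borel G) _ (loc f).
Proof.
apply: cmeasurableM.
  by apply: cmeasurable_real; exact: measurable_indic measurable_finite_energy.
apply: (@cmeasurable_section_cintegral R G Z rho v (fun p => ig p.1 p.2)) => //.
  exact: integrand_cmeasurable.
move=> x z /ComplexField.Normc.eq0_normc uz.
by rewrite /localization_integrand /= uz !mul0r.
Qed.

Lemma normc_loc_le (c : R) x : 0 <= c ->
  (\int[mu]_x (normc (f x) ^+ 2)%:E <= (c ^+ 2)%:E)%E ->
  ((normc (loc f x) ^+ 2)%:E <= (c ^+ 2 * I)%:E * window_energy x)%E.
Proof.
move=> c0 fc; rewrite /loc indicE.
have E0 := window_energy_ge0 x.
case: (boolP (x \in finite_energy)) => [|_]; last first.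
  rewrite mul0r ComplexField.Normc.normc0 expr0n/=.
  by rewrite mule_ge0// lee_fin mulr_ge0// sqr_ge0.
rewrite inE => ex; rewrite mul1r.
have e0 : 0 <= fine (window_energy x) by rewrite fine_ge0.
have Efin : window_energy x \is a fin_num by rewrite ge0_fin_numE.
have n1 : normc (localization rho theta alpha delta u f x) <=
    c * (Num.sqrt I * Num.sqrt (fine (window_energy x))).
  exact: (normc_cintegral (integrand_integrable ex)
    (dominating_integrable c0 ex) (cbound c0 fc x) (dominating_le c0 ex)).
rewrite -(fineK Efin) -EFinM lee_fin.
have -> : c ^+ 2 * I * fine (window_energy x) =
    (c * (Num.sqrt I * Num.sqrt (fine (window_energy x)))) ^+ 2.
  by rewrite !exprMn !sqr_sqrtr// mulrA.
by rewrite ler_pXn2r// nnegrE ?normc_ge0// !mulr_ge0// sqrtr_ge0.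
Qed.

Lemma integral_loc_le (c : R) : 0 <= c ->
  (\int[mu]_x (normc (f x) ^+ 2)%:E <= (c ^+ 2)%:E)%E ->
  (\int[mu]_x (normc (loc f x) ^+ 2)%:E <= ((I * c) ^+ 2)%:E)%E.
Proof.
move=> c0 fc.
apply: (@le_trans _ _ (\int[mu]_x ((c ^+ 2 * I)%:E * window_energy x))%E).
  apply: ge0_le_integral => //.
  - by move=> x _; rewrite lee_fin sqr_ge0.
  - by apply/measurable_EFinP; apply: measurable_sqr_normc; exact: loc_cmeasurable.
  - apply: emeasurable_funM => //; exact: measurable_window_energy.
  - by move=> x _; exact: normc_loc_le.
rewrite ge0_integralZl_EFin//.
- have -> : (I * c) ^+ 2 = c ^+ 2 * I * I by rewrite exprMn mulrC -mulrA -expr2.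
  rewrite [in leRHS]EFinM lee_wpmul2l//; last exact: integral_window_energy.
  by rewrite lee_fin mulr_ge0// sqr_ge0.
- by move=> x _; exact: window_energy_ge0.
- exact: measurable_window_energy.
- by rewrite mulr_ge0// sqr_ge0.
Qed.

Lemma ae_loc : {ae mu, forall x : borel G,
  cintegrable rho (ig x) /\ loc f x = localization rho theta alpha delta u f x}.
Proof.
have := ae_finite_energy; apply: (@filterS _ _ (ae_filter_ringOfSetsType mu)) => x ex.
split; first exact: integrand_integrable.
by rewrite /loc indicE mem_set// mul1r.
Qed.

End one_function.

Lemma loc_linear (a b : R[i]) f g : cLp mu 2 f -> cLp mu 2 g ->
  loc (fun y => a * f y + b * g y) = fun x => a * loc f x + b * loc g x.
Proof.
move=> f2 g2; apply/funext => x; rewrite /loc indicE.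
case: (boolP (x \in finite_energy)) => [|_]; last first.
  move: (localization _ _ _ _ _ _ _) (localization _ _ _ _ _ f x)
    (localization _ _ _ _ _ g x) => p q r.
  by rewrite !mul0r !mulr0 addr0.
rewrite inE => ex.
have If := integrand_integrable f2 ex; have Ig := integrand_integrable g2 ex.
suff -> : localization rho theta alpha delta u (fun y => a * f y + b * g y) x =
    a * localization rho theta alpha delta u f x +
    b * localization rho theta alpha delta u g x.
  move: (localization _ _ _ _ _ f x) (localization _ _ _ _ _ g x) => p q.
  by rewrite !mul1r.
rewrite /localization -!cintegralZ// -cintegralD; last 2 first.
- exact: cintegrableZ.
- exact: cintegrableZ.
congr cintegral; apply/funext => z; rewrite /localization_integrand.
rewrite (stockwell_linear hG lcG hmu cptK calpha mod_delta mtheta theta1)//.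
move: (stockwell _ _ _ _ f _ _) (stockwell _ _ _ _ g _ _) (atom _ _ _ _ _ _).
by move: (u z) => p q r w; ring.
Qed.

End localization_operator.

(** * Compression to the bi-invariant functions *)

Lemma opnorm_le d (T : measurableType d) (R : realType)
    (m : {measure set T -> \bar R}) (E : set (T -> R[i]))
    (L : (T -> R[i]) -> (T -> R[i])) (c : R) : 0 <= c ->
  (forall f, E f -> (\int[m]_x (normc (f x) ^+ 2)%:E <= (1 ^+ 2)%:E)%E ->
     (\int[m]_x (normc (L f x) ^+ 2)%:E <= (c ^+ 2)%:E)%E) ->
  (opnorm m E L <= c%:E)%E.
Proof.
move=> c0 Lc; apply: ge_ereal_sup => _ [f [Ef f1] <-].
by apply/cLnorm2_le => //; apply: Lc => //; apply/cLnorm2_le.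
Qed.

Section biinvariant_projection.
Context {R : realType} {G : topologicalGroupType}.
Variable mu : {measure set (borel G) -> \bar R}.
Variable K : set G.
Local Notation LpK2 := (LpK mu K 2).
Implicit Types f g h p : G -> R[i].

Let r (x y : G) : Prop := exists k k', [/\ K k, K k' & x = (k * y * k')%g].

Let LpK2P f : LpK2 f <->
  @L2inv _ (borel G) _ mu r (fun x => Re (f x)) /\
  @L2inv _ (borel G) _ mu r (fun x => Im (f x)).
Proof.
split=> [[/cLp2P[fr fi] bf]|[[fr rr] [fi ri]]].
  by split; split => // x y [k [k' [Kk Kk' ->]]]; rewrite bf.
split; first exact/cLp2P.
by move=> x k k' Kk Kk'; apply: complex_ext; [apply: rr|apply: ri]; exists k, k'.
Qed.

Lemma LpK_lin (a b : R[i]) f g : LpK2 f -> LpK2 g ->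
  LpK2 (fun x => a * f x + b * g x).
Proof.
move=> [f2 bf] [g2 bg]; split; first exact: cLp2_lin.
by move=> x k k' Kk Kk'; rewrite bf// bg.
Qed.

(** [|p|^2 = <h, p>], and [0 <= |h - p|^2 = |h|^2 - |p|^2]. *)
Let ip_projection_le (h p : borel G -> R) : square_integrable mu h ->
  square_integrable mu p -> ip mu p p = ip mu h p -> ip mu p p <= ip mu h h.
Proof.
move=> h2 p2 e; have := ip_ge0 mu (fun x => h x - 1 * p x).
by rewrite ip_subZ//; lra.
Qed.

(** The complex projection is the real one on real and imaginary parts, as the
    subspace is stable under conjugation. *)
Lemma LpK_projection h : cLp mu 2 h -> exists p,
  [/\ LpK2 p, forall g, LpK2 g -> inner mu p g = inner mu h g &
      (\int[mu]_x (normc (p x) ^+ 2)%:E <= \int[mu]_x (normc (h x) ^+ 2)%:E)%E].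
Proof.
move=> h2; have /cLp2P[hr hi] := h2.
have [pr [ppr Er]] := @L2_projection _ (borel G) _ _ r _ hr.
have [pi [ppi Ei]] := @L2_projection _ (borel G) _ _ r _ hi.
pose p x := (pr x +i* pi x)%C.
have Lp : LpK2 p by exact/LpK2P.
have p2 : cLp mu 2 p by case: Lp.
exists p; split => //.
  move=> g Lg; have g2 : cLp mu 2 g by case: Lg.
  have /LpK2P[gr gi] := Lg.
  by apply: complex_ext; rewrite ?Re_inner// ?Im_inner//= !(Er, Ei).
have mp : @cmeasurable _ (borel G) _ p by case: p2.
have mh : @cmeasurable _ (borel G) _ h by case: h2.
rewrite !integral_sqr_normc// !ip_sqrE//; last 2 first.
- by case: ppi.
- by case: ppr.
rewrite -!EFinD lee_fin lerD//; apply: ip_projection_le => //.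
- by case: ppr.
- exact: Er.
- by case: ppi.
- exact: Ei.
Qed.

(** Projecting values is linear only up to null sets, since representatives are
    chosen; almost-everywhere linearity follows from the uniqueness of a
    bi-invariant function with given inner products ([inner_eq_ae]). *)
Lemma LpK_compression (L : (G -> R[i]) -> (G -> R[i])) (c : R) : 0 <= c ->
  (forall f, LpK2 f -> cLp mu 2 (L f)) ->
  (forall (a b : R[i]) f g, LpK2 f -> LpK2 g ->
     L (fun y => a * f y + b * g y) = fun x => a * L f x + b * L g x) ->
  (forall f, LpK2 f -> (\int[mu]_x (normc (f x) ^+ 2)%:E <= (1 ^+ 2)%:E)%E ->
     (\int[mu]_x (normc (L f x) ^+ 2)%:E <= (c ^+ 2)%:E)%E) ->
  exists L' : (G -> R[i]) -> (G -> R[i]),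
    [/\ forall f g, LpK2 f -> LpK2 g -> inner mu (L' f) g = inner mu (L f) g,
        bounded_operator mu LpK2 LpK2 L' & (opnorm mu LpK2 L' <= c%:E)%E].
Proof.
move=> c0 L2 Llin Lc.
have exP f : exists p, LpK2 f -> [/\ LpK2 p,
    forall g, LpK2 g -> inner mu p g = inner mu (L f) g &
    (\int[mu]_x (normc (p x) ^+ 2)%:E <= \int[mu]_x (normc (L f x) ^+ 2)%:E)%E].
  have [Lf|nLf] := pselect (LpK2 f); last by exists f.
  by have [p Hp] := LpK_projection (L2 f Lf); exists p.
pose L' f := projT1 (cid (exP f)).
have HL' f : LpK2 f -> [/\ LpK2 (L' f),
    forall g, LpK2 g -> inner mu (L' f) g = inner mu (L f) g &
    (\int[mu]_x (normc (L' f x) ^+ 2)%:E <= \int[mu]_x (normc (L f x) ^+ 2)%:E)%E].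
  exact: (projT2 (cid (exP f))).
have oL' : (opnorm mu LpK2 L' <= c%:E)%E.
  apply: opnorm_le => // f Kf f1; have [_ _ le] := HL' f Kf.
  exact: le_trans le (Lc f Kf f1).
exists L'; split => //.
- by move=> f g Kf Kg; have [_ E _] := HL' f Kf; exact: E.
- split; last exact: le_lt_trans oL' (ltry _).
    by move=> f Kf; have [] := HL' f Kf.
  move=> a b f g Kf Kg; have [Pf Ef _] := HL' f Kf; have [Pg Eg _] := HL' g Kg.
  have Kfg : LpK2 (fun y => a * f y + b * g y) by exact: LpK_lin.
  have [Pfg Efg _] := HL' _ Kfg.
  have P2 : LpK2 (fun x => a * L' f x + b * L' g x) by exact: LpK_lin.
  apply: inner_eq_ae; [by case: Pfg|by case: P2|].
  set e := (X in inner mu _ X); have Ke : LpK2 e by exact: LpK_lin.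
  have e2 : cLp mu 2 e by case: Ke.
  rewrite Efg// Llin// !inner_lin//; try exact: L2.
  + by rewrite Ef// Eg.
  + by case: Pf.
  + by case: Pg.
Qed.

End biinvariant_projection.
Theorem theorem4p3 (R : realType) (G : topologicalGroupType)
    (hausG : hausdorff_space G) (lcG : locally_compact [set: G])
    (mu : {measure set (borel G) -> \bar R}) (haar_mu : left_haar mu)
    (K : set G) (cptK : compact_subgroup K) (gelfand : gelfand_pair mu K)
    (nu : {measure set (borel (Splus_type mu K)) -> \bar R})
    (plancherel_nu : plancherel nu)
    (rho : {measure set (borel (G * Splus_type mu K)%type) -> \bar R})
    (prod_rho : radon_product mu nu rho)
    (alpha : G -> G) (aut_alpha : topological_automorphism alpha)
    (delta : R) (mod_delta : modulus mu alpha delta)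
    (theta : G -> R[i]) (L2theta : LpK mu K 2 theta)
    (theta1 : cLnorm mu 2 theta = 1%E)
    (u : G * Splus_type mu K -> R[i]) (L1u : cLp rho 1 u) :
  exists L : (G -> R[i]) -> (G -> R[i]),
    [/\ forall f, LpK mu K 2 f -> {ae mu, forall x,
          cintegrable rho (localization_integrand theta alpha delta u f x) /\
          L f x = localization rho theta alpha delta u f x},
        bounded_operator mu (LpK mu K 2) (cLp mu 2) L,
        (opnorm mu (LpK mu K 2) L <= cLnorm rho 1 u)%E &
        exists L' : (G -> R[i]) -> (G -> R[i]),
          [/\ forall f g, LpK mu K 2 f -> LpK mu K 2 g ->
                inner mu (L' f) g = inner mu (L f) g,
              bounded_operator mu (LpK mu K 2) (LpK mu K 2) L' &
              (opnorm mu (LpK mu K 2) L' <= cLnorm rho 1 u)%E]].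
Proof.
have calpha : continuous alpha by case: aut_alpha.
have rrho : @radon R (G * Splus_type mu K)%type rho by case: prod_rho.
have mtheta : @cmeasurable _ (borel G) _ theta by case: L2theta => -[].
have IE : ((fine (cLnorm rho 1 u))%:E = cLnorm rho 1 u)%E.
  case: L1u => _ uoo; rewrite fineK// ge0_fin_numE//.
  exact: Lnorm_ge0.
have I0 : 0 <= fine (cLnorm rho 1 u) by rewrite -lee_fin IE Lnorm_ge0.
pose L := loc rho alpha delta theta u.
have Lc f : LpK mu K 2 f ->
    (\int[mu]_x (normc (f x) ^+ 2)%:E <= (1 ^+ 2)%:E)%E ->
    (\int[mu]_x (normc (L f x) ^+ 2)%:E <= (fine (cLnorm rho 1 u) ^+ 2)%:E)%E.
  move=> [f2 _] f1; rewrite -[X in (X ^+ 2)%:E]mulr1.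
  exact: integral_loc_le f1.
have L2 f : LpK mu K 2 f -> cLp mu 2 (L f).
  move=> [f2 bf]; split; first exact: loc_cmeasurable.
  apply/cLnorm2_lty.
  have [c [c0 fc]] := cLp2_bound f2.
  exact: le_lt_trans (integral_loc_le _ _ _ _ _ _ _ _ _ _ f2 c0 fc) (ltry _).
have Llin (a b : R[i]) f g : LpK mu K 2 f -> LpK mu K 2 g ->
    L (fun y => a * f y + b * g y) = fun x => a * L f x + b * L g x.
  by move=> [f2 _] [g2 _]; exact: loc_linear.
have oL : (opnorm mu (LpK mu K 2) L <= cLnorm rho 1 u)%E.
  by rewrite -IE; exact: opnorm_le.
exists L; split => //.
- by move=> f [f2 _]; exact: ae_loc.
- split => //.
    by move=> a b f g Kf Kg; apply: aeW => x; rewrite Llin.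
  by apply: le_lt_trans oL _; case: L1u.
- by have := LpK_compression I0 L2 Llin Lc; rewrite IE.
Qed.
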